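(* Let $\mathcal{D}\subset\mathbb{R}^N$ be open, bounded, connected and walk-regular. Then for every continuous $F:\partial\mathcal{D}\to\mathbb{R}$, the family $\{u^\epsilon\}_{\epsilon\in(0,1)}$, $u^\epsilon(x)=\mathbb{E}[F\circ X^{\epsilon,x}]$, satisfies $u^\epsilon\to u$ as $\epsilon\to0$, where $u\in C(\bar{\mathcal{D}})$ is the unique solution of the boundary value problem $\Delta u=0$ in $\mathcal{D}$, $u=F$ on $\partial\mathcal{D}$.
   Context: Probability space: $\Omega_1=B_1(0)\subset\mathbb{R}^N$ with Borel $\sigma$-algebra and normalised Lebesgue measure; $(\Omega,\mathcal{F},\mathbb{P})$ is the countable product $\Omega=(\Omega_1)^{\mathbb{N}}$, $\omega=\{w_i\}_{i\ge1}$. The $\epsilon$-ball walk started at $x\in\mathcal{D}$: $X_0^{\epsilon,x}\equiv x$, $X_n^{\epsilon,x}=X_{n-1}^{\epsilon,x}+\big(\epsilon\wedge\operatorname{dist}(X_{n-1}^{\epsilon,x},\partial\mathcal{D})\big)w_n$ for $n\ge1$; it converges $\mathbb{P}$-a.s. to a random variable $X^{\epsilon,x}:\Omega\to\partial\mathcal{D}$. A point $y_0\in\partial\mathcal{D}$ is walk-regular if for every $\eta,\delta>0$ there exist $\hat\delta\in(0,\delta)$ and $\hat\epsilon\in(0,1)$ such that $\mathbb{P}(X^{\epsilon,x_0}\in B_\delta(y_0))\ge1-\eta$ for all $\epsilon\in(0,\hat\epsilon)$ and all $x_0\in B_{\hat\delta}(y_0)\cap\mathcal{D}$; $\mathcal{D}$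 is walk-regular if every $y_0\in\partial\mathcal{D}$ is walk-regular. *)

(* Defs.v *)
From HB Require Import structures.
From mathcomp Require Import all_boot all_order all_algebra.
From mathcomp Require Import all_classical all_reals all_analysis.

Set Implicit Arguments.
Unset Strict Implicit.
Unset Printing Implicit Defensive.

Import Order.TTheory GRing.Theory Num.Theory.
Import numFieldNormedType.Exports.

Local Open Scope classical_set_scope.
Local Open Scope ring_scope.

Section BallWalk.
Context {R : realType} {N : nat}.
Local Notation V := 'rV[R]_N.

(* Euclidean norm on R^N (the library norm on matrices is the max norm;
   it induces the same topology, but balls and distances below must be
   Euclidean). *)
Definition enorm (x : V) : R := Num.sqrt (\sum_(i < N) (x ord0 i) ^+ 2).

Definition eball (y : V) (r : R) : set V := [set z | enorm (z - y) < r].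

Definition bdry (D : set V) : set V := closure D `\` interior D.

Definition dist_bdry (D : set V) (y : V) : R :=
  inf [set enorm (y - z) | z in bdry D].

Definition borelN (A : set V) : Prop :=
  <<s [set U : set V | open U] >> A.

(* N-dimensional Lebesgue measure of a (Borel) set, computed as the
   iterated one-dimensional Lebesgue integral of its indicator
   (Fubini--Tonelli).  Coordinate k'-1 is integrated outermost. *)
Fixpoint iint (k : nat) (g : (nat -> R) -> \bar R) (x : nat -> R) : \bar R :=
  if k is k'.+1 then
    (\int[lebesgue_measure]_t iint k' g (fun j => if j == k' then t else x j))%E
  else g x.

Definition lebN (A : set V) : \bar R :=
  iint N (fun x => (\1_A (\row_(i < N) x (nat_of_ord i)) : R)%:E) (fun _ => 0).

(* The sequence w = (w_1, w_2, ...) (here indexed from 0) of random vectors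
   is i.i.d. with law the normalised Lebesgue measure on B_1(0). *)
Definition iid_uniform_ball {d : measure_display} {T : measurableType d}
    (P : probability T R) (w : nat -> T -> V) : Prop :=
  [/\ (forall k (A : set V), borelN A -> measurable (w k @^-1` A)),
      (forall k (A : set V), borelN A ->
         P (w k @^-1` A) =
         (fine (lebN (A `&` eball 0 1)) / fine (lebN (eball 0 1)))%:E) &
      (forall (s : seq nat) (A : nat -> set V), uniq s ->
         (forall k, borelN (A k)) ->
         P (\bigcap_(k in [set` s]) (w k @^-1` A k)) =
         (\big[*%E/1%E]_(k <- s) P (w k @^-1` A k))%E)].

Section Walk.
Context {T : Type} (w : nat -> T -> V) (D : set V).

Fixpoint walk (eps : R) (x : V) (n : nat) (t : T) : V :=
  if n is n'.+1 then
    let y := walk eps x n' t in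
    y + Num.min eps (dist_bdry D y) *: w n' t
  else x.

(* The limit X^{eps,x} (which exists almost surely). *)
Definition Xlim (eps : R) (x : V) (t : T) : V :=
  limn (fun n => walk eps x n t).
End Walk.

Definition walk_regular_point {d : measure_display} {T : measurableType d}
    (P : probability T R) (w : nat -> T -> V) (D : set V) (y0 : V) : Prop :=
  forall eta delta : R, 0 < eta -> 0 < delta ->
  exists dh eh : R, [/\ 0 < dh, dh < delta, 0 < eh, eh < 1 &
    forall eps x0, 0 < eps -> eps < eh -> eball y0 dh x0 -> D x0 ->
      ((1 - eta)%:E <= P [set t | eball y0 delta (Xlim w D eps x0 t)])%E].

Definition walk_regular {d : measure_display} {T : measurableType d}
    (P : probability T R) (w : nat -> T -> V) (D : set V) : Prop :=
  forall y0, bdry D y0 -> walk_regular_point P w D y0.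

Definition u_eps {d : measure_display} {T : measurableType d}
    (P : probability T R) (w : nat -> T -> V) (D : set V) (F : V -> R)
    (eps : R) (x : V) : R :=
  fine (\int[P]_t (F (Xlim w D eps x t))%:E)%E.

Definition evec (i : 'I_N) : V := delta_mx ord0 i.

Definition laplacian (u : V -> R) (x : V) : R :=
  \sum_(i < N) 'D_(evec i) ('D_(evec i) u) x.

Definition C2_on (D : set V) (u : V -> R) : Prop :=
  [/\ (forall x, D x -> differentiable u x),
      (forall i x, D x -> differentiable ('D_(evec i) u) x) &
      (forall i j x, D x -> {for x, continuous ('D_(evec j) ('D_(evec i) u))})].

Definition dirichlet_solution (D : set V) (F : V -> R) (u : V -> R) : Prop :=
  [/\ C2_on D u,
      (forall x, D x -> laplacian u x = 0),
      {within closure D, continuous u} &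
      (forall y, bdry D y -> u y = F y)].

End BallWalk.

(* Main.v *)
(* Away from the boundary, u^eps equals its average over the ball of radius eps
   with respect to the law of a step, which is isotropic: it is invariant under
   coordinate reflections, centred, and its covariance is a multiple of the identity.
   Adding a small multiple of |x|^2 turns this into a discrete maximum principle.
   Walk-regularity and compactness control u^eps uniformly near the boundary, and
   the maximum principle applied to u^eps(x + h) - u^eps(x) carries this control
   inside, so that the family is equicontinuous up to o(1) on the closure of D.
   Hence u^eps converges uniformly along every ultrafilter finer than eps -> 0+.

   Let f be a local uniform limit of functions with the mean value property at
   scales tending to 0. Then f - q has no local maximum when q is a quadratic
   polynomial with negative Laplacian. The reflection and barrier argument of
   Gilbarg-Trudinger, Section 3.4, deduces from this alone an interior gradient bound.
   Applied to difference quotients, which are limits of the same kind, it shows that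
   the partial derivatives exist and are again such limits; so f is C^2, and Taylor's
   formula gives Laplacian 0.

   The solution of the Dirichlet problem being unique, the limit is the same along
   all ultrafilters, which is convergence as eps -> 0. *)
Require Import Defs.
From HB Require Import structures.
From mathcomp Require Import all_boot all_order all_algebra.
From mathcomp Require Import all_classical all_reals all_analysis.
From mathcomp Require Import perm measurable_realfun ring lra.
Import Order.TTheory GRing.Theory Num.Theory.
Import numFieldNormedType.Exports.
Set Implicit Arguments.
Unset Strict Implicit.
Unset Printing Implicit Defensive.
Local Open Scope classical_set_scope.
Local Open Scope ring_scope.

(** * Borel sets and the Euclidean norm *)

(** The law of a step is given only through iterated one-dimensional integrals, so the symmetries
    drawn from it are those visible there: a sign change in one variable and, by Tonelli, the
    exchange of two consecutive ones. Reflections preserve the cubes [|x - x0| < r] of the max norm,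
    on which the local analysis takes place. The functions u^eps are merely Borel in the starting
    point: they may fail to attain a supremum, and they cannot be differentiated. The quadratic
    perturbation answers the first difficulty, because it gains a multiple of eps^2 per step and so
    excludes even points close to the supremum; passing to the limit before differentiating answers
    the second. Two obstacles come from the definitions: [Xlim] has a default value where the walk
    diverges, so almost sure convergence to the boundary has to be proved, and [F] is arbitrary off
    the boundary, so it is traded for a continuous bounded extension [G]. Ultrafilters stand in for
    Arzela-Ascoli: a bounded family converges pointwise along each of them. *)

Section Borel.
Context {R : realType} {N : nat}.
Local Notation V := 'rV[R]_N.

(** An alias of the row vectors whose measurable sets are, by conversion, the sets in [borelN], so
    that the hypotheses of [iid_uniform_ball] apply as they stand. *)
Definition borelV := g_sigma_algebraType [set U : set V | open U].

HB.instance Definition _ := Measurable.on borelV.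

Lemma coord_le_norm (x : V) i : `|x ord0 i| <= `|x|.
Proof.
rewrite [leRHS]/Num.norm /= mx_normrE.
by apply/bigmax_geP; right => /=; exists (ord0, i).
Qed.

Lemma norm_lt_coord (x : V) r : 0 < r -> (forall i, `|x ord0 i| < r) -> `|x| < r.
Proof.
move=> r0 xr; rewrite [ltLHS]/Num.norm /= mx_normrE; apply/bigmax_ltP; split => //.
by move=> [i j] _ /=; rewrite ord1.
Qed.

Lemma norm_le_coord (x : V) r : 0 <= r -> (forall i, `|x ord0 i| <= r) -> `|x| <= r.
Proof.
move=> r0 xr; rewrite [leLHS]/Num.norm /= mx_normrE; apply/bigmax_leP; split => //.
by move=> [i j] _ /=; rewrite ord1.
Qed.

(** An open set is the countable union of the cubes [S p] with rational centre and radius 1/(k+1)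
    that it contains, and membership in a cube is a finite conjunction of conditions on
    coordinates. *)
Lemma measurable_borelV d (T : measurableType d) (f : T -> borelV) :
  (forall i, measurable_fun setT (fun t => f t ord0 i)) ->
  measurable_fun setT f.
Proof.
move=> mf; apply: (@measurability _ _ _ _ setT f [set U : set V | open U]) => //.
move=> _ [U oU <-]; rewrite setTI.
pose q2r (q : 'rV[rat]_N) : V := map_mx ratr q.
pose S (p : 'rV[rat]_N * nat) : set V := ball (q2r p.1) (p.2.+1%:R^-1).
pose W p := if `[< S p `<=` U >] then f @^-1` S p else set0.
have -> : f @^-1` U = \bigcup_p W p.
  apply/seteqP; split => [t Ut|t [p _]]; last first.
    by rewrite /W; case: asboolP => // + St; exact.
  have /nbhs_ballP[e /= e0 eU] : nbhs (f t) U by exact: open_nbhs_nbhs.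
  have [k ke] : exists k, k.+1%:R^-1 < e / 2.
    have [k _ hk] := @near_infty_natSinv_lt R (PosNum (divr_gt0 e0 (ltr0Sn _ 1))).
    by exists k; apply: hk => /=.
  have k0 : 0 < k.+1%:R^-1 :> R by rewrite invr_gt0.
  have /choice[q hq] : forall i, exists q : rat, `|ratr q - f t ord0 i| < k.+1%:R^-1.
    move=> i; have : f t ord0 i - k.+1%:R^-1 < f t ord0 i + k.+1%:R^-1.
      by rewrite ltrBlDr -addrA ltrDl addr_gt0.
    move=> /rat_in_itvoo[q /itvP qq]; exists q.
    by rewrite ltr_distl !qq.
  exists (\row_i q i, k) => //; rewrite /W.
  have Sp : S (\row_i q i, k) (f t).
    rewrite /S -ball_normE /=; apply: norm_lt_coord => // i.
    by rewrite !mxE.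
  case: asboolP => // -[] y; rewrite /S -ball_normE /= => qy; apply: eU.
  rewrite -ball_normE /= (le_lt_trans (ler_distD (q2r (\row_i q i)) _ _))//.
  move: Sp; rewrite /S -ball_normE /= => Sp; rewrite (splitr e) ltrD//.
    by rewrite distrC (lt_trans Sp).
  by rewrite (lt_trans qy).
apply: countable_bigcupT_measurable => [|p]; first exact: countableP.
rewrite /W; case: asboolP => // _.
have -> : f @^-1` S p =
    \bigcap_(i in [set: 'I_N]) [set t | `|q2r p.1 ord0 i - f t ord0 i| < p.2.+1%:R^-1].
  apply/seteqP; split => t; rewrite /S -ball_normE /=.
    move=> h i _ /=; apply: le_lt_trans h.
    by have := coord_le_norm (q2r p.1 - f t) i; rewrite !mxE.
  move=> h; apply: norm_lt_coord; first by rewrite invr_gt0.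
  by move=> i; have := h i I; rewrite /= !mxE.
apply: fin_bigcap_measurable => // i _.
have mg : measurable_fun setT (fun t => `|q2r p.1 ord0 i - f t ord0 i|).
  by apply: measurableT_comp => //; apply: measurable_funB.
have := mg measurableT _ (measurable_itv `]-oo, (p.2.+1%:R^-1 : R)[).
by rewrite setTI set_itvE.
Qed.

Lemma measurable_continuousV (f : V -> R) :
  continuous f -> measurable_fun setT (f : borelV -> R).
Proof.
move=> /continuousP cf.
apply: (measurability (@RGenOInfty.G R)); first exact: RGenOInfty.measurableE.
move=> _ [_ [x ->] <-]; rewrite setTI.
by apply: sub_sigma_algebra; apply: cf.
Qed.

Lemma measurable_coordV i : measurable_fun setT (fun x : borelV => (x : V) ord0 i).
Proof. by apply: measurable_continuousV; exact: coord_continuous. Qed.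

End Borel.
Arguments borelV : clear implicits.

Section EuclideanNorm.
Context {R : realType} {N : nat}.
Local Notation V := 'rV[R]_N.
Implicit Types x y v : V.

Lemma coord_le_enorm x i : `|x ord0 i| <= enorm x.
Proof.
rewrite -sqrtr_sqr ler_wsqrtr// (bigD1 i)//= lerDl.
by apply: sumr_ge0 => j _; exact: sqr_ge0.
Qed.

Lemma norm_le_enorm x : `|x| <= enorm x.
Proof. by apply: norm_le_coord => [|i]; rewrite ?sqrtr_ge0// coord_le_enorm. Qed.

Lemma enorm_ge0 x : 0 <= enorm x. Proof. exact: sqrtr_ge0. Qed.

Lemma enormN x : enorm (- x) = enorm x.
Proof. by congr Num.sqrt; apply: eq_bigr => i _; rewrite mxE sqrrN. Qed.

Lemma enormZ (a : R) x : enorm (a *: x) = `|a| * enorm x.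
Proof.
rewrite /enorm -sqrtr_sqr -sqrtrM ?sqr_ge0// mulr_sumr.
by congr Num.sqrt; apply: eq_bigr => i _; rewrite mxE exprMn.
Qed.

Lemma enorm_sqr x : enorm x ^+ 2 = \sum_(i < N) (x ord0 i) ^+ 2.
Proof. by rewrite sqr_sqrtr// sumr_ge0// => i _; exact: sqr_ge0. Qed.

(* Cauchy-Schwarz from the nonnegativity of enorm (enorm y ^2 x - <x,y> y) ^2 *)
Lemma enormD x y : enorm (x + y) <= enorm x + enorm y.
Proof.
pose p := \sum_(i < N) x ord0 i * y ord0 i.
have sq a b : enorm (a *: x + b *: y) ^+ 2 =
    a ^+ 2 * enorm x ^+ 2 + 2 * a * b * p + b ^+ 2 * enorm y ^+ 2.
  rewrite !enorm_sqr /p !mulr_sumr -!big_split /=; apply: eq_bigr => i _.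
  by rewrite !mxE; ring.
have CS : p <= enorm x * enorm y.
  have := sqr_ge0 (enorm (enorm y *: x + (- enorm x) *: y)); rewrite sq.
  have [x0|x0] := eqVneq (enorm x) 0.
    move=> _; rewrite x0 mul0r /p big1// => i _.
    by have := coord_le_enorm x i; rewrite x0 normr_le0 => /eqP ->; rewrite mul0r.
  have [y0|y0] := eqVneq (enorm y) 0.
    move=> _; rewrite y0 mulr0 /p big1// => i _.
    by have := coord_le_enorm y i; rewrite y0 normr_le0 => /eqP ->; rewrite mulr0.
  have {}x0 : 0 < enorm x by rewrite lt_def x0 enorm_ge0.
  have {}y0 : 0 < enorm y by rewrite lt_def y0 enorm_ge0.
  move=> h; have {h} : 0 <= (2 * enorm x * enorm y) * (enorm x * enorm y - p).
    by apply: le_trans h _; rewrite le_eqVlt; apply/orP; left; apply/eqP; ring.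
  by rewrite pmulr_rge0 ?subr_ge0// !mulr_gt0.
rewrite -(@ler_pXn2r _ 2)// ?nnegrE ?addr_ge0 ?enorm_ge0//.
have := sq 1 1; rewrite !scale1r => ->; move: CS; nra.
Qed.

Lemma enormB x y : enorm (x - y) = enorm (y - x).
Proof. by rewrite -enormN opprB. Qed.

Lemma enorm0 : enorm (0 : V) = 0.
Proof. by rewrite -(scale0r 0) enormZ normr0 mul0r. Qed.

(** The optimal constant is the square root of N; the cruder N avoids a root and is precise enough
    for every later conversion between cubes and balls. *)
Lemma enorm_le_norm x : enorm x <= N%:R * `|x|.
Proof.
have := fun i => coord_le_norm x i; have := normr_ge0 x; set r := `|x| => r0 h.
rewrite -(@ler_pXn2r _ 2)// ?nnegrE ?mulr_ge0 ?enorm_ge0//.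
rewrite enorm_sqr; apply: (@le_trans _ _ (\sum_(i < N) r ^+ 2)).
  apply: ler_sum => i _.
  rewrite -real_normK ?num_real//; by apply: lerXn2r; rewrite ?nnegrE.
rewrite sumr_const card_ord exprMn -[leLHS]mulr_natl ler_wpM2r ?sqr_ge0//.
by rewrite -natrX ler_nat; case: (N) => // n; rewrite expnS expn1 leq_pmulr.
Qed.

Lemma nbhs_normV x (A : set V) :
  nbhs x A <-> exists2 d, 0 < d & forall y, `|y - x| < d -> A y.
Proof.
split=> [/nbhs_ballP[d /= d0 dA]|[d d0 dA]].
  by exists d => // y yx; apply: dA; rewrite -ball_normE /= distrC.
by apply/nbhs_ballP; exists d => // y; rewrite -ball_normE /= distrC => /dA.
Qed.

Lemma continuousV_P (f : V -> R) x : {for x, continuous f} <->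
  forall e, 0 < e -> exists2 d, 0 < d & forall y, `|y - x| < d -> `|f y - f x| < e.
Proof.
split=> [cf e e0|h].
  have /(@cvgrPdist_lt _ _ _ (nbhs x) _ f (f x)) /(_ e e0) := cf.
  by move=> /nbhs_normV[d d0 h]; exists d => // y /h; rewrite distrC.
apply/(@cvgrPdist_lt _ _ _ (nbhs x) _ f (f x)) => e /h[d d0 hd].
by apply/nbhs_normV; exists d => // y /hd; rewrite distrC.
Qed.

Lemma lipschitz_continuousV (f : V -> R) K :
  (forall x y, f x - f y <= K * `|x - y|) -> continuous f.
Proof.
move=> fK x; apply/continuousV_P => e e0.
have K0 : 0 < `|K| + 1 by rewrite ltr_wpDl.
exists (e / (`|K| + 1)); first exact: divr_gt0.
move=> y xy; apply: (@le_lt_trans _ _ ((`|K| + 1) * `|y - x|)); last first.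
  by rewrite mulrC -ltr_pdivlMr.
have Kle : K * `|y - x| <= (`|K| + 1) * `|y - x|.
  by rewrite ler_wpM2r// (le_trans (ler_norm _))// lerDl.
by rewrite ler_norml lerNl opprB; apply/andP; split;
  [rewrite (le_trans (fK _ _))// distrC|rewrite (le_trans (fK _ _))].
Qed.

Lemma enorm_continuous : continuous (@enorm R N).
Proof.
apply: (@lipschitz_continuousV _ N%:R) => x y.
by rewrite (le_trans _ (enorm_le_norm _))// lerBlDr -{1}(subrK y x) enormD.
Qed.

Lemma open_eball y r : open (eball y r).
Proof.
rewrite openE => z zr; apply/nbhs_normV.
have /continuousV_P/(_ (r - enorm (z - y))) := @enorm_continuous (z - y).
rewrite subr_gt0 => /(_ zr)[d d0 h]; exists d => // x xz.
have := h (x - y); rewrite opprB addrA subrK => /(_ xz).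
by rewrite /eball /= ltr_norml => /andP[_]; rewrite ltrBlDr subrK.
Qed.

End EuclideanNorm.

(** * Averages over the unit ball *)

Section Average.
Context {R : realType} {N : nat}.
Local Notation V := 'rV[R]_N.
Local Notation VM := (borelV R N).
Variable mu : probability VM R.
Local Notation B := (eball (0 : V) 1).

(** The bound is asked on the unit ball alone, so that coordinates and polynomials qualify. *)
Definition bounded_borel (f : V -> R) :=
  measurable_fun (setT : set VM) f /\ exists K, forall v, B v -> `|f v| <= K.

Definition avg (f : V -> R) : R := (\int[mu]_(v in (B : set VM)) f v)%R.

Lemma measurable_unit_ball : measurable (B : set VM).
Proof. by apply: sub_sigma_algebra; exact: open_eball. Qed.

Lemma unit_ball_norm v : B v -> `|v| < 1.
Proof. by rewrite /eball /= subr0; apply: le_lt_trans; exact: norm_le_enorm. Qed.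

Hypothesis muB : mu B = 1%E.

Lemma bounded_borel_integrable f : bounded_borel f ->
  mu.-integrable (B : set VM) (EFin \o f).
Proof.
move=> [mf [K fK]]; apply: measurable_bounded_integrable.
- exact: measurable_unit_ball.
- by rewrite [ltLHS](_ : _ = 1%:E) ?ltry.
- exact: measurable_funTS.
- exists K; split; first exact: num_real.
  by move=> M KM v Bv /=; rewrite (le_trans (fK _ Bv))// ltW.
Qed.

Lemma bounded_borelD f g : bounded_borel f -> bounded_borel g ->
  bounded_borel (fun v => f v + g v).
Proof.
move=> [mf [K fK]] [mg [L gL]]; split; first exact: measurable_funD.
by exists (K + L) => v Bv; rewrite (le_trans (ler_normD _ _))// lerD// ?fK ?gL.
Qed.

Lemma bounded_borelM f g : bounded_borel f -> bounded_borel g ->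
  bounded_borel (fun v => f v * g v).
Proof.
move=> [mf [K fK]] [mg [L gL]]; split; first exact: measurable_funM.
by exists (K * L) => v Bv; rewrite normrM ler_pM ?fK ?gL.
Qed.

Lemma bounded_borel_cst k : bounded_borel (fun=> k).
Proof. by split; [exact: measurable_cst|exists `|k|]. Qed.

Lemma bounded_borelZ k f : bounded_borel f -> bounded_borel (fun v => k * f v).
Proof. by move=> bf; apply: bounded_borelM => //; exact: bounded_borel_cst. Qed.

Lemma bounded_borelB f g : bounded_borel f -> bounded_borel g ->
  bounded_borel (fun v => f v - g v).
Proof.
move=> bf bg; have := bounded_borelD bf (bounded_borelZ (-1) bg).
by under eq_fun do rewrite mulN1r.
Qed.

Lemma bounded_borel_coord i : bounded_borel (fun v => v ord0 i).
Proof.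
split; first exact: measurable_coordV.
exists 1 => v /unit_ball_norm/ltW; exact/le_trans/coord_le_norm.
Qed.

Lemma avgD f g : bounded_borel f -> bounded_borel g ->
  avg (fun v => f v + g v) = avg f + avg g.
Proof.
move=> bf bg; apply: RintegralD; first exact: measurable_unit_ball.
- exact: bounded_borel_integrable.
- exact: bounded_borel_integrable.
Qed.

Lemma avgZ k f : bounded_borel f -> avg (fun v => k * f v) = k * avg f.
Proof.
move=> bf; apply: RintegralZl; first exact: measurable_unit_ball.
exact: bounded_borel_integrable.
Qed.

Lemma avgB f g : bounded_borel f -> bounded_borel g ->
  avg (fun v => f v - g v) = avg f - avg g.
Proof.
move=> bf bg; apply: RintegralB; first exact: measurable_unit_ball.
- exact: bounded_borel_integrable.
- exact: bounded_borel_integrable.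
Qed.

Lemma avg_cst k : avg (fun=> k) = k.
Proof.
rewrite /avg Rintegral_cst; last exact: measurable_unit_ball.
by rewrite (_ : fine _ = 1) ?mulr1//; exact: (congr1 fine muB).
Qed.

Lemma le_avg f g : bounded_borel f -> bounded_borel g ->
  (forall v, B v -> f v <= g v) -> avg f <= avg g.
Proof.
move=> bf bg fg; apply: le_Rintegral; first exact: measurable_unit_ball.
- exact: bounded_borel_integrable.
- exact: bounded_borel_integrable.
- exact: fg.
Qed.

Lemma norm_avg_le f K : bounded_borel f -> (forall v, B v -> `|f v| <= K) ->
  `|avg f| <= K.
Proof.
move=> bf fK; rewrite ler_norml -[leLHS](avg_cst (- K)) -[X in _ && (_ <= X)](avg_cst K).
apply/andP; split; apply: le_avg => //; try exact: bounded_borel_cst;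
  by move=> v /fK; rewrite ler_norml => /andP[].
Qed.

Lemma eq_avg f g : (forall v, B v -> f v = g v) -> avg f = avg g.
Proof. by move=> fg; apply: eq_Rintegral => v /set_mem; exact: fg. Qed.

Lemma measurable_affine (f : V -> R) x e : measurable_fun (setT : set VM) f ->
  measurable_fun (setT : set VM) (fun v : V => f (x + e *: v)).
Proof.
move=> mf; apply: (@measurableT_comp _ _ _ VM VM R f setT (fun v : V => x + e *: v)) => //.
apply: measurable_borelV => i.
rewrite (_ : (fun v : VM => _) = (fun v : VM => x ord0 i + e * (v : V) ord0 i)); last first.
  by apply/funext => v; rewrite !mxE.
apply: measurable_funD => //.
by apply: measurable_funM => //; exact: measurable_coordV.
Qed.

End Average.
Arguments bounded_borel_coord {R N} i.
Arguments bounded_borel_cst {R N} k.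

(** * Isotropic laws and quadratic polynomials *)

Section Isotropic.
Context {R : realType} {N : nat}.
Local Notation V := 'rV[R]_N.
Local Notation VM := (borelV R N).
Local Notation B := (eball (0 : V) 1).

Definition opp_coord (i : 'I_N) (x : V) : V :=
  \row_j (if j == i then - x ord0 j else x ord0 j).

(** This is what is retained of the law of a step. Reflections make the first and the mixed second
    moments vanish, so that with [iso_sqr] the averages of quadratic polynomials are explicit. They
    are asked for all [f], and not for moments only, because [harm_mirror] transports the mean value
    property by them. *)
Record isotropic (mu : probability VM R) (c : R) : Prop := Isotropic {
  iso_ball : mu B = 1%E ;
  iso_gt0 : 0 < c ;
  iso_reflect : forall i f, bounded_borel f ->
    avg mu (fun v => f (opp_coord i v)) = avg mu f ;
  iso_sqr : forall i, avg mu (fun v => v ord0 i ^+ 2) = c }.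

Variables (mu : probability VM R) (c : R).
Hypothesis iso : isotropic mu c.

Lemma avg_coord i : avg mu (fun v => v ord0 i) = 0.
Proof.
have := iso_reflect iso i (bounded_borel_coord i).
under eq_fun do rewrite mxE eqxx -mulN1r.
rewrite avgZ ?(iso_ball iso)//; last exact: bounded_borel_coord.
by move: (avg _ _) => a h; lra.
Qed.

Lemma avg_coordM i j :
  avg mu (fun v => v ord0 i * v ord0 j) = c * (i == j)%:R.
Proof.
case: eqP => [->|/eqP ij].
  by rewrite mulr1 -(iso_sqr iso j); under eq_fun do rewrite -expr2.
have bij : bounded_borel (fun v : V => v ord0 i * v ord0 j).
  by apply: bounded_borelM; exact: bounded_borel_coord.
have := iso_reflect iso i bij.
under eq_fun do rewrite !mxE eqxx eq_sym (negbTE ij) mulNr -mulN1r.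
rewrite avgZ ?(iso_ball iso)// mulr0.
by move: (avg _ _) => a h; lra.
Qed.

(* A function whose average over the ball of radius e around x exceeds its value
   at x by e^2 l, as happens for a quadratic polynomial of Laplacian 2l/c. *)
Definition parabolic (q : V -> R) (l : R) :=
  continuous q /\ forall x e,
    bounded_borel (fun v => q (x + e *: v)) /\
    avg mu (fun v => q (x + e *: v)) = q x + e ^+ 2 * l.

Lemma parabolicD q1 l1 q2 l2 : parabolic q1 l1 -> parabolic q2 l2 ->
  parabolic (fun x => q1 x + q2 x) (l1 + l2).
Proof.
move=> [c1 h1] [c2 h2]; split=> [x|x e].
  by apply: continuousD; [exact: c1|exact: c2].
have [b1 e1] := h1 x e; have [b2 e2] := h2 x e.
split; first exact: bounded_borelD.
by rewrite avgD ?(iso_ball iso)// e1 e2; ring.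
Qed.

Lemma parabolicZ k q l : parabolic q l -> parabolic (fun x => k * q x) (k * l).
Proof.
move=> [cq h]; split=> [x|x e].
  by apply: continuousM; [exact: cst_continuous|exact: cq].
have [b1 e1] := h x e.
split; first exact: bounded_borelZ.
by rewrite avgZ ?(iso_ball iso)// e1; ring.
Qed.

Lemma parabolic_cst k : parabolic (fun=> k) 0.
Proof.
split=> [|x e]; first exact: cst_continuous.
split; first exact: bounded_borel_cst.
by rewrite avg_cst ?(iso_ball iso)// mulr0 addr0.
Qed.

Lemma parabolic_coord i : parabolic (fun x => x ord0 i) 0.
Proof.
have E (x : V) e : (fun v : V => (x + e *: v) ord0 i) = (fun v => x ord0 i + e * v ord0 i).
  by apply/funext => v; rewrite !mxE.
split=> [|x e]; first exact: coord_continuous.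
have bi := bounded_borelZ e (bounded_borel_coord i).
have bx := bounded_borel_cst (N := N) (x ord0 i); rewrite E.
split; first exact: bounded_borelD.
rewrite avgD ?(iso_ball iso)// avg_cst ?(iso_ball iso)//.
rewrite avgZ ?(iso_ball iso)//; last exact: bounded_borel_coord.
by rewrite avg_coord !mulr0.
Qed.

Lemma parabolic_coordM i j : parabolic (fun x => x ord0 i * x ord0 j) (c * (i == j)%:R).
Proof.
split=> [x|x e]; first by apply: continuousM; exact: coord_continuous.
have E : (fun v : V => (x + e *: v) ord0 i * (x + e *: v) ord0 j) =
  (fun v => (x ord0 i * x ord0 j + (e * x ord0 i) * v ord0 j) +
     ((e * x ord0 j) * v ord0 i + e ^+ 2 * (v ord0 i * v ord0 j))).
  by apply/funext => v; rewrite !mxE; ring.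
have bi := bounded_borel_coord (R := R) i; have bj := bounded_borel_coord (R := R) j.
have b1 := bounded_borel_cst (N := N) (x ord0 i * x ord0 j).
have b2 := bounded_borelZ (e * x ord0 i) bj.
have b3 := bounded_borelZ (e * x ord0 j) bi.
have bij := bounded_borelM bi bj.
have b4 := bounded_borelZ (e ^+ 2) bij.
have b12 := bounded_borelD b1 b2; have b34 := bounded_borelD b3 b4.
have h := iso_ball iso.
rewrite E; split; first exact: bounded_borelD.
rewrite !avgD// !avgZ//; last exact: bounded_borel_cst.
by rewrite avg_cst// !avg_coord avg_coordM; ring.
Qed.

Lemma parabolic_sum I (r : seq I) (q : I -> V -> R) (l : I -> R) :
  (forall i, parabolic (q i) (l i)) ->
  parabolic (fun x => \sum_(i <- r) q i x) (\sum_(i <- r) l i).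
Proof.
move=> pq; elim: r => [|i r IH].
  by rewrite big_nil; under eq_fun do rewrite big_nil; exact: parabolic_cst.
by rewrite big_cons; under eq_fun do rewrite big_cons; exact: parabolicD.
Qed.

Lemma parabolic_shift q l p : parabolic q l -> parabolic (fun x => q (x - p)) l.
Proof.
move=> [cq h]; split=> [x|x e].
  apply/continuousV_P => e e0; have /continuousV_P/(_ e e0)[d d0 hd] := cq (x - p).
  by exists d => // y yx; apply: hd; rewrite opprB addrA subrK.
have [b1 e1] := h (x - p) e.
by under eq_fun do rewrite addrAC.
Qed.

Definition sqn (x : V) : R := \sum_(i < N) x ord0 i ^+ 2.

Lemma parabolic_sqn p : parabolic (fun x => sqn (x - p)) (N%:R * c).
Proof.
apply: (@parabolic_shift sqn).
have -> : N%:R * c = \sum_(i < N) c * (i == i)%:R.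
  by under eq_bigr do rewrite eqxx mulr1; rewrite sumr_const card_ord mulr_natl.
apply: parabolic_sum => i; exact: (parabolic_coordM i i).
Qed.

Lemma sqn_ge0 x : 0 <= sqn x.
Proof. by apply: sumr_ge0 => i _; exact: sqr_ge0. Qed.

Lemma coord_le_sqn (x : V) i : x ord0 i ^+ 2 <= sqn x.
Proof. by rewrite /sqn (bigD1 i)//= lerDl sumr_ge0// => j _; exact: sqr_ge0. Qed.

Lemma sqn_le (x : V) r : `|x| <= r -> sqn x <= N%:R * r ^+ 2.
Proof.
move=> xr; apply: (@le_trans _ _ (\sum_(i < N) r ^+ 2)).
  apply: ler_sum => i _; rewrite -real_normK ?num_real//.
  rewrite lerXn2r ?nnegrE ?(le_trans _ xr)//.
  exact: coord_le_norm.
by rewrite sumr_const card_ord mulr_natl.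
Qed.

End Isotropic.

(** * The discrete maximum principle *)

Section MaxPrinciple.
Context {R : realType} {N : nat}.
Local Notation V := 'rV[R]_N.
Local Notation VM := (borelV R N).
Local Notation B := (eball (0 : V) 1).
Variables (mu : probability VM R) (c : R).
Hypotheses (iso : isotropic mu c) (N0 : (0 < N)%N).
Local Notation avg := (avg mu).

(** The supremum over [Z] may not be attained. A point whose value is within [t] of it cannot lie in
    [U], since its average, larger by [t], would exceed the supremum. *)
Lemma near_sup_outside (Z U : set V) (h : V -> R) (e t K : R) :
  0 < t -> (forall x, Z x -> h x <= K) ->
  (forall x, Z x -> U x ->
    [/\ bounded_borel (fun v => h (x + e *: v)), (forall v, B v -> Z (x + e *: v)) &
        h x + t <= avg (fun v => h (x + e *: v))]) ->
  forall x0, Z x0 -> exists x, [/\ Z x, ~ U x & h x0 - t < h x].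
Proof.
move=> t0 hK hU x0 Zx0; pose E := [set h x | x in Z]; pose S := sup E.
have supE : has_sup E.
  by split; [exists (h x0), x0|exists K => _ [x Zx <-]; exact: hK].
have hS x : Z x -> h x <= S.
  by move=> Zx; apply: ub_le_sup; [exact: (proj2 supE)|exists x].
have [_ [x Zx <-] Sx] := sup_adherent t0 supE.
exists x; split=> //; last by rewrite (le_lt_trans _ Sx)// lerB// hS.
move=> Ux; have [bh Zv hx] := hU x Zx Ux.
have : h x + t <= S.
  apply: (le_trans hx); rewrite -[leRHS](avg_cst (iso_ball iso)).
  apply: le_avg => //; first exact: (iso_ball iso).
    exact: bounded_borel_cst.
  by move=> v Bv; exact/hS/Zv.
by rewrite leNgt -ltrBlDr Sx.
Qed.

Lemma bounded_borel_affine (f : V -> R) x e (Z : set V) K :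
  measurable_fun (setT : set VM) f -> (forall y, Z y -> `|f y| <= K) ->
  (forall v, B v -> Z (x + e *: v)) -> bounded_borel (fun v => f (x + e *: v)).
Proof.
move=> mf fK Zv; split; first exact: measurable_affine.
by exists K => v Bv; exact/fK/Zv.
Qed.

Lemma discrete_max_principle (Z U : set V) (f : V -> R) (e b r K : R) :
  0 < e -> (forall x, Z x -> `|x| <= r) ->
  measurable_fun (setT : set VM) f -> (forall x, Z x -> `|f x| <= K) ->
  (forall x, Z x -> U x -> (forall v, B v -> Z (x + e *: v)) /\
     f x <= avg (fun v => f (x + e *: v))) ->
  (forall x, Z x -> ~ U x -> f x <= b) ->
  forall x, Z x -> f x <= b.
Proof.
move=> e0 Zr mf fK fU fb x0 Zx0; rewrite leNgt; apply/negP => bx0.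
have Nc0 : 0 < N%:R * c by rewrite mulr_gt0 ?ltr0n// (iso_gt0 iso).
pose G := N%:R * r ^+ 2 + e ^+ 2 * (N%:R * c).
have G0 : 0 < G.
  by apply: ltr_wpDl; [rewrite mulr_ge0 ?sqr_ge0|rewrite mulr_gt0// exprn_gt0].
(* [G] adds the largest value of the square norm on [Z] to its gain in one step. With this [k], a
   nearly maximal point outside [U] gives f x0 < b + k G = f x0. *)
pose k := (f x0 - b) / G.
have k0 : 0 < k by rewrite divr_gt0// subr_gt0.
have pq := parabolicZ iso k (parabolic_sqn iso 0).
pose q x := k * sqn (x - 0 : V).
have q0 x : 0 <= q x by rewrite mulr_ge0 ?sqn_ge0// ltW.
have qr x : Z x -> q x <= k * (N%:R * r ^+ 2).
  by move=> Zx; rewrite ler_wpM2l ?(ltW k0)// subr0 sqn_le// Zr.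
pose t := k * (e ^+ 2 * (N%:R * c)).
have t0 : 0 < t by rewrite mulr_gt0// mulr_gt0// exprn_gt0.
have [||x [Zx Ux hx]] := @near_sup_outside Z U (fun x => f x + q x) e t
    (K + k * (N%:R * r ^+ 2)) t0 _ _ x0 Zx0.
- by move=> x Zx; rewrite lerD ?qr// (le_trans (ler_norm _))// fK.
- move=> x Zx Ux; have [Zv fx] := fU x Zx Ux.
  have bf := bounded_borel_affine mf fK Zv.
  have [bq qE] := pq.2 x e.
  split=> //; first exact: bounded_borelD.
  rewrite avgD ?(iso_ball iso)// qE /t.
  by rewrite [e ^+ 2 * (k * _)]mulrCA -addrA lerD.
- have : f x0 < b + k * (N%:R * r ^+ 2) + t.
    rewrite -ltrBlDr (le_lt_trans _ (lt_le_trans hx (lerD (fb _ Zx Ux) (qr _ Zx))))//.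
    by rewrite lerB// lerDl.
  rewrite -addrA /t -mulrDr -/G /k divfK ?gt_eqF//.
  by rewrite addrC subrK ltxx.
Qed.

End MaxPrinciple.

(** * Limits of functions with the mean value property *)

Section Harm.
Context {R : realType} {N : nat}.
Local Notation V := 'rV[R]_N.
Local Notation VM := (borelV R N).
Local Notation B := (eball (0 : V) 1).
Variables (mu : probability VM R) (c : R).
Hypotheses (iso : isotropic mu c) (N0 : (0 < N)%N).
Local Notation avg := (avg mu).
Variable F : set_system R.
Context {FF : ProperFilter F}.
Hypothesis F0 : forall d, 0 < d -> F [set e | 0 < e < d].
Implicit Types (f g : V -> R) (x y p v : V) (r a e : R).

(* f is, on the cube of centre x0 and radius r, a uniform limit along F of
   functions having the mean value property at the scale e -> 0. *)
Definition harm x0 r f := [/\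
  forall x, `|x - x0| < r -> {for x, continuous f},
  exists K, forall x, `|x - x0| < r -> `|f x| <= K &
  forall t, 0 < t -> F [set e | exists g,
    [/\ measurable_fun (setT : set VM) g,
        (forall x, `|x - x0| < r -> `|g x - f x| <= t) &
        (forall x, `|x - x0| < r - e -> g x = avg (fun v => g (x + e *: v)))]]].

Lemma affine_in_cube x0 r e x v : 0 < e -> `|x - x0| < r - e -> B v ->
  `|x + e *: v - x0| < r.
Proof.
move=> e0 xr /unit_ball_norm v1; rewrite addrAC (le_lt_trans (ler_normD _ _))//.
rewrite -(subrK e r) ltr_leD// normrZ gtr0_norm// -[leRHS]mulr1.
by rewrite ler_wpM2l// ltW.
Qed.

Lemma approx_bounded x0 r f t e g x : 0 < e ->
  (exists K, forall x, `|x - x0| < r -> `|f x| <= K) ->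
  measurable_fun (setT : set VM) g ->
  (forall x, `|x - x0| < r -> `|g x - f x| <= t) ->
  `|x - x0| < r - e ->
  bounded_borel (fun v => g (x + e *: v)).
Proof.
move=> e0 [K fK] mg gf xr.
apply: (@bounded_borel_affine _ _ _ _ _ [set y | `|y - x0| < r] (t + K)) => //.
- move=> y yr; rewrite -(subrK (f y) (g y)) (le_trans (ler_normD _ _))//.
  by rewrite lerD ?gf ?fK.
- by move=> v Bv; exact: affine_in_cube.
Qed.

Lemma harmS x0 r x1 r1 f : `|x1 - x0| + r1 <= r -> harm x0 r f -> harm x1 r1 f.
Proof.
move=> rr [cf [K fK] af].
have sub y s : `|y - x1| < r1 - s -> `|y - x0| < r - s.
  move=> yr; rewrite -(subrK x1 y) -addrA (le_lt_trans (ler_normD _ _))//.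
  by rewrite ltrBrDr; move: rr; rewrite ltrBrDr in yr; lra.
have sub0 y : `|y - x1| < r1 -> `|y - x0| < r.
  by have := sub y 0; rewrite !subr0.
split; first by move=> x /sub0; exact: cf.
  by exists K => x /sub0; exact: fK.
move=> t /af; apply: filterS => e [g [mg gf gm]].
by exists g; split=> // x => [/sub0|/sub]; [exact: gf|exact: gm].
Qed.

Lemma harmD x0 r f1 f2 : harm x0 r f1 -> harm x0 r f2 ->
  harm x0 r (fun x => f1 x + f2 x).
Proof.
move=> [c1 b1 a1] [c2 b2 a2]; split.
- by move=> x xr; apply: continuousD; [exact: c1|exact: c2].
- have [K1 h1] := b1; have [K2 h2] := b2; exists (K1 + K2) => x xr.
  by rewrite (le_trans (ler_normD _ _))// lerD ?h1 ?h2.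
- move=> t t0; have t2 : 0 < t / 2 by rewrite divr_gt0.
  have := F0 ltr01; apply: filterS2 (filterI (a1 _ t2) (a2 _ t2)).
  move=> e [[g1 [m1 e1 h1]] [g2 [m2 e2 h2]]] /andP[e0 _].
  exists (fun x => g1 x + g2 x); split; first exact: measurable_funD.
    move=> x xr; rewrite [t]splitr opprD addrACA (le_trans (ler_normD _ _))//.
    by rewrite lerD ?e1 ?e2.
  move=> x xr; rewrite avgD; first by rewrite -h1// -h2.
  + exact: (iso_ball iso).
  + exact: approx_bounded e0 b1 m1 e1 xr.
  + exact: approx_bounded e0 b2 m2 e2 xr.
Qed.

Lemma harmZ x0 r f k : harm x0 r f -> harm x0 r (fun x => k * f x).
Proof.
move=> [c1 b1 a1]; split.
- by move=> x xr; apply: continuousM; [exact: cst_continuous|exact: c1].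
- have [K1 h1] := b1; exists (`|k| * K1) => x xr.
  by rewrite normrM ler_wpM2l// h1.
- move=> t t0; have k0 : 0 < `|k| + 1 by rewrite ltr_wpDl.
  have := F0 ltr01; apply: filterS2 (a1 _ (divr_gt0 t0 k0)).
  move=> e [g1 [m1 e1 h1]] /andP[e0 _].
  exists (fun x => k * g1 x); split; first exact: measurable_funM.
    move=> x xr; rewrite -mulrBr normrM.
    apply: (@le_trans _ _ ((`|k| + 1) * (t / (`|k| + 1)))).
      by rewrite ler_pM ?e1// lerDl.
    by rewrite mulrC divfK// gt_eqF.
  move=> x xr; rewrite avgZ; first by rewrite -h1.
  + exact: (iso_ball iso).
  + exact: approx_bounded e0 b1 m1 e1 xr.
Qed.

Lemma harmB x0 r f1 f2 : harm x0 r f1 -> harm x0 r f2 ->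
  harm x0 r (fun x => f1 x - f2 x).
Proof.
move=> h1 /(harmZ (-1)) h2; have := harmD h1 h2.
by under eq_fun do rewrite mulN1r.
Qed.

Lemma harm_translate x0 r f (a : V) : harm x0 r f -> harm (x0 - a) r (fun x => f (x + a)).
Proof.
have E x : x - (x0 - a) = x + a - x0 by rewrite opprB addrA addrAC.
move=> [c1 [K fK] a1]; split.
- move=> x; rewrite E => /c1 cf; apply/continuousV_P => e e0.
  have /continuousV_P/(_ e e0)[d d0 hd] := cf.
  by exists d => // y yx; apply: hd; rewrite opprD addrACA subrr addr0.
- by exists K => x; rewrite E; exact: fK.
- move=> t /a1; apply: filterS => e [g [mg gf gm]].
  exists (fun x => g (x + a)); split.
  + rewrite (_ : (fun x => _) = (fun x => g (a + 1 *: x))).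
      exact: measurable_affine.
    by apply/funext => x; rewrite scale1r addrC.
  + by move=> x; rewrite E; exact: gf.
  + move=> x; rewrite E => /gm ->; congr avg; apply/funext => v.
    by rewrite addrAC.
Qed.

(** This closure property turns difference quotients into derivatives. It holds because [harm] only
    asks for approximants within each prescribed [t], so errors can be split in halves. *)
Lemma harm_unif x0 r f :
  (forall t, 0 < t -> exists2 g, harm x0 r g &
     forall x, `|x - x0| < r -> `|g x - f x| <= t) -> harm x0 r f.
Proof.
move=> fg; split.
- move=> x xr; apply/continuousV_P => e e0.
  have e4 : 0 < e / 4 by rewrite divr_gt0.
  have [g [cg _ _] gf] := fg _ e4.
  have /continuousV_P/(_ _ e4)[d d0 hd] := cg x xr.
  exists (Order.min d (r - `|x - x0|)); first by rewrite lt_min d0 subr_gt0.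
  move=> y; rewrite lt_min => /andP[yd yr].
  have {}yr : `|y - x0| < r.
    rewrite -(subrK x y) -addrA (le_lt_trans (ler_normD _ _))//.
    by rewrite -ltrBrDr.
  have := gf y yr; have := gf x xr; have := hd y yd.
  rewrite !ler_norml !ltr_norml => /andP[? ?] /andP[? ?] /andP[? ?].
  by apply/andP; split; lra.
- have [g [_ [K gK] _] gf] := fg _ ltr01; exists (K + 1) => x xr.
  rewrite -(subrK (g x) (f x)) addrC (le_trans (ler_normD _ _))//.
  by rewrite lerD ?gK// distrC gf.
- move=> t t0; have t2 : 0 < t / 2 by rewrite divr_gt0.
  have [g [_ _ ag] gf] := fg _ t2.
  apply: filterS (ag _ t2) => e [h [mh hg hm]]; exists h; split=> // x xr.
  by rewrite [t]splitr (le_trans (ler_distD (g x) _ _))// lerD ?hg ?gf.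
Qed.

Lemma harm_ext x0 r f g : (forall x, `|x - x0| < r -> f x = g x) ->
  harm x0 r f -> harm x0 r g.
Proof.
move=> fg hf; apply: harm_unif => t t0; exists f => // x xr.
by rewrite fg// subrr normr0 ltW.
Qed.

Definition mirror i a x : V := \row_j (if j == i then a *+ 2 - x ord0 j else x ord0 j).

Lemma mirror_dist i a x y : `|mirror i a x - mirror i a y| = `|x - y|.
Proof.
wlog: x y / `|mirror i a x - mirror i a y| <= `|x - y|.
  have mK z : mirror i a (mirror i a z) = z.
    apply/rowP => j; rewrite !mxE; case: eqP => // _.
    by rewrite opprB addrC subrK.
  move=> h; apply: (h x y); apply: norm_le_coord => // j.
  apply: le_trans (coord_le_norm (x - y) j); rewrite !mxE.
  by case: eqP => _ //; rewrite opprB addrC addrA subrK distrC.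
move=> h; apply/eqP; rewrite eq_le h /=; apply: norm_le_coord => // j.
apply: le_trans (coord_le_norm _ j); rewrite !mxE.
by case: eqP => _ //; rewrite opprB [X in _ <= `|X|]addrC addrA subrK distrC.
Qed.

(** The mirror image of x + e v is the mirror image of x plus e times the reflected v, so the
    invariance of the law under [opp_coord] carries the mean value property over. The centre lies on
    the mirror, hence the cube is mapped to itself. *)
Lemma harm_mirror x0 r f i : harm x0 r f -> harm x0 r (f \o mirror i (x0 ord0 i)).
Proof.
set a := x0 ord0 i; have E x : `|mirror i a x - x0| = `|x - x0|.
  rewrite -[RHS](mirror_dist i a); congr (`| _ - _|).
  apply/rowP => j; rewrite !mxE; case: eqP => // ->.
  by rewrite mulr2n addrK.
move=> [c1 b1 a1]; split.
- move=> x xr; apply/continuousV_P => e e0.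
  have xr' : `|mirror i a x - x0| < r by rewrite E.
  have /continuousV_P/(_ e e0)[d d0 hd] := c1 _ xr'.
  by exists d => // y yx; apply: hd; rewrite mirror_dist.
- by have [K fK] := b1; exists K => x xr /=; rewrite fK// E.
- move=> t t0; have := F0 ltr01; apply: filterS2 (a1 _ t0).
  move=> e [g [mg gf gm]] /andP[e0 _]; exists (g \o mirror i a); split.
  + apply: (@measurableT_comp _ _ _ VM VM R g setT (mirror i a)) => //.
    apply: measurable_borelV => j; case: (eqVneq j i) => [->|ji].
      rewrite (_ : (fun x : VM => _) = (fun x : VM => a *+ 2 - (x : V) ord0 i)); last first.
        by apply/funext => x; rewrite mxE eqxx.
      by apply: measurable_funB => //; exact: measurable_coordV.
    rewrite (_ : (fun x : VM => _) = (fun x : VM => (x : V) ord0 j)); last first.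
      by apply/funext => x; rewrite mxE (negbTE ji).
    exact: measurable_coordV.
  + by move=> x xr /=; rewrite gf// E.
  + move=> x xr /=; have xr' : `|mirror i a x - x0| < r - e by rewrite E.
    rewrite gm// -(iso_reflect iso i); last exact: approx_bounded e0 b1 mg gf xr'.
    congr avg; apply/funext => v; congr g; apply/rowP => j; rewrite !mxE.
    by case: eqP => // _; ring.
Qed.

(** An approximant g of f equals its averages, while q, even after adding a small multiple of |x -
    p|^2, lies strictly above its own; so the difference is subharmonic with a definite gain, and
    [near_sup_outside] produces a nearly maximal point far from p. There the added square outweighs
    all errors. *)
Lemma harm_no_touching x0 r f q l p s : harm x0 r f -> parabolic mu q l -> l < 0 ->
  0 < s -> `|p - x0| + s <= r ->
  ~ (forall x, `|x - p| < s -> f x - q x <= f p - q p).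
Proof.
move=> [cf bf af] pq l0 s0 psr fqp.
have Nc0 : 0 < N%:R * c by rewrite mulr_gt0 ?ltr0n// (iso_gt0 iso).
(* The added square uses up half of the negative coefficient [l]. *)
pose k := - l / (2 * (N%:R * c)).
have k0 : 0 < k by rewrite divr_gt0 ?oppr_gt0// mulr_gt0.
have pq' := parabolicD iso pq (parabolicZ iso k (parabolic_sqn iso p)).
have lE : l + k * (N%:R * c) = l / 2.
  by rewrite /k; move: (N%:R * c) Nc0 => G G0; field; rewrite gt_eqF.
rewrite lE in pq'.
pose q' x := q x + k * sqn (x - p).
(* At distance s/2 from p the added square is at least 4 h. The errors to beat are two approximation
   errors and the slack [t], each at most h. *)
pose h := k * s ^+ 2 / 16.
have h0 : 0 < h by rewrite divr_gt0// mulr_gt0// exprn_gt0.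
have s2 : 0 < s / 2 by rewrite divr_gt0.
have [e [/andP[e0 es] [g [mg gf gm]]]] := filter_ex (filterI (F0 s2) (af _ h0)).
have inr x : `|x - p| < s -> `|x - x0| < r.
  move=> xs; rewrite -(subrK p x) -addrA (le_lt_trans (ler_normD _ _))//.
  by apply: lt_le_trans psr; rewrite [ltRHS]addrC ltrD2r.
(* The second term is exactly the gain in the mean at scale [e]; the first keeps the slack below
   h. *)
pose t := Order.min h (- l * e ^+ 2 / 2).
have t0 : 0 < t.
  by rewrite lt_min h0/= divr_gt0// mulr_gt0 ?oppr_gt0// exprn_gt0.
have gq x : `|x - p| < s -> g x - q' x <= f p - q p + h - k * sqn (x - p).
  move=> xs; have := fqp x xs; have := gf x (inr x xs); rewrite ler_norml /q'.
  by move=> /andP[_]; lra.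
have [|||x [Zx Ux hx]] := @near_sup_outside _ _ mu c iso [set x | `|x - p| < s]
   [set x | `|x - p| < s / 2] (fun x => g x - q' x) e t (f p - q p + h) t0 _ _ p.
- move=> x /gq gx; apply: le_trans gx _.
  by rewrite gerBl mulr_ge0 ?sqn_ge0 ?(ltW k0).
- move=> x Zx Ux.
  have xr : `|x - x0| < r - e.
    rewrite -(subrK p x) -addrA (le_lt_trans (ler_normD _ _))//.
    by move: Ux es psr => /=; lra.
  have bg := approx_bounded e0 bf mg gf xr.
  have [bq qE] := pq'.2 x e.
  split.
  + exact: bounded_borelB.
  + move=> v Bv /=; apply: affine_in_cube => //.
    by move: Ux es => /=; lra.
  + rewrite avgB// ?(iso_ball iso)// qE -gm//.
    have : t <= - l * e ^+ 2 / 2 by rewrite ge_min lexx orbT.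
    rewrite /q'; lra.
- by rewrite /= subrr normr0.
- have tle : t <= h by rewrite ge_min lexx.
  have := gq x Zx.
  have : `|g p - f p| <= h by rewrite gf// inr// subrr normr0.
  rewrite ler_norml => /andP[gp _].
  have q'p : q' p = q p.
    rewrite /q' subrr /sqn big1 ?mulr0 ?addr0// => i _.
    by rewrite mxE expr0n.
  rewrite q'p in hx; move=> gx.
  have sx : sqn (x - p) < (s / 2) ^+ 2.
    rewrite -(ltr_pM2l k0).
    have -> : k * (s / 2) ^+ 2 = 4 * h by rewrite /h; field.
    lra.
  apply: Ux; apply: norm_lt_coord => // i.
  rewrite -(@ltr_pXn2r _ 2) ?nnegrE ?(ltW s2)//.
  rewrite real_normK ?num_real//; exact: le_lt_trans (coord_le_sqn _ _) sx.
Qed.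

End Harm.

(** * A derivative with explicit remainder from bounded second differences *)

Section SecondDifferences.
Context {R : realType}.
Variables (g : R -> R) (a C L : R).
Hypotheses (a0 : 0 < a) (C0 : 0 <= C) (L0 : 0 <= L).
Hypothesis gL : forall s t, `|s| < a -> `|t| < a -> `|g s - g t| <= L * `|s - t|.
Hypothesis gC : forall t h k, `|t| < a -> `|t + h| < a -> `|t + k| < a ->
  `|t + h + k| < a -> `|g (t + h + k) - g (t + h) - g (t + k) + g t| <= C * (`|h| * `|k|).

(** Going from m k to (m + 1) k costs one second difference, at most C (m k) k, and these costs sum
    to at most C (m k)^2. *)
Let gmul k m : 0 < k -> m%:R * k < a ->
  `|g (m%:R * k) - g 0 - m%:R * (g k - g 0)| <= C * (m%:R * k) ^+ 2.
Proof.
move=> k0; elim: m => [|m IH] mk.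
  by rewrite !mul0r subr0 subrr normr0 expr0n mulr0.
have mk0 : 0 <= m%:R * k by rewrite mulr_ge0// ltW.
rewrite mulrSr mulrDl mul1r in mk.
have mka : m%:R * k < a by apply: le_lt_trans mk; rewrite lerDl ltW.
have ka : k < a by apply: le_lt_trans mk; rewrite lerDr.
have mkk0 : 0 <= m%:R * k + k by rewrite addr_ge0// ltW.
have := @gC 0 (m%:R * k) k; rewrite !add0r normr0 (ger0_norm mk0) (gtr0_norm k0).
rewrite (ger0_norm mkk0) => /(_ a0 mka ka mk).
have := IH mka; rewrite mulrSr mulrDl mul1r.
have m2 : 0 <= C * (m%:R * k ^+ 2) by rewrite (mulr_ge0 C0)// mulr_ge0// sqr_ge0.
have k2 : 0 <= C * k ^+ 2 by rewrite (mulr_ge0 C0)// sqr_ge0.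
have -> : C * (m%:R * k + k) ^+ 2 = C * (m%:R * k) ^+ 2 + 2 * (C * (m%:R * k ^+ 2)) + C * k ^+ 2.
  ring.
have -> : C * (m%:R * k * k) = C * (m%:R * k ^+ 2) by ring.
rewrite !ler_norml => /andP[? ?] /andP[? ?]; apply/andP; split; lra.
Qed.

Let quot h := (g h - g 0) / h.

(** Compare h with the largest multiple m j below it: [gmul] accounts for C h^2, the gap h - m j for
    L j, and the rounding of h / j to m for another L j; then divide by h. *)
Let quotB j h : 0 < j -> j <= h -> h < a -> `|quot h - quot j| <= C * h + 2 * L * j / h.
Proof.
move=> j0 jh ha; have h0 : 0 < h by exact: lt_le_trans jh.
have hj0 : 0 <= h / j by rewrite divr_ge0// ltW.
set m := Num.truncn (h / j).
have /andP[mle mlt] := truncn_itv hj0; rewrite -/m in mle mlt.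
have mh : `|m%:R - h / j| <= 1.
  by rewrite distrC ger0_norm ?subr_ge0// lerBlDr addrC -mulrSr ltW.
rewrite ler_pdivlMr// in mle; rewrite ltr_pdivrMr// mulrSr mulrDl mul1r in mlt.
have m0 : 0 <= m%:R * j by rewrite mulr_ge0// ltW.
have mja : m%:R * j < a by exact: le_lt_trans ha.
have ja : j < a by exact: le_lt_trans ha.
have := gmul j0 mja.
have := @gL h (m%:R * j); rewrite (gtr0_norm h0) (ger0_norm m0) => /(_ ha mja).
have := @gL j 0; rewrite (gtr0_norm j0) normr0 => /(_ ja a0).
rewrite subr0 (gtr0_norm j0) (ger0_norm (_ : 0 <= h - m%:R * j)) ?subr_ge0//.
have E : quot h - quot j =
   (g h - g (m%:R * j) + (g (m%:R * j) - g 0 - m%:R * (g j - g 0)) +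
     (m%:R - h / j) * (g j - g 0)) / h.
  by rewrite /quot; field; rewrite !gt_eqF.
move=> g1 g2 g3; rewrite E normrM normfV (gtr0_norm h0).
have -> : C * h + 2 * L * j / h = (C * h ^+ 2 + 2 * L * j) / h.
  by field; rewrite gt_eqF.
rewrite ler_pM2r ?invr_gt0//.
have e1 : `|(m%:R - h / j) * (g j - g 0)| <= L * j.
  by rewrite normrM -[leRHS]mul1r ler_pM.
have e2 : L * (h - m%:R * j) <= L * j by rewrite ler_wpM2l// lerBlDr addrC ltW.
have e3 : C * (m%:R * j) ^+ 2 <= C * h ^+ 2 by rewrite ler_wpM2l// lerXn2r// nnegrE ltW.
rewrite (le_trans (ler_normD _ _))// (le_trans (lerD (ler_normD _ _) e1))//; lra.
Qed.

(** By comparison with a common tiny j, each lower value quot h - C h is below each upper value quot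
    k + C k; the supremum of the lower ones is therefore a derivative from the right, with remainder
    C h^2. One more second difference reaches negative h. *)
Lemma second_diff_derive :
  exists l, forall h, `|h| < a -> `|g h - g 0 - h * l| <= 2 * C * h ^+ 2.
Proof.
have qle h k : 0 < h < a -> 0 < k < a -> quot h - C * h <= quot k + C * k.
  move=> /andP[h0 ha] /andP[k0 ka]; apply/ler_addgt0Pr => e e0.
  (* j = e / G brings both rounding errors together below e; the [+ 1] keeps G positive when L =
     0. *)
  pose G := 2 * L / h + 2 * L / k + 1.
  have G0 : 0 < G by rewrite ltr_wpDl// addr_ge0// divr_ge0 ?mulr_ge0// ltW.
  pose j := Order.min (Order.min h k) (e / G).
  have j0 : 0 < j by rewrite !lt_min h0 k0 divr_gt0.
  have jh : j <= h by rewrite !ge_min lexx.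
  have jk : j <= k by rewrite !ge_min lexx orbT.
  have jG : G * j <= e.
    by rewrite mulrC -ler_pdivlMr// ge_min lexx orbT.
  have := quotB j0 jh ha; have := quotB j0 jk ka.
  rewrite !ler_norml => /andP[k1 k2] /andP[h1 h2].
  have : 2 * L * j / h + 2 * L * j / k + j <= e.
    by apply: le_trans jG; rewrite le_eqVlt; apply/orP; left; apply/eqP; rewrite /G; ring.
  lra.
pose E := [set quot h - C * h | h in [set h | 0 < h < a]].
have a2 : 0 < a / 2 < a by rewrite divr_gt0//= ltr_pdivrMr// ltr_pMr// ltr1n.
have E0 : E !=set0 by exists (quot (a / 2) - C * (a / 2)), (a / 2).
have lP h : 0 < h < a -> quot h - C * h <= sup E <= quot h + C * h.
  move=> hh; apply/andP; split.
    apply: ub_le_sup; last by exists h.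
    by exists (quot (a / 2) + C * (a / 2)) => _ [k kk <-]; exact: qle.
  by apply: ge_sup => // _ [k kk <-]; exact: qle.
have pos h : 0 < h < a -> `|g h - g 0 - h * sup E| <= C * h ^+ 2.
  move=> hh; have /andP[h0 ha] := hh.
  have -> : g h - g 0 - h * sup E = h * (quot h - sup E).
    by rewrite /quot; field; rewrite gt_eqF.
  rewrite normrM (gtr0_norm h0) expr2 mulrCA ler_pM2l// ler_norml.
  by have /andP[? ?] := lP h hh; apply/andP; split; lra.
exists (sup E) => h ha; have h2 : 0 <= C * h ^+ 2 by rewrite mulr_ge0 ?sqr_ge0.
have [h0|h0|->] := ltrgtP h 0; last first.
- by rewrite subrr mul0r subrr normr0 expr0n mulr0.
- rewrite (le_trans (pos h _)) ?h0//=; first by rewrite gtr0_norm in ha.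
  by rewrite -mulrA mulr_natl mulr2n lerDl.
(* The bound on g(h) + g(-h) - 2 g(0) reflects the estimate to negative h, which accounts for the
   factor 2 in the statement. *)
- have Nh : 0 < - h < a by rewrite oppr_gt0 h0 -(ltr0_norm h0).
  have := pos _ Nh; rewrite sqrrN.
  have := @gC 0 h (- h); rewrite !add0r normrN subrr normr0 => /(_ a0 ha ha a0).
  rewrite -expr2 real_normK ?num_real//.
  rewrite !ler_norml => /andP[? ?] /andP[? ?]; apply/andP; split; lra.
Qed.

End SecondDifferences.

(** * The reflection and barrier argument *)

Section Gradient.
Context {R : realType} {N : nat}.
Local Notation V := 'rV[R]_N.
Local Notation VM := (borelV R N).
Local Notation B := (eball (0 : V) 1).
Variables (mu : probability VM R) (c : R).
Hypotheses (iso : isotropic mu c) (N0 : (0 < N)%N).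
Variable F : set_system R.
Context {FF : ProperFilter F}.
Hypothesis F0 : forall d, 0 < d -> F [set e | 0 < e < d].
Local Notation harm := (harm mu F).
Implicit Types (f g : V -> R) (x y p v : V) (r e : R).

Lemma evec_coord (i j : 'I_N) : (evec i : V) ord0 j = (j == i)%:R.
Proof. by rewrite mxE eqxx. Qed.

Lemma norm_evec (i : 'I_N) : `|(evec i : V)| <= 1.
Proof.
by apply: norm_le_coord => // j; rewrite evec_coord; case: (j == i); rewrite ?normr1 ?normr0.
Qed.

Lemma normZ_evec (i : 'I_N) t : `|t *: (evec i : V)| <= `|t|.
Proof. by rewrite normrZ ler_piMr// norm_evec. Qed.

(* The comparison function is that of Gilbarg-Trudinger, Section 3.4: on the half
   cube 0 < y_i < d, |y_j| < d (y = x - x0) a strictly superharmonic quadratic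
   polynomial dominates the odd part of f in the variable y_i. *)
Lemma harm_symmetric_difference x0 r f (i : 'I_N) M d h : harm x0 r f ->
  0 < d -> d < r -> 0 < M -> (forall x, `|x - x0| < r -> `|f x| <= M) ->
  0 <= h -> h <= d ->
  f (x0 + h *: evec i) - f (x0 - h *: evec i) <= 2 * M * N.+1%:R / d * h.
Proof.
move=> hf d0 dr M0 fM h0 hd; set a := x0 ord0 i; set m := mirror i a.
pose w x := f x - f (m x).
have hw : harm x0 r w by exact: (harmB iso F0 hf (harm_mirror iso F0 i hf)).
(* 2 M bounds the odd part [w]. Since psi(y) is at least |y|^2 on the half cube, [phi] is at least A
   d^2 = 2 M on the faces |y_j| = d. *)
pose A := 2 * M / d ^+ 2.
have A0 : 0 < A by rewrite divr_gt0 ?mulr_gt0// exprn_gt0.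
pose n : R := N.+1%:R.
have n0 : 0 < n by rewrite ltr0n.
(* This is |y|^2 + n y_i (d - y_i). As n = N + 1 exceeds the dimension by one, the coefficient N c -
   n c is negative; along the axis psi(h e_i) is at most n d h, which gives the linear bound
   sought. *)
pose psi y : R := sqn y + (- n * (y ord0 i * y ord0 i) + n * d * y ord0 i).
have ppsi : parabolic mu psi (- c).
  have -> : - c = N%:R * c + (- n * (c * (i == i)%:R) + n * d * 0).
    by rewrite eqxx /= mulr1n /n -natr1; ring.
  apply: (parabolicD iso); last apply: (parabolicD iso).
  - have := parabolic_sqn iso 0.
    by congr parabolic; apply/funext => y; rewrite subr0.
  - by apply: parabolicZ; first exact: iso; exact: parabolic_coordM.
  - by apply: parabolicZ; first exact: iso; exact: (parabolic_coord iso).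
pose phi x := A * psi (x - x0).
have pphi : parabolic mu phi (A * - c).
  by apply: (parabolicZ iso); exact: parabolic_shift.
have wM x : `|x - x0| < r -> w x <= A * d ^+ 2.
  move=> xr; rewrite /A divfK ?gt_eqF ?exprn_gt0//.
  have mx : `|m x - x0| < r.
    suff -> : `|m x - x0| = `|x - x0| by [].
    rewrite -[RHS](mirror_dist i a); congr (`| _ - _|).
    by apply/rowP => j; rewrite !mxE; case: eqP => // ->; rewrite mulr2n addrK.
  have := fM x xr; have := fM _ mx; rewrite !ler_norml /w.
  by move=> /andP[? ?] /andP[? ?]; lra.
(* The closed half cube is written as a product of segments, whence its compactness. *)
pose lo j := if j == i then x0 ord0 j else x0 ord0 j - d.
pose W := [set x : V | forall j, (`[lo j, x0 ord0 j + d]%classic : set R) (x ord0 j)].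
have WP x : W x <-> 0 <= (x - x0) ord0 i /\ `|x - x0| <= d.
  split=> [Wx|[xi xd] j].
    split.
      by have := Wx i; rewrite /lo eqxx /= in_itv /= !mxE subr_ge0 => /andP[].
    apply: norm_le_coord => [|j]; first exact: ltW.
    have := Wx j; rewrite /lo /= in_itv /= !mxE ler_norml.
    by case: eqP => _ /andP[? ?]; apply/andP; split; lra.
  have := le_trans (coord_le_norm _ j) xd; rewrite /lo /= in_itv /= !mxE ler_norml.
  move=> /andP[? ?]; case: eqP => [ji|_]; apply/andP; split; try lra.
  by move: xi; rewrite -ji !mxE subr_ge0.
have cW : compact W.
  apply: (@rV_compact _ _ (fun j => `[lo j, x0 ord0 j + d]%classic)) => j.
  exact: segment_compact.
have Wr x : W x -> `|x - x0| < r by move=> /WP[_ xd]; exact: le_lt_trans dr.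
pose z := x0 + h *: evec i.
have zx0 : z - x0 = h *: evec i by rewrite /z addrC addKr.
have Wz : W z.
  apply/WP; rewrite zx0; split; first by rewrite mxE evec_coord eqxx mulr1.
  by rewrite (le_trans (normZ_evec _ _))// ger0_norm.
have cwphi : {within W, continuous (fun x => w x - phi x)}.
  apply: continuous_in_subspaceT => x /set_mem /Wr xr.
  apply: continuousB; last exact: (proj1 pphi x).
  by have [cw _ _] := hw; exact: cw.
have [p /set_mem Wp pmax] := EVT_max_rV (ex_intro _ z Wz) cW cwphi.
suff wp : w p - phi p <= 0.
  have := pmax z (mem_set Wz).
  have -> : w z = f (x0 + h *: evec i) - f (x0 - h *: evec i).
    congr (_ - f _); apply/rowP => j; rewrite !mxE ?eqxx/=.
    by case: eqP => [->|_] /=; rewrite ?mulr1 ?mulr0 /a; ring.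
  have sz : psi (z - x0) <= n * d * h.
    have sq : sqn (h *: (evec i : V)) = h ^+ 2.
      rewrite /sqn (bigD1 i)//= big1 ?addr0 => [|j /negbTE ji].
        by rewrite mxE evec_coord eqxx mulr1.
      by rewrite mxE evec_coord ji mulr0 expr0n.
    rewrite zx0 /psi sq mxE evec_coord eqxx mulr1.
    have : 0 <= (n - 1) * h ^+ 2.
      by rewrite mulr_ge0 ?sqr_ge0// /n -natr1 addrK.
    have -> : (n - 1) * h ^+ 2 = n * (h * h) - h ^+ 2 by ring.
    lra.
  have : phi z <= A * (n * d * h) by rewrite ler_wpM2l// ltW.
  have -> : A * (n * d * h) = 2 * M * N.+1%:R / d * h.
    by rewrite /A /n; field; rewrite gt_eqF.
  lra.
(* A positive maximum avoids the face y_i = 0, where [w] vanishes, and the faces |y_j| = d, where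
   [phi] dominates; it is then interior, against [harm_no_touching]. *)
rewrite leNgt; apply/negP => wphi.
have /WP[yi0 yd] := Wp; set y := p - x0 in yi0 yd.
have sq0 : 0 <= sqn y by exact: sqn_ge0.
have yid : y ord0 i <= d.
  by apply: le_trans yd; apply: le_trans (coord_le_norm _ i); exact: ler_norm.
have psiy : sqn y <= psi y.
  have : 0 <= n * (y ord0 i * (d - y ord0 i)).
    by rewrite mulr_ge0 ?(ltW n0)// mulr_ge0// subr_ge0.
  have -> : n * (y ord0 i * (d - y ord0 i)) = n * d * y ord0 i - n * (y ord0 i * y ord0 i).
    ring.
  rewrite /psi; lra.
have yip : 0 < y ord0 i.
  rewrite lt_neqAle yi0 andbT; apply/eqP => y0.
  have mp : m p = p.
    apply/rowP => j; rewrite mxE; case: eqP => // ->.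
    by move/eqP: y0; rewrite !mxE eq_sym subr_eq0 => /eqP ->; rewrite mulr2n addrK.
  move: wphi; rewrite /w mp subrr sub0r oppr_gt0 ltNge => /negP; apply.
  by rewrite mulr_ge0 ?(ltW A0)// (le_trans sq0).
have ydd : `|y| < d.
  apply: norm_lt_coord => // j; rewrite ltNge; apply/negP => dj.
  move: wphi; rewrite subr_gt0 ltNge => /negP; apply.
  apply: (le_trans (wM _ (Wr _ Wp))); rewrite ler_pM2l// (le_trans _ psiy)//.
  apply: le_trans (coord_le_sqn _ j); rewrite -[leRHS]real_normK ?num_real//.
  by rewrite lerXn2r// nnegrE ltW.
pose s := Order.min (y ord0 i) (d - `|y|).
have s0 : 0 < s by rewrite lt_min yip subr_gt0.
have := @harm_no_touching _ _ mu c iso N0 F _ F0 x0 r w phi (A * - c) p s hw pphi.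
case=> //.
- by rewrite mulrN oppr_lt0 mulr_gt0// (iso_gt0 iso).
- have : s <= d - `|y| by rewrite ge_min lexx orbT.
  by rewrite -/y; lra.
- move=> x; rewrite lt_min => /andP[x1 x2]; apply: pmax; apply/mem_set/WP.
  have E : x - x0 = (x - p) + y by rewrite /y addrA subrK.
  rewrite E; split; last by rewrite (le_trans (ler_normD _ _))// -lerBrDr ltW.
  have := le_lt_trans (coord_le_norm (x - p) i) x1; rewrite ltr_norml [in X in _ -> X]mxE.
  by move=> /andP[? ?]; lra.
Qed.

End Gradient.

(** * Existence of partial derivatives *)

Section Derivative.
Context {R : realType} {N : nat}.
Local Notation V := 'rV[R]_N.
Local Notation VM := (borelV R N).
Local Notation B := (eball (0 : V) 1).
Variables (mu : probability VM R) (c : R).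
Hypotheses (iso : isotropic mu c) (N0 : (0 < N)%N).
Variable F : set_system R.
Context {FF : ProperFilter F}.
Hypothesis F0 : forall d, 0 < d -> F [set e | 0 < e < d].
Local Notation harm := (harm mu F).
Implicit Types (f g : V -> R) (x y p v : V) (r e : R).

(** The increment is a symmetric difference about the midpoint of x and x + t e_i, which lies in the
    same convex cube and is the centre of a cube of radius rho where f is controlled. Applying the
    bound to f and to -f makes it two-sided. *)
Lemma harm_lipschitz x0 r f (i : 'I_N) M rho x t : harm x0 r f ->
  0 < M -> (forall x, `|x - x0| < r -> `|f x| <= M) -> 0 < rho ->
  `|x - x0| < r - rho -> `|x + t *: evec i - x0| < r - rho -> `|t| < rho ->
  `|f (x + t *: evec i) - f x| <= 2 * M * N.+1%:R / rho * `|t|.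
Proof.
move=> hf M0 fM rho0.
wlog t0 : x t / 0 <= t.
  move=> h xr yr tr; have [tp|/ltW t0] := leP 0 t; first exact: h.
  have E : x + t *: evec i + - t *: evec i = x by rewrite scaleNr addrK.
  have := h (x + t *: evec i) (- t); rewrite oppr_ge0 E normrN => /(_ t0 yr xr tr).
  by rewrite distrC.
move=> xr yr tr; rewrite (ger0_norm t0) in tr *.
pose m := x + (t / 2) *: (evec i : V).
have mE1 : m - (t / 2) *: evec i = x by rewrite /m addrK.
have mE2 : m + (t / 2) *: evec i = x + t *: evec i.
  by rewrite /m -addrA -scalerDl -splitr.
have mr : `|m - x0| < r - rho.
  have -> : m - x0 = 2^-1 *: ((x - x0) + (x + t *: evec i - x0)).
    by apply/rowP => j; rewrite !mxE; field.
  rewrite normrZ gtr0_norm ?invr_gt0// mulrC ltr_pdivrMr//.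
  by rewrite (le_lt_trans (ler_normD _ _))// mulr_natr mulr2n ltrD.
have sub g : harm x0 r g -> harm m rho g.
  by apply: harmS; rewrite -lerBrDr ltW.
have inm y : `|y - m| < rho -> `|y - x0| < r.
  move=> ym; rewrite -(subrK m y) -addrA (le_lt_trans (ler_normD _ _))//.
  by move: ym mr; lra.
have [h0 hd] : 0 <= t / 2 /\ t / 2 <= rho / 2.
  by rewrite divr_ge0// ler_pM2r ?invr_gt0// ltW.
have [d0 dr] : 0 < rho / 2 /\ rho / 2 < rho.
  by rewrite divr_gt0// ltr_pdivrMr// ltr_pMr// ltr1n.
have E : 2 * M * N.+1%:R / (rho / 2) * (t / 2) = 2 * M * N.+1%:R / rho * t.
  by field; rewrite gt_eqF.
have := harm_symmetric_difference iso N0 F0 i (sub _ hf) d0 dr M0 (fun y ym => fM y (inm y ym)) h0 hd.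
have hNf : harm x0 r (fun y => - 1 * f y) by exact: (harmZ iso F0).
have NM y : `|y - m| < rho -> `| - 1 * f y| <= M.
  by move=> /inm/fM; rewrite mulN1r normrN.
have := harm_symmetric_difference iso N0 F0 i (sub _ hNf) d0 dr M0 NM h0 hd.
rewrite mE1 mE2 E !mulN1r; set K := 2 * M * _ / _ * _; rewrite ler_norml.
move: (f _) (f x) K => f1 f2 K /(_ FF) h1 /(_ FF) h2; apply/andP; split; lra.
Qed.

Lemma harm_bound x0 r f : harm x0 r f ->
  exists2 M, 0 < M & forall x, `|x - x0| < r -> `|f x| <= M.
Proof.
move=> [_ [K fK] _]; exists (`|K| + 1); first by rewrite ltr_wpDl.
by move=> x /fK h; rewrite (le_trans h)// (le_trans (ler_norm _))// lerDl.
Qed.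

Lemma harm_shift x0 r s f h (i : 'I_N) : harm x0 r f -> `|h| + s <= r ->
  harm x0 s (fun x => f (x + h *: evec i)).
Proof.
move=> hf hs; rewrite -[x0](addrK (h *: evec i)); apply: harm_translate.
apply: harmS hf; rewrite addrAC subrr add0r.
by rewrite (le_trans _ hs)// lerD2r normZ_evec.
Qed.

(** The Lipschitz bound for f bounds its difference quotients, which are again [harm]; their own
    Lipschitz bound then controls the second differences of f. The resulting remainder is uniform in
    x, so the quotients converge uniformly and the derivative is [harm]. *)
Lemma harm_derivative x0 r f (i : 'I_N) : harm x0 r f -> 0 < r ->
  exists f' : V -> R, [/\ harm x0 (r / 2) f',
   exists C, forall x h, `|x - x0| < r / 2 -> `|h| < r / 16 ->
     `|f (x + h *: evec i) - f x - h * f' x| <= C * h ^+ 2 &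
   exists L, forall x h, `|x - x0| < r / 2 -> `|h| < r / 16 ->
     `|f (x + h *: evec i) - f x| <= L * `|h|].
Proof.
move=> hf r0; have [M M0 fM] := harm_bound hf.
(* From 8 rho one rho is lost at each stage: increments of f within 7 rho, bounded quotients within
   6 rho, increments of quotients within 5 rho, derivatives within 4 rho. *)
pose rho := r / 8; have rho0 : 0 < rho by rewrite divr_gt0.
have rE : r = 8 * rho by rewrite /rho; field.
pose n : R := N.+1%:R; have n0 : 0 < n by rewrite ltr0n.
pose L1 := 2 * M * n / rho.
have L10 : 0 < L1 by rewrite divr_gt0// !mulr_gt0.
pose L2 := 2 * L1 * n / rho.
have L20 : 0 < L2 by rewrite divr_gt0// (mulr_gt0 (mulr_gt0 _ L10) n0).
have L22 : 0 < 2 * L2 by exact: mulr_gt0.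
have lip1 x t : `|x - x0| < r - rho -> `|x + t *: evec i - x0| < r - rho ->
    `|t| < rho -> `|f (x + t *: evec i) - f x| <= L1 * `|t|.
  by move=> *; apply: (harm_lipschitz hf M0 fM rho0).
have shift x t s : `|x - x0| < s -> `|t| < rho -> `|x + t *: evec i - x0| < s + rho.
  move=> xs tr; rewrite addrAC (le_lt_trans (ler_normD _ _))// ltrD//.
  by rewrite (le_lt_trans (normZ_evec _ _)).
pose q h x := h^-1 * (f (x + h *: evec i) - f x).
have hq h s : `|h| + s <= r -> harm x0 s (q h).
  move=> hs; apply: (harmZ iso F0); apply: (harmB iso F0); first exact: harm_shift hs.
  by apply: harmS hf; rewrite subrr normr0 add0r (le_trans _ hs)// lerDr.
have qL h x : h != 0 -> `|h| < rho -> `|x - x0| < 6 * rho -> `|q h x| <= L1.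
  move=> h0 hr xr; rewrite /q normrM normfV ler_pdivrMl ?normr_gt0// mulrC.
  apply: lip1 => //; first lra.
  have := shift x h _ xr hr; lra.
have lip2 h x t : h != 0 -> `|h| < rho -> `|x - x0| < 5 * rho ->
    `|x + t *: evec i - x0| < 5 * rho -> `|t| < rho ->
    `|q h (x + t *: evec i) - q h x| <= L2 * `|t|.
  move=> h0 hr xr yr tr.
  have hh : `|h| + 6 * rho <= r by lra.
  apply: (harm_lipschitz (hq h _ hh) L10 _ rho0) => //.
  - by move=> y yr'; exact: qL.
  - by lra.
  - by lra.
have main x : `|x - x0| < 4 * rho -> exists l, forall h, `|h| < rho / 2 ->
    `|f (x + h *: evec i) - f x - h * l| <= 2 * L2 * h ^+ 2.
  move=> xr; pose g t := f (x + t *: evec i).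
  have gx t : `|t| < rho -> `|x + t *: evec i - x0| < 5 * rho.
    by move=> tr; have := shift x t _ xr tr; lra.
  have tri (a b : R) : `|a| < rho / 2 -> `|b| < rho / 2 -> `|a - b| < rho.
    by rewrite !ltr_norml => /andP[? ?] /andP[? ?]; apply/andP; split; lra.
  have lt2 (a : R) : `|a| < rho / 2 -> `|a| < rho.
    by move=> h; rewrite (lt_trans h)// ltr_pdivrMr// ltr_pMr// ltr1n.
  have [l hl] : exists l, forall h, `|h| < rho / 2 ->
      `|g h - g 0 - h * l| <= 2 * L2 * h ^+ 2.
    apply: (@second_diff_derive _ g (rho / 2) L2 L1).
    - by rewrite divr_gt0.
    - exact: ltW.
    - exact: ltW.
    - move=> s t sr tr; rewrite /g.
      have E : x + s *: evec i = (x + t *: evec i) + (s - t) *: evec i.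
        by rewrite -addrA -scalerDl [t + _]addrC subrK.
      rewrite E; apply: lip1; last exact: tri.
        by have := gx t (lt2 _ tr); lra.
      by rewrite -E; have := gx s (lt2 _ sr); lra.
    - move=> t h k tr thr tkr thkr; rewrite /g.
      have [->|h0] := eqVneq h 0.
        rewrite !addr0 normr0 mul0r mulr0.
        by rewrite (_ : _ + _ = 0) ?normr0//; ring.
      have hr : `|h| < rho by have := tri _ _ thr tr; rewrite addrAC subrr add0r.
      have kr : `|k| < rho by have := tri _ _ tkr tr; rewrite addrAC subrr add0r.
      have E1 : x + (t + k) *: evec i = (x + t *: evec i) + k *: evec i.
        by rewrite -addrA -scalerDl.
      have E2 : x + (t + h + k) *: evec i = (x + (t + k) *: evec i) + h *: evec i.
        by rewrite -[RHS]addrA -scalerDl addrAC.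
      have E3 : x + (t + h) *: evec i = (x + t *: evec i) + h *: evec i.
        by rewrite -addrA -scalerDl.
      have := lip2 h (x + t *: evec i) k h0 hr (gx _ (lt2 _ tr)).
      rewrite -E1 => /(_ (gx _ (lt2 _ tkr)) kr).
      rewrite /q -E2 -E3 -mulrBr normrM normfV.
      rewrite mulrC ler_pdivrMr ?normr_gt0// => hh.
      have -> : L2 * (`|h| * `|k|) = L2 * `|k| * `|h| by ring.
      by apply: le_trans hh; rewrite le_eqVlt; apply/orP; left; apply/eqP; congr `| _ |; ring.
  by exists l => h /hl; rewrite /g scale0r addr0.
have /choice[f' f'P] : forall x, exists l, `|x - x0| < 4 * rho ->
    forall h, `|h| < rho / 2 -> `|f (x + h *: evec i) - f x - h * l| <= 2 * L2 * h ^+ 2.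
  move=> x; have [/main[l hl]|_] := ltP `|x - x0| (4 * rho); first by exists l.
  by exists 0.
have r2 : r / 2 = 4 * rho by rewrite rE; field.
have r16 : r / 16 = rho / 2 by rewrite rE; field.
exists f'; rewrite r2 r16; split.
- apply: harm_unif => t t0.
  (* The quotient at step h differs from the derivative by at most 2 L2 h, hence by at most t. *)
  pose h := Order.min (rho / 4) (t / (2 * L2)).
  have h0 : 0 < h by rewrite lt_min !divr_gt0.
  have h1 : h <= rho / 4 by rewrite ge_min lexx.
  have hle : `|h| < rho / 2 by rewrite gtr0_norm//; lra.
  have h2 : 2 * L2 * h <= t.
    have -> : t = 2 * L2 * (t / (2 * L2)) by field; rewrite gt_eqF.
    by rewrite ler_pM2l// ge_min lexx orbT.
  exists (q h); first by apply: hq; rewrite gtr0_norm//; lra.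
  move=> x xr; have := f'P x xr h hle.
  have -> : f (x + h *: evec i) - f x - h * f' x = h * (q h x - f' x).
    by rewrite /q; field; rewrite gt_eqF.
  rewrite normrM (gtr0_norm h0) expr2 mulrA mulrC ler_pM2r//.
  by move=> hh; apply: le_trans hh h2.
- by exists (2 * L2) => x h xr hr; exact: f'P.
- exists L1 => x h xr hr; apply: lip1; first lra.
    have hr' : `|h| < rho by lra.
    by have := shift x h _ xr hr'; lra.
  lra.
Qed.

End Derivative.

(** * First and second order expansions *)

Section Calculus.
Context {R : realType}.

(** In this form, free of quotients, errors add up directly and h = 0 is included. *)
Lemma is_deriveP (W : normedModType R) (f : W -> R) x (v : W) (l : R) :
  is_derive x v f l <-> forall e, 0 < e -> exists2 d, 0 < d & forall h, `|h| < d ->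
    `|f (x + h *: v) - f x - h * l| <= e * `|h|.
Proof.
pose Q h : R := h^-1 *: (f (h *: v + x) - f x).
have QE h : h != 0 -> `|f (x + h *: v) - f x - h * l| = `|h| * `|l - Q h|.
  move=> h0; rewrite -normrM distrC; congr `|_|; rewrite /Q [x + _]addrC.
  by rewrite -[h^-1 *: _]/(h^-1 * _) mulrBr mulrA mulfV// mul1r.
split=> [[dfv Dl] e e0|h].
  have cQ : Q @ 0^' --> (l : R^o) by rewrite -Dl; exact: dfv.
  have /(@cvgrPdist_lt R R^o R 0^' _ Q l) /(_ e e0) := cQ.
  move=> /nbhs_ballP[d /= d0 hd]; exists d => // h hh.
  have [->|h0] := eqVneq h 0.
    by rewrite scale0r addr0 subrr mul0r subrr normr0 mulr0.
  rewrite QE// mulrC ler_wpM2r// ltW// hd// /ball /= sub0r normrN.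
  exact: hh.
suff cQ : Q @ 0^' --> l.
  have dfv : derivable f x v by apply/cvg_ex; exists l.
  by split=> //; apply/cvg_lim.
apply/(@cvgrPdist_lt R R^o R 0^' _ Q l) => e e0.
have e2 : 0 < e / 2 by rewrite divr_gt0.
have [d d0 hd] := h _ e2; apply/nbhs_ballP; exists d => //= k.
rewrite /ball /= sub0r normrN => kd k0; have := hd k kd.
rewrite QE// mulrC ler_pM2r ?normr_gt0// => /le_lt_trans; apply.
by rewrite ltr_pdivrMr// ltr_pMr// ltr1n.
Qed.

Context {N : nat}.
Local Notation V := 'rV[R]_N.

Lemma row_sum_evec (v : V) : v = \sum_(i < N) v ord0 i *: evec i.
Proof.
apply/rowP => j; rewrite summxE (bigD1 j)//= big1 ?addr0 => [|i ij].
  by rewrite !mxE !eqxx mulr1.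
by rewrite !mxE eqxx eq_sym (negbTE ij) mulr0.
Qed.

Lemma near0_normP (P : V -> Prop) :
  (\forall v \near nbhs (0 : V), P v) <-> exists2 d, 0 < d & forall v, `|v| < d -> P v.
Proof.
rewrite -[X in X <-> _]/(nbhs (0 : V) [set v | P v]) nbhs_normV.
by split=> -[d d0 h]; exists d => // v; have := h v; rewrite subr0.
Qed.

Lemma differentiable_expansion (f : V -> R) x : differentiable f x ->
  forall e, 0 < e -> exists2 d, 0 < d & forall v, `|v| < d ->
    `|f (x + v) - f x - \sum_i v ord0 i * 'D_(evec i) f x| <= e * `|v|.
Proof.
move=> df e e0; have /diff_locally/eqaddoP/(_ e e0)/near0_normP[d d0 hd] := df.
exists d => // v /hd.
rewrite (_ : (f \o shift x - (cst (f x) + 'd f x)) v = f (v + x) - (f x + 'd f x v))//.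
suff -> : 'd f x v = \sum_i v ord0 i * 'D_(evec i) f x.
  by rewrite [v + x]addrC opprD addrA.
rewrite {1}(row_sum_evec v) linear_sum; apply: eq_bigr => i _.
by rewrite linearZ /= deriveE.
Qed.

Lemma expansion_differentiable (f : V -> R) x (l : 'I_N -> R) :
  (forall e, 0 < e -> exists2 d, 0 < d & forall v, `|v| < d ->
    `|f (x + v) - f x - \sum_i v ord0 i * l i| <= e * `|v|) -> differentiable f x.
Proof.
move=> hf; pose L (v : V) : R := \sum_i v ord0 i * l i.
have linL : linear (L : V -> R^o).
  move=> a u v; rewrite /L /GRing.scale /= mulr_sumr -big_split /=.
  by apply: eq_bigr => i _; rewrite !mxE; ring.
pose LL : {linear V -> R^o} := HB.pack L (GRing.isLinear.Build _ _ _ _ L linL).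
have cL : continuous LL.
  apply: (@lipschitz_continuousV _ _ L (\sum_i `|l i|)) => u v.
  rewrite /L -sumrB mulr_suml; apply: ler_sum => i _.
  rewrite -mulrBl mulrC (le_trans (ler_norm _))// normrM ler_wpM2l//.
  by have := coord_le_norm (u - v) i; rewrite !mxE.
have lit e : 0 < e -> \forall v \near nbhs (0 : V),
    `|((f : V -> R^o) \o shift x - (cst (f x : R^o) + LL)) v| <= e * `|v|.
  move=> /hf[d d0 hd]; apply/near0_normP; exists d => // z /hd.
  rewrite (_ : ((f : V -> R^o) \o shift x - (cst (f x : R^o) + LL)) z =
    f (z + x) - (f x + L z))//.
  by rewrite [x + z]addrC opprD addrA.
have fE := proj2 (eqaddoP _ _ _ _) lit.
have dE : 'd f x = LL :> (V -> R^o) by exact: diff_unique.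
by apply/diff_locallyP; rewrite dE; split.
Qed.

(* Moving from x to x + v one coordinate at a time. *)
Lemma partials_differentiable (f : V -> R) x (l : 'I_N -> V -> R) (C : 'I_N -> R) r :
  0 < r -> (forall i y h, `|y - x| < r -> `|h| < r ->
    `|f (y + h *: evec i) - f y - h * l i y| <= C i * h ^+ 2) ->
  (forall i, {for x, continuous (l i)}) -> differentiable f x.
Proof.
move=> r0 hC cl; apply: (@expansion_differentiable _ _ (fun i => l i x)) => e e0.
pose p (v : V) k : V := \row_j (if (j < k)%N then v ord0 j else 0).
have pS v (i : 'I_N) : p v i.+1 = p v i + v ord0 i *: evec i.
  apply/rowP => j; rewrite !mxE eqxx /= ltnS leq_eqVlt -val_eqE /=.
  by case: ltngtP => //= ji; rewrite ?mulr0 ?addr0// mulr1 add0r; congr (v _ _); exact/val_inj.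
have p0 v : p v 0%N = 0 by apply/rowP => j; rewrite !mxE.
have pN v : p v N = v by apply/rowP => j; rewrite !mxE ltn_ord.
have pn v k : `|p v k| <= `|v|.
  apply: norm_le_coord => // j; rewrite mxE; case: ifP => _; rewrite ?normr0//.
  exact: coord_le_norm.
(* N errors of size t |v| add up to at most e |v|; N + 1 keeps the divisor nonzero in dimension
   0. *)
pose t := e / N.+1%:R; have t0 : 0 < t by rewrite divr_gt0.
pose T (v : V) (i : 'I_N) := f (x + p v i.+1) - f (x + p v i) - v ord0 i * l i x.
suff /filter_forall /near0_normP[d d0 hd] :
    forall i, \forall v \near nbhs (0 : V), `|T v i| <= t * `|v|.
  exists d => // v vd.
  have -> : f (x + v) - f x = \sum_(i < N) (f (x + p v i.+1) - f (x + p v i)).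
    rewrite -(big_mkord xpredT (fun i => f (x + p v i.+1) - f (x + p v i))).
    by rewrite telescope_sumr// pN p0 addr0.
  rewrite -sumrB (le_trans (ler_norm_sum _ _ _))//.
  apply: (@le_trans _ _ (\sum_(i < N) t * `|v|)).
    by apply: ler_sum => i _; exact: hd.
  rewrite sumr_const card_ord -mulrnAl ler_wpM2r// /t -mulr_natr mulrAC.
  by rewrite ler_pdivrMr// ler_wpM2l ?(ltW e0)// ler_nat.
move=> i; apply/near0_normP.
have t2 : 0 < t / 2 by rewrite divr_gt0.
have /continuousV_P/(_ _ t2)[d1 d10 h1] := cl i.
have C0 : 0 < `|C i| + 1 by rewrite ltr_wpDl.
pose d := Order.min (Order.min r d1) (t / 2 / (`|C i| + 1)).
exists d; first by rewrite !lt_min r0 d10 divr_gt0.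
move=> v; rewrite !lt_min => /andP[/andP[vr vd1] vC].
have vi := coord_le_norm v i.
have E : `|x + p v i - x| <= `|v| by rewrite addrAC subrr add0r.
have := hC i (x + p v i) (v ord0 i) (le_lt_trans E vr) (le_lt_trans vi vr).
have E2 : x + p v i + v ord0 i *: evec i = x + p v i.+1 by rewrite pS addrA.
rewrite E2 => k1; have k2 := h1 _ (le_lt_trans E vd1).
have -> : T v i = (f (x + p v i.+1) - f (x + p v i) - v ord0 i * l i (x + p v i)) +
    v ord0 i * (l i (x + p v i) - l i x) by rewrite /T; ring.
rewrite [t]splitr mulrDl (le_trans (ler_normD _ _))// lerD//.
  apply: (le_trans k1); rewrite -real_normK ?num_real//.
  apply: (@le_trans _ _ ((`|C i| + 1) * `|v| * `|v|)).
    apply: (@le_trans _ _ ((`|C i| + 1) * `|v ord0 i| ^+ 2)).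
      by rewrite ler_wpM2r ?sqr_ge0// (le_trans (ler_norm _))// lerDl.
    by rewrite -mulrA ler_wpM2l ?(ltW C0)// expr2 ler_pM.
  by rewrite ler_wpM2r// mulrC -ler_pdivlMr// ltW.
by rewrite normrM mulrC ler_pM// ltW.
Qed.

Lemma differentiable_ray (u : V -> R) x v t : differentiable u (x + t *: v) ->
  is_derive t 1 (fun s => u (x + s *: v))
    (\sum_i v ord0 i * 'D_(evec i) u (x + t *: v)).
Proof.
move=> du; set S := \sum_i _.
apply/is_deriveP => e e0.
have v0 : 0 < `|v| + 1 by rewrite ltr_wpDl.
have [d d0 hd] := differentiable_expansion du (divr_gt0 e0 v0).
exists (d / (`|v| + 1)); first exact: divr_gt0.
move=> h hh; have hv : `|h *: v| < d.
  rewrite normrZ; apply: (@le_lt_trans _ _ (`|h| * (`|v| + 1))).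
    by rewrite ler_wpM2l// lerDl.
  by rewrite -ltr_pdivlMr.
have := hd _ hv.
have -> : x + t *: v + h *: v = x + (t + h) *: v by rewrite -addrA -scalerDl.
have -> : \sum_i (h *: v) ord0 i * 'D_(evec i) u (x + t *: v) = h * S.
  by rewrite /S mulr_sumr; apply: eq_bigr => i _; rewrite mxE mulrA.
rewrite -[h *: 1]/(h * 1) mulr1 => /le_trans; apply.
rewrite normrZ.
have -> : e / (`|v| + 1) * (`|h| * `|v|) = e * `|h| * (`|v| / (`|v| + 1)) by ring.
by rewrite ler_piMr ?mulr_ge0 ?(ltW e0)// ler_pdivrMr// mul1r lerDl.
Qed.

(** Along the segment from x to x + v the remainder [psi] vanishes at 0, and its derivative [dpsi]
    pairs v with the first order remainder of the gradient, so that it is at most k |v|^2; the mean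
    value theorem concludes. *)
Lemma taylor2 (D : set V) (u : V -> R) x : open D -> C2_on D u -> D x ->
  forall k, 0 < k -> exists2 d, 0 < d & forall v, `|v| < d ->
   `|u (x + v) - u x - \sum_i v ord0 i * 'D_(evec i) u x
     - 2^-1 * \sum_i \sum_j v ord0 i * v ord0 j * 'D_(evec j) ('D_(evec i) u) x|
   <= k * `|v| ^+ 2.
Proof.
move=> oD [du ddu _] Dx k k0.
have /nbhs_normV[r r0 rD] : nbhs x D by exact: open_nbhs_nbhs.
pose k' := k / N.+1%:R; have k'0 : 0 < k' by rewrite divr_gt0.
have /filter_forall /near0_normP[d d0 hd] : forall i, \forall v \near nbhs (0 : V),
   `|'D_(evec i) u (x + v) - 'D_(evec i) u x - \sum_j v ord0 j * 'D_(evec j) ('D_(evec i) u) x|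
     <= k' * `|v|.
  by move=> i; apply/near0_normP; exact: (differentiable_expansion (ddu i x Dx)).
exists (Order.min r d); first by rewrite lt_min r0.
move=> v; rewrite lt_min => /andP[vr vd].
set S1 := \sum_i v ord0 i * _; set S2 := \sum_i \sum_j _.
pose psi s := u (x + s *: v) - u x - s * S1 - s ^+ 2 * (2^-1 * S2).
pose dpsi s := \sum_i v ord0 i * 'D_(evec i) u (x + s *: v) - S1 - s * S2.
have sv (s : R) : 0 <= s <= 1 -> `|s *: v| <= `|v|.
  by move=> /andP[s0 s1]; rewrite normrZ ger0_norm// ler_piMl.
have dP (s : R) : 0 <= s <= 1 -> is_derive s 1 psi (dpsi s).
  move=> s01; have Dsv : D (x + s *: v).
    by apply: rD; rewrite addrAC subrr add0r (le_lt_trans (sv _ s01)).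
  have /is_deriveP hu := differentiable_ray (du _ Dsv).
  apply/is_deriveP => e e0; have e2 : 0 < e / 2 by rewrite divr_gt0.
  have [b b0 hb] := hu _ e2.
  have S20 : 0 < `|2^-1 * S2| + 1 by rewrite ltr_wpDl.
  exists (Order.min b (e / 2 / (`|2^-1 * S2| + 1))); first by rewrite lt_min b0 divr_gt0.
  move=> h; rewrite lt_min => /andP[hb1 hb2].
  have := hb h hb1; rewrite -![h *: 1]/(h * 1) !mulr1 => hb3.
  set A := _ - _ - _ in hb3.
  have -> : psi (s + h) - psi s - h * dpsi s = A - h * (h * (2^-1 * S2)).
    by rewrite /psi /dpsi /A; field.
  rewrite [e]splitr mulrDl (le_trans (ler_normB _ _))// lerD//.
  rewrite normrM mulrC ler_wpM2r// normrM.
  apply: (@le_trans _ _ (`|h| * (`|2^-1 * S2| + 1))).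
    by rewrite ler_wpM2l// lerDl.
  by rewrite -ler_pdivlMr// ltW.
have cpsi : {within `[0, 1], continuous psi}.
  apply: derivable_within_continuous => s.
  by rewrite in_itv /= => s01; have [] := dP s s01.
have oo (s : R) : s \in `]0, 1[ -> 0 <= s <= 1.
  by rewrite in_itv /= => /andP[s0 s1]; rewrite !ltW.
have [s /oo s01] := MVT ltr01 (fun s hs => dP s (oo s hs)) cpsi.
have -> : psi 1 = u (x + v) - u x - S1 - 2^-1 * S2.
  by rewrite /psi scale1r expr1n !mul1r.
have -> : psi 0 = 0 by rewrite /psi scale0r addr0 expr0n !mul0r !subr0 subrr.
rewrite !subr0 mulr1 => ->.
have -> : dpsi s = \sum_i v ord0 i * ('D_(evec i) u (x + s *: v) - 'D_(evec i) u x
    - \sum_j (s *: v) ord0 j * 'D_(evec j) ('D_(evec i) u) x).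
  rewrite /dpsi /S1 /S2 mulr_sumr -!sumrB; apply: eq_bigr => i _.
  rewrite !mulrBr; congr (_ - _); rewrite !mulr_sumr; apply: eq_bigr => j _.
  by rewrite mxE; ring.
rewrite (le_trans (ler_norm_sum _ _ _))//.
apply: (@le_trans _ _ (\sum_(i < N) k' * `|v| ^+ 2)).
  apply: ler_sum => i _; rewrite normrM expr2 mulrCA ler_pM//.
    exact: coord_le_norm.
  apply: le_trans (hd _ _ i) _; first exact: le_lt_trans (sv _ s01) vd.
  by rewrite ler_wpM2l ?(ltW k'0)// sv.
rewrite sumr_const card_ord -mulrnAl ler_wpM2r ?sqr_ge0// /k' -mulr_natr mulrAC.
by rewrite ler_pdivrMr// ler_wpM2l ?(ltW k0)// ler_nat.
Qed.

End Calculus.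

(** * Limits are twice continuously differentiable and harmonic *)

Section Regularity.
Context {R : realType} {N : nat}.
Local Notation V := 'rV[R]_N.
Local Notation VM := (borelV R N).
Variables (mu : probability VM R) (c : R).
Hypotheses (iso : isotropic mu c) (N0 : (0 < N)%N).
Variable F : set_system R.
Context {FF : ProperFilter F}.
Hypothesis F0 : forall d, 0 < d -> F [set e | 0 < e < d].
Local Notation harm := (harm mu F).
Implicit Types (f g u : V -> R) (x y p v : V) (r e : R).

Definition loc_harm (D : set V) u := forall x, D x -> exists2 r, 0 < r & harm x r u.

Lemma harm_is_derive x0 r f i : harm x0 r f -> 0 < r ->
  harm x0 (r / 2) ('D_(evec i) f) /\
  exists C, forall x h, `|x - x0| < r / 16 -> `|h| < r / 16 ->
     `|f (x + h *: evec i) - f x - h * 'D_(evec i) f x| <= C * h ^+ 2.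
Proof.
move=> hf r0; have [f' [hf' [C hC] _]] := harm_derivative iso N0 F0 i hf r0.
have r16 : 0 < r / 16 by rewrite divr_gt0.
have dE x : `|x - x0| < r / 2 -> 'D_(evec i) f x = f' x.
  move=> xr; suff [] : is_derive x (evec i) f (f' x) by [].
  apply/is_deriveP => e e0.
  have C0 : 0 < `|C| + 1 by rewrite ltr_wpDl.
  exists (Order.min (r / 16) (e / (`|C| + 1))); first by rewrite lt_min r16 divr_gt0.
  move=> h; rewrite lt_min => /andP[hr hC'].
  apply: (le_trans (hC x h xr hr)); rewrite -real_normK ?num_real// expr2 mulrA.
  rewrite ler_wpM2r//; apply: (@le_trans _ _ ((`|C| + 1) * `|h|)).
    by rewrite ler_wpM2r// (le_trans (ler_norm _))// lerDl.
  by rewrite mulrC -ler_pdivlMr// ltW.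
split; first by apply: harm_ext hf' => x xr; rewrite dE.
exists C => x h xr hr.
have xr2 : `|x - x0| < r / 2 by lra.
by rewrite dE//; exact: hC.
Qed.

Lemma loc_harm_derive D u i : loc_harm D u -> loc_harm D ('D_(evec i) u).
Proof.
move=> hu x /hu[r r0 /harm_is_derive hx]; have [hi _] := hx i r0.
by exists (r / 2) => //; rewrite divr_gt0.
Qed.

Lemma loc_harm_continuous D u x : loc_harm D u -> D x -> {for x, continuous u}.
Proof. by move=> hu /hu[r r0 [cu _ _]]; apply: cu; rewrite subrr normr0. Qed.

Lemma loc_harm_differentiable D u x : loc_harm D u -> D x -> differentiable u x.
Proof.
move=> hu Dx; have [r r0 hx] := hu x Dx.
have /choice[C hC] := fun i => proj2 (harm_is_derive i hx r0).
apply: (@partials_differentiable _ _ u x (fun i => 'D_(evec i) u) C (r / 16)).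
- by rewrite divr_gt0.
- by move=> i y h yr hr; exact: hC.
- by move=> i; exact: (loc_harm_continuous (loc_harm_derive i hu)).
Qed.

Lemma loc_harm_C2 D u : loc_harm D u -> C2_on D u.
Proof.
move=> hu; split.
- by move=> x; exact: loc_harm_differentiable.
- by move=> i x; exact: loc_harm_differentiable (loc_harm_derive i hu).
- move=> i j x; apply: loc_harm_continuous; exact/loc_harm_derive/loc_harm_derive.
Qed.

Lemma norm_sqr_le_sqn v : `|v| ^+ 2 <= sqn v.
Proof.
rewrite -[leRHS]enorm_sqr lerXn2r ?nnegrE ?enorm_ge0//; exact: norm_le_enorm.
Qed.

(** If the trace of Q were negative, the Taylor polynomial plus k |v|^2 would touch u from above at
    x while keeping a negative Laplacian: k is chosen to use up half of it. The coefficients are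
    arbitrary so that the lemma applies to -u with the negated derivatives of u. *)
Lemma harm_laplacian_ge0 x r u (a : 'I_N -> R) (Q : 'I_N -> 'I_N -> R) :
  harm x r u -> 0 < r ->
  (forall k, 0 < k -> exists2 d, 0 < d & forall v, `|v| < d ->
   `|u (x + v) - u x - \sum_i v ord0 i * a i
     - 2^-1 * \sum_i \sum_j v ord0 i * v ord0 j * Q i j| <= k * `|v| ^+ 2) ->
  0 <= \sum_i Q i i.
Proof.
move=> hu r0 hT; set L := \sum_i _; rewrite leNgt; apply/negP => L0.
pose k := - L / (4 * N%:R); have n0 : 0 < N%:R :> R by rewrite ltr0n.
have k0 : 0 < k by rewrite divr_gt0 ?oppr_gt0// mulr_gt0.
pose q0 (v : V) : R := \sum_i a i * v ord0 i
    + (2^-1 * (\sum_i \sum_j Q i j * (v ord0 i * v ord0 j)) + k * sqn v).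
have pq0 : parabolic mu q0 (\sum_i a i * 0
   + (2^-1 * (\sum_i \sum_j Q i j * (c * (i == j)%:R)) + k * (N%:R * c))).
  apply: (parabolicD iso).
    apply: (parabolic_sum iso) => i; apply: (parabolicZ iso).
    exact: (parabolic_coord iso).
  apply: (parabolicD iso).
    apply: (parabolicZ iso); apply: (parabolic_sum iso) => i.
    apply: (parabolic_sum iso) => j; apply: (parabolicZ iso).
    exact: (parabolic_coordM iso).
  apply: (parabolicZ iso); have := parabolic_sqn iso 0.
  by congr parabolic; apply/funext => y; rewrite subr0.
have lE : \sum_i a i * 0
   + (2^-1 * (\sum_i \sum_j Q i j * (c * (i == j)%:R)) + k * (N%:R * c)) = c * L / 4.
  rewrite big1 ?add0r => [|i _]; last by rewrite mulr0.
  have -> : \sum_i \sum_j Q i j * (c * (i == j)%:R) = c * L.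
    rewrite /L mulr_sumr; apply: eq_bigr => i _.
    rewrite (bigD1 i)//= big1 ?addr0 => [|j ji].
      by rewrite eqxx mulr1 mulrC.
    by rewrite eq_sym (negbTE ji) !mulr0.
  by rewrite /k; field; rewrite gt_eqF.
rewrite lE in pq0.
have pq := parabolic_shift x pq0.
have c0 := iso_gt0 iso.
have l0 : c * L / 4 < 0 by rewrite pmulr_llt0 ?invr_gt0// pmulr_rlt0.
have [d d0 hd] := hT k k0.
pose s := Order.min d r; have s0 : 0 < s by rewrite lt_min d0.
have H p0 := @harm_no_touching _ _ mu c iso N0 F FF F0 x r u _ _ p0 s hu pq l0 s0.
apply: (H x).
  by rewrite subrr normr0 add0r ge_min lexx orbT.
have q00 : q0 (x - x) = 0.
  rewrite subrr /q0 /sqn !big1 ?mulr0 ?addr0// => i _.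
  - by rewrite mxE expr0n.
  - by rewrite big1// => j _; rewrite mxE mul0r mulr0.
  - by rewrite mxE mulr0.
rewrite q00 subr0 => y; rewrite lt_min => /andP[yd _].
have := hd _ yd; rewrite [x + _]addrC subrK.
have E1 : \sum_i (y - x) ord0 i * a i = \sum_i a i * (y - x) ord0 i.
  by apply: eq_bigr => i _; rewrite mulrC.
have E2 : \sum_i \sum_j (y - x) ord0 i * (y - x) ord0 j * Q i j =
    \sum_i \sum_j Q i j * ((y - x) ord0 i * (y - x) ord0 j).
  by apply: eq_bigr => i _; apply: eq_bigr => j _; rewrite mulrC.
rewrite E1 E2 ler_norml => /andP[_ h]; rewrite /q0.
have : k * `|y - x| ^+ 2 <= k * sqn (y - x).
  by rewrite ler_pM2l// norm_sqr_le_sqn.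
move: h; set s1 := \sum_i a i * (y - x) ord0 i.
by set s2 := \sum_i \sum_j Q i j * ((y - x) ord0 i * (y - x) ord0 j); lra.
Qed.

Lemma loc_harm_laplacian D u x : open D -> loc_harm D u -> D x -> laplacian u x = 0.
Proof.
move=> oD hu Dx; have [r r0 hx] := hu x Dx.
have T := taylor2 oD (loc_harm_C2 hu) Dx.
have hNx : harm x r (fun y => -1 * u y) by exact: (harmZ iso F0).
apply/eqP; rewrite eq_le; apply/andP; split; last exact: harm_laplacian_ge0 hx r0 T.
rewrite -oppr_ge0 /laplacian -sumrN.
apply: (@harm_laplacian_ge0 x r (fun y => -1 * u y) (fun i => - 'D_(evec i) u x)
  (fun i j => - 'D_(evec j) ('D_(evec i) u) x)) => // k /T[d d0 hd].
exists d => // v /hd.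
have -> : \sum_i v ord0 i * - 'D_(evec i) u x = - \sum_i v ord0 i * 'D_(evec i) u x.
  by rewrite -sumrN; apply: eq_bigr => i _; rewrite mulrN.
have -> : \sum_i \sum_j v ord0 i * v ord0 j * - 'D_(evec j) ('D_(evec i) u) x =
    - \sum_i \sum_j v ord0 i * v ord0 j * 'D_(evec j) ('D_(evec i) u) x.
  rewrite -sumrN; apply: eq_bigr => i _; rewrite -sumrN; apply: eq_bigr => j _.
  by rewrite mulrN.
set S1 := \sum_i v ord0 i * _; set S2 := \sum_i \sum_j _.
rewrite (_ : -1 * u (x + v) - _ - _ - _ = - (u (x + v) - u x - S1 - 2^-1 * S2)) ?normrN//.
by move: (u _) (u _) S1 S2 => *; ring.
Qed.

End Regularity.

(** * The law of a step *)

Section IteratedIntegral.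
Context {R : realType}.

(** [iint] acts on functions of whole sequences, so measurability is taken with respect to all
    coordinates at once, uniformly in the number of integrations. *)
Definition seq_cylinders : set (set (nat -> R)) :=
  [set C | exists j A, measurable A /\ C = (fun x : nat -> R => x j) @^-1` A].

Definition seqR := g_sigma_algebraType seq_cylinders.
HB.instance Definition _ := Measurable.on seqR.

Lemma measurable_seqR d (T : measurableType d) (f : T -> seqR) :
  (forall j, measurable_fun setT (fun t => f t j)) -> measurable_fun setT f.
Proof.
move=> mf; apply: (@measurability _ _ _ _ setT f seq_cylinders) => //.
move=> _ [_ [j [A [mA ->]]] <-].
exact: (mf j measurableT A mA).
Qed.

Lemma measurable_seq_coord j : measurable_fun setT (fun x : seqR => x j).
Proof.
move=> _ A mA; rewrite setTI; apply: sub_sigma_algebra.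
by exists j, A.
Qed.

Definition upd (k : nat) (x : nat -> R) (t : R) : nat -> R :=
  fun j => if j == k then t else x j.

Lemma measurable_upd k :
  measurable_fun setT (fun xt : seqR * R => upd k xt.1 xt.2 : seqR).
Proof.
apply: measurable_seqR => j; rewrite /upd; case: (j == k).
  exact: measurable_snd.
apply: (@measurableT_comp _ _ _ _ seqR R (fun x : seqR => x j) setT fst).
  exact: measurable_seq_coord.
exact: measurable_fst.
Qed.

Let leb := @lebesgue_measure R.

Definition nonneg_measurable (g : seqR -> \bar R) :=
  measurable_fun setT g /\ forall x, (0 <= g x)%E.

Lemma iintS k g x : iint k.+1 g x = (\int[leb]_t iint k g (upd k x t))%E.
Proof. by []. Qed.

Lemma iint_measurable k g : nonneg_measurable g -> nonneg_measurable (iint k g).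
Proof.
move=> hg; elim: k => //= k [mk k0]; split; last first.
  by move=> x; apply: integral_ge0 => t _; exact: k0.
apply: (@measurable_fun_fubini_tonelli_F _ _ seqR (measurableTypeR R) R leb
  (fun xt => iint k g (upd k xt.1 xt.2))).
- by apply: (@measurableT_comp _ _ _ _ _ _ (iint k g : seqR -> \bar R)) => //; exact: measurable_upd.
- by move=> xt; exact: k0.
Qed.

Lemma measurable_upd2 k x : measurable_fun setT (fun t : measurableTypeR R => upd k x t : seqR).
Proof.
apply: measurable_seqR => j; rewrite /upd; case: (j == k).
  exact: measurable_id.
exact: measurable_cst.
Qed.

Lemma integral_lebesgue_opp (h : R -> \bar R) :
  measurable_fun setT h -> (forall t, (0 <= h t)%E) ->
  (\int[leb]_t h (- t)%R = \int[leb]_t h t)%E.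
Proof.
move=> mh h0.
rewrite -[RHS](@eq_measure_integral _ _ _ _ _ (pushforward leb (-%R : _ -> measurableTypeR R))).
  by rewrite ge0_integral_pushforward//= preimage_setT.
by move=> A mA _; exact: lebesgue_measureN.
Qed.

Definition flip (i : nat) (x : nat -> R) : nat -> R :=
  fun j => if j == i then - x j else x j.

(** Coordinates from k on are mere parameters of the k inner integrations, so a sign change in one
    of them passes through. *)
Lemma iint_flip_ge k g i x : (k <= i)%N ->
  iint k (fun y => g (flip i y)) x = iint k g (flip i x).
Proof.
elim: k x => // k IH x ki; rewrite !iintS; apply: eq_integral => t _.
rewrite IH ?(ltnW ki)//; congr iint; apply/funext => j; rewrite /flip /upd.
by case: (eqVneq j i) => // ->; rewrite gtn_eqF.
Qed.

Lemma iint_flip k g i x : nonneg_measurable g -> (i < k)%N ->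
  iint k (fun y => g (flip i y)) x = iint k g x.
Proof.
move=> hg; elim: k x => // k IH x; rewrite ltnS leq_eqVlt => /orP[/eqP ->|ik].
  rewrite !iintS; have [mk k0] := iint_measurable k hg.
  rewrite -[RHS](@integral_lebesgue_opp (fun t => iint k g (upd k x t))).
  - apply: eq_integral => t _; rewrite iint_flip_ge//.
    by congr iint; apply/funext => j; rewrite /flip /upd; case: (j == k).
  - by apply: (@measurableT_comp _ _ _ _ _ _ (iint k g : seqR -> \bar R)) => //; exact: measurable_upd2.
  - by move=> t; exact: k0.
by rewrite !iintS; apply: eq_integral => t _; exact: IH.
Qed.

Definition swap_next (i : nat) (x : nat -> R) : nat -> R :=
  fun j => if j == i then x i.+1 else if j == i.+1 then x i else x j.

Lemma iint_swap_ge k g i x : (k <= i)%N ->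
  iint k (fun y => g (swap_next i y)) x = iint k g (swap_next i x).
Proof.
elim: k x => // k IH x ki; rewrite !iintS; apply: eq_integral => t _.
rewrite IH ?(ltnW ki)//; congr iint; apply/funext => j; rewrite /swap_next /upd.
rewrite (gtn_eqF ki) (gtn_eqF (ltnW ki : (k < i.+1)%N)).
case: (eqVneq j i) => [->|_]; first by rewrite gtn_eqF.
by case: (eqVneq j i.+1) => // ->; rewrite gtn_eqF// ltnW.
Qed.

(** The two variables are integrated consecutively, so Tonelli's theorem exchanges them; this is the
    reason for working with neighbouring coordinates. *)
Lemma iint_swap k g i x : nonneg_measurable g -> (i.+1 < k)%N ->
  iint k (fun y => g (swap_next i y)) x = iint k g x.
Proof.
move=> hg; elim: k x => // k IH x; rewrite ltnS leq_eqVlt => /orP[/eqP <-|ik]; last first.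
  by rewrite !iintS; apply: eq_integral => t _; exact: IH.
rewrite !iintS.
have [mi i0] := iint_measurable i hg.
have E t s : swap_next i (upd i (upd i.+1 x t) s) = upd i (upd i.+1 x s) t.
  apply/funext => j; rewrite /swap_next /upd eqxx.
  case: (eqVneq j i) => [_|ji]; first by rewrite eqn_leq ltnn.
  by rewrite eqxx; case: (eqVneq j i.+1).
transitivity (\int[leb]_t \int[leb]_s iint i g (upd i (upd i.+1 x s) t))%E.
  apply: eq_integral => t _; rewrite iintS; apply: eq_integral => s _.
  by rewrite iint_swap_ge// E.
transitivity (\int[leb]_s \int[leb]_t iint i g (upd i (upd i.+1 x s) t))%E; last by [].
apply: (@fubini_tonelli _ _ (measurableTypeR R) (measurableTypeR R) R leb leb
  (fun ts => iint i g (upd i (upd i.+1 x ts.2) ts.1))) => [|ts]; last exact: i0.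
apply: (@measurableT_comp _ _ _ _ _ _ (iint i g : seqR -> \bar R)) => //.
apply: measurable_seqR => j; rewrite /upd; case: (j == i); first exact: measurable_fst.
case: (j == i.+1); first exact: measurable_snd.
exact: measurable_cst.
Qed.

Lemma iint_eq0 k (g : (nat -> R) -> \bar R) x : (forall y, (forall j, (k <= j)%N -> y j = x j) -> g y = 0%E) ->
  iint k g x = 0%E.
Proof.
elim: k x => [|k IH] x g0; first exact: g0.
rewrite iintS integral0_eq// => t _; apply: IH => y hy; apply: g0 => j kj.
by rewrite hy ?(ltnW kj)// /upd gtn_eqF.
Qed.

(** The variable k is the outermost one, so the claim reduces to the nullity of a point on the line.
    For this reason the positivity of the second moment is first proved for the last coordinate. *)
Lemma iint_hyperplane k (g : (nat -> R) -> \bar R) x : (forall y, y k != 0 -> g y = 0%E) ->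
  iint k.+1 g x = 0%E.
Proof.
move=> g0; rewrite iintS.
transitivity (\int[leb]_(t in [set (0:R)%R]) iint k g (upd k x t))%E; last exact: integral_set1.
rewrite [RHS]integral_mkcond; apply: eq_integral => t _; rewrite patchE.
case: ifPn => //; rewrite notin_setE /= => /eqP t0; apply: iint_eq0 => y hy.
by apply: g0; rewrite hy// /upd eqxx.
Qed.

End IteratedIntegral.
Arguments seqR : clear implicits.

(** * Isotropy of the uniform law on the ball *)

Section Law.
Context {R : realType} {N : nat}.
Local Notation V := 'rV[R]_N.
Local Notation VM := (borelV R N).
Local Notation B := (eball (0 : V) 1).
Context {d : measure_display} {T : measurableType d}.
Variables (P : probability T R) (w : nat -> T -> V).
Hypotheses (iid : iid_uniform_ball P w) (N0 : (0 < N)%N).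

Lemma measurable_step k : measurable_fun setT (w k : T -> VM).
Proof. by move=> _ A mA; rewrite setTI; have [h _ _] := iid; exact: h. Qed.

Let W : {mfun T >-> VM} := mfun_Sub (mem_set (measurable_step 0)).

Definition step_law : probability VM R := distribution P W.

Lemma step_lawE k (A : set VM) : measurable A -> P (w k @^-1` A) = step_law A.
Proof. by move=> mA; have [_ h _] := iid; rewrite [LHS]h// [RHS]h. Qed.

Lemma step_law_lebN (A : set VM) : measurable A ->
  step_law A = (fine (lebN ((A : set V) `&` B)) / fine (lebN B))%:E.
Proof. by move=> mA; have [_ h _] := iid; exact: h. Qed.

(** The volume is not computed: the whole space has probability 1, whereas the formula for the law
    would give 0 if the denominator vanished, division by zero being zero. *)
Lemma fine_lebN_ball : fine (lebN B) != 0.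
Proof.
have := step_law_lebN (@measurableT _ VM).
rewrite [LHS]probability_setT setTI => /eqP; rewrite eqe => /eqP h.
by apply/eqP => B0; move: h; rewrite B0 mul0r => /eqP; rewrite oner_eq0.
Qed.

Lemma step_law_ball : step_law B = 1%E.
Proof.
rewrite step_law_lebN; last exact: measurable_unit_ball.
by rewrite setIid divff// fine_lebN_ball.
Qed.

Let row (x : nat -> R) : V := \row_(i < N) x (nat_of_ord i).

Let ind (A : set V) (x : nat -> R) : \bar R := ((\1_A (row x) : R)%:E).

Let ind_nonneg_measurable (A : set VM) : measurable A -> nonneg_measurable (ind A).
Proof.
move=> mA; split=> [|x]; last by rewrite lee_fin.
apply/measurable_EFinP.
apply: (@measurableT_comp _ _ _ _ VM R (\1_A : VM -> R) setT (row : seqR R -> VM)).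
  exact: measurable_indic.
apply: measurable_borelV => i.
rewrite (_ : (fun x : seqR R => _) = (fun x : seqR R => x i)).
  exact: measurable_seq_coord.
by apply/funext => x; rewrite mxE.
Qed.

Let enorm_perm (f : V -> V) : (forall x, enorm (f x) = enorm x) ->
  f @^-1` B = B.
Proof. by move=> hf; apply/seteqP; split => x; rewrite /eball /= !subr0 hf. Qed.

Lemma enorm_reflect i (x : V) : enorm (opp_coord i x) = enorm x.
Proof.
congr Num.sqrt; apply: eq_bigr => j _; rewrite mxE.
by case: (j == i); rewrite ?sqrrN.
Qed.

Lemma step_law_reflect i (A : set VM) : measurable A ->
  measurable (opp_coord i @^-1` A : set VM) ->
  step_law (opp_coord i @^-1` A) = step_law A.
Proof.
move=> mA mrA; rewrite !step_law_lebN//; congr ((fine _ / _)%:E).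
have mAB : measurable ((A : set V) `&` B : set VM).
  by apply: measurableI => //; exact: measurable_unit_ball.
rewrite -{1}(enorm_perm (enorm_reflect i)) -preimage_setI.
rewrite /lebN -(@iint_flip _ N _ i _ (ind_nonneg_measurable mAB) (ltn_ord i)).
congr iint; apply/funext => x; rewrite /ind !indicE; congr ((_ : bool)%:R%:E).
have -> : row (flip i x) = opp_coord i (row x).
  by apply/rowP => j; rewrite !mxE /flip val_eqE.
by apply/idP/idP; rewrite !inE.
Qed.

Definition exchange (i j : 'I_N) (x : V) : V := \row_k x ord0 (tperm i j k).

Lemma enorm_exchange i j (x : V) : enorm (exchange i j x) = enorm x.
Proof.
congr Num.sqrt; rewrite [RHS](reindex_inj (@perm_inj _ (tperm i j))).
by apply: eq_bigr => k _; rewrite mxE.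
Qed.

Lemma step_law_exchange (i j : 'I_N) (A : set VM) : j = i.+1 :> nat -> measurable A ->
  measurable (exchange i j @^-1` A : set VM) ->
  step_law (exchange i j @^-1` A) = step_law A.
Proof.
move=> ji mA mrA; rewrite !step_law_lebN//; congr ((fine _ / _)%:E).
have mAB : measurable ((A : set V) `&` B : set VM).
  by apply: measurableI => //; exact: measurable_unit_ball.
rewrite -{1}(enorm_perm (enorm_exchange i j)) -preimage_setI.
have iN : (i.+1 < N)%N by rewrite -ji.
rewrite /lebN -(@iint_swap _ N _ i _ (ind_nonneg_measurable mAB) iN).
congr iint; apply/funext => x; rewrite /ind !indicE; congr ((_ : bool)%:R%:E).
have -> : row (swap_next i x) = exchange i j (row x).
  apply/rowP => k; rewrite !mxE /swap_next.
  case: tpermP => [->|->|/eqP ki /eqP kj].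
  - by rewrite eqxx ji.
  - by rewrite ji (gtn_eqF (ltnSn i)) eqxx.
  - by rewrite val_eqE (negbTE ki) -ji val_eqE (negbTE kj).
by apply/idP/idP; rewrite !inE.
Qed.

Lemma avg_invariant (s : V -> V) f :
  measurable_fun setT (s : VM -> VM) -> (forall x, enorm (s x) = enorm x) ->
  (forall A : set VM, measurable A -> step_law (s @^-1` A) = step_law A) ->
  bounded_borel f -> avg step_law (fun v => f (s v)) = avg step_law f.
Proof.
move=> ms es hs bf; have [mf [K fK]] := bf; congr fine.
rewrite -[RHS](@eq_measure_integral _ _ _ _ _ (pushforward step_law (s : VM -> VM))).
  rewrite [RHS]integral_pushforward; last 4 first.
  - exact: ms.
  - exact/measurable_EFinP.
  - rewrite (enorm_perm es).
    apply: (@bounded_borel_integrable _ _ _ step_law_ball (fun v => f (s v))).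
    split; first exact: (@measurableT_comp _ _ _ VM VM R f setT s).
    by exists K => v Bv; apply: fK; move: Bv; rewrite /eball /= !subr0 es.
  - exact: measurable_unit_ball.
  by rewrite (enorm_perm es).
by move=> A mA _; exact: hs.
Qed.

(** A vanishing second moment would put the ball, of mass 1, inside the union of the hyperplane v_i
    = 0 and a null set, and the hyperplane is itself null. *)
Lemma avg_coord_sqr_gt0 (i : 'I_N) : i.+1 = N ->
  0 < avg step_law (fun v => v ord0 i ^+ 2).
Proof.
move=> iN; have bi : bounded_borel (fun v : V => v ord0 i ^+ 2).
  under eq_fun do rewrite expr2.
  by apply: bounded_borelM; exact: bounded_borel_coord.
have mB := @measurable_unit_ball R N.
rewrite lt_def; apply/andP; split; last first.
  by apply: Rintegral_ge0 => v _; exact: sqr_ge0.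
apply/eqP => a0.
have intf := bounded_borel_integrable step_law_ball bi.
have : (\int[step_law]_(v in (B : set VM)) `| ((v : V) ord0 i ^+ 2)%:E | = 0)%E.
  rewrite -[RHS]/(0%:E) -a0 /avg /Rintegral fineK; last exact: integrable_fin_num.
  by apply: eq_integral => v _; rewrite gee0_abs// lee_fin sqr_ge0.
move=> /ae_eq_integral_abs; case=> //.
  apply/measurable_EFinP; apply: measurable_funTS; exact: (proj1 bi).
move=> M [mM M0 BM].
pose H : set VM := [set v : V | v ord0 i = 0].
have mH : measurable H.
  have := @measurable_coordV R N i measurableT _ (measurable_set1 (0 : R)).
  by rewrite setTI.
have H0 : step_law H = 0%E.
  rewrite step_law_lebN// (_ : lebN _ = 0%E) ?mul0r// /lebN -{1}iN.
  apply: iint_hyperplane => x xi; rewrite indicE memNset// => -[].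
  by rewrite /H /= mxE => /eqP; rewrite (negbTE xi).
have : (step_law (B : set VM) <= step_law (H `|` M))%E.
  apply: le_measure; rewrite ?inE//; first exact: measurableU.
  move=> v Bv; have [Hv|Hv] := pselect (H v); [by left|right].
  apply: BM => /= /(_ Bv) [] /eqP; rewrite sqrf_eq0 => /eqP.
  exact: Hv.
rewrite step_law_ball => /le_trans /(_ (measureU2 _ mH mM)) h.
have {h} : (1 <= step_law H + step_law M)%E by exact: h.
by rewrite H0 M0 adde0 lee_fin ler10.
Qed.

Lemma step_law_isotropic : exists c, isotropic step_law c.
Proof.
have Nm : (N.-1 < N)%N by rewrite prednK.
pose z := Ordinal Nm.
exists (avg step_law (fun v => v ord0 z ^+ 2)); split.
- exact: step_law_ball.
- by apply: avg_coord_sqr_gt0; rewrite /= prednK.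
- move=> i f bf.
  have ms : measurable_fun setT (opp_coord i : VM -> VM).
    apply: measurable_borelV => j.
    case: (eqVneq j i) => [->|ji].
      rewrite (_ : (fun x : VM => _) = (fun x : VM => - (x : V) ord0 i)); last first.
        by apply/funext => x; rewrite mxE eqxx.
      by apply: measurable_funN; exact: measurable_coordV.
    rewrite (_ : (fun x : VM => _) = (fun x : VM => (x : V) ord0 j)); last first.
      by apply/funext => x; rewrite mxE (negbTE ji).
    exact: measurable_coordV.
  apply: avg_invariant => //; first exact: enorm_reflect.
  move=> A mA; apply: step_law_reflect => //.
  by have := ms measurableT A mA; rewrite setTI.
- have step (i j : 'I_N) : j = i.+1 :> nat ->
      avg step_law (fun v => v ord0 i ^+ 2) = avg step_law (fun v => v ord0 j ^+ 2).
    move=> ji; have bi : bounded_borel (fun v : V => v ord0 j ^+ 2).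
      under eq_fun do rewrite expr2.
      by apply: bounded_borelM; exact: bounded_borel_coord.
    have ms : measurable_fun setT (exchange i j : VM -> VM).
      apply: measurable_borelV => k.
      rewrite (_ : (fun x : VM => _) = (fun x : VM => (x : V) ord0 (tperm i j k))); last first.
        by apply/funext => x; rewrite mxE.
      exact: measurable_coordV.
    rewrite -[RHS](@avg_invariant (exchange i j) _ ms)//.
    + by congr avg; apply/funext => v; rewrite mxE tpermR.
    + exact: enorm_exchange.
    + move=> A mA; apply: step_law_exchange => //.
      by have := ms measurableT A mA; rewrite setTI.
  (* Exchanges of neighbours carry the second moment of any coordinate, one index at a time, to that
     of the last. *)
  have all n (i j : 'I_N) : j = (i + n)%N :> nat ->
      avg step_law (fun v => v ord0 i ^+ 2) = avg step_law (fun v => v ord0 j ^+ 2).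
    elim: n i j => [|n IH] i j.
      by rewrite addn0 => ji; congr avg; apply/funext => v; congr (v _ _ ^+ 2); exact/val_inj.
    move=> ji; have kN : (i + n < N)%N by rewrite (leq_trans _ (ltn_ord j))// ji addnS ltnS leqW.
    rewrite (IH i (Ordinal kN))//; apply: step.
    by rewrite ji addnS.
  move=> i; apply: (all (N.-1 - i)%N) => /=.
  by rewrite subnKC// -ltnS prednK.
Qed.

End Law.

(** * The distance to the boundary *)

Section Geometry.
Context {R : realType} {N : nat}.
Local Notation V := 'rV[R]_N.
Implicit Types (D : set V) (x y z : V).

Lemma interior_openE D : open D -> interior D = D.
Proof. by move=> /interior_id. Qed.

Lemma bdry_notin D z : open D -> bdry D z -> ~ D z.
Proof. by move=> oD []; rewrite interior_openE. Qed.

Lemma closure_bdry D x : open D -> closure D x -> D x \/ bdry D x.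
Proof.
move=> oD cx; have [Dx|nDx] := pselect (D x); [by left|right].
by split => //; rewrite interior_openE.
Qed.

Lemma closed_bdry D : closed (bdry D).
Proof.
rewrite /bdry setDE; apply: closedI; first exact: closed_closure.
by apply: open_closedC; exact: open_interior.
Qed.

Lemma norm_closureP D x : closure D x <->
  forall e, 0 < e -> exists2 y, D y & `|y - x| < e.
Proof.
split=> [cx e e0|h A /nbhs_normV[e e0 eA]].
  have [|y [Dy ye]] := cx [set y | `|y - x| < e]; last by exists y.
  by apply/nbhs_normV; exists e.
by have [y Dy ye] := h e e0; exists y; split => //; exact: eA.
Qed.

Lemma enorm_dist_triangle x y z : enorm (x - z) <= enorm (x - y) + enorm (y - z).
Proof. by rewrite -{1}(subrK y x) -addrA enormD. Qed.

Lemma dist_bdry_ge0 D x : 0 <= dist_bdry D x.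
Proof.
rewrite /dist_bdry; have [[z Dz]|nD] := pselect (bdry D !=set0).
  apply: lb_le_inf; first by exists (enorm (x - z)), z.
  by move=> _ [y _ <-]; exact: enorm_ge0.
(* The infimum of the empty set is 0 by convention. *)
rewrite (_ : bdry D = set0) ?image_set0 ?inf0//.
by apply/seteqP; split => // z Dz; case: nD; exists z.
Qed.

Lemma dist_bdry_le D x z : bdry D z -> dist_bdry D x <= enorm (x - z).
Proof.
move=> Dz; apply: ge_inf; last by exists z.
by exists 0 => _ [y _ <-]; exact: enorm_ge0.
Qed.

Lemma dist_bdry_ge D x r : bdry D !=set0 ->
  (forall z, bdry D z -> r <= enorm (x - z)) -> r <= dist_bdry D x.
Proof.
move=> [z0 Dz0] h; apply: lb_le_inf; first by exists (enorm (x - z0)), z0.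
by move=> _ [z Dz <-]; exact: h.
Qed.

Lemma dist_bdry_lip D x y : dist_bdry D x - dist_bdry D y <= enorm (x - y).
Proof.
have [D0|nD0] := pselect (bdry D !=set0).
  rewrite lerBlDr addrC -lerBlDr; apply: dist_bdry_ge => // z Dz.
  by rewrite lerBlDl (le_trans (dist_bdry_le x Dz))// enorm_dist_triangle.
rewrite /dist_bdry (_ : bdry D = set0); last first.
  by apply/seteqP; split => // z Dz; case: nD0; exists z.
by rewrite !image_set0 subrr enorm_ge0.
Qed.

Lemma dist_bdry_continuous D : continuous (dist_bdry D).
Proof.
apply: (@lipschitz_continuousV _ _ _ N%:R) => x y.
by rewrite (le_trans (dist_bdry_lip _ _ _))// enorm_le_norm.
Qed.

(** The witness is the point at the first exit time s: it is outside D since D is open, and in the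
    closure since the segment is in D at all earlier times. *)
Lemma segment_bdry D x y : open D -> D x -> ~ D y ->
  exists2 z, bdry D z & enorm (x - z) <= enorm (x - y).
Proof.
move=> oD Dx nDy; pose p (t : R) : V := x + t *: (y - x).
have pd (t s : R) : p t - p s = (t - s) *: (y - x).
  by rewrite /p opprD addrACA subrr add0r -scalerBl.
pose E := [set t | 0 <= t <= 1 /\ ~ D (p t)].
have E1 : E 1 by split; [rewrite ler01 lexx|rewrite /p scale1r addrC subrK].
have infE : has_inf E by split; [exists 1|exists 0 => t [/andP[]]].
pose s := inf E.
have s0 : 0 <= s by apply: lb_le_inf; [exists 1|move=> t [/andP[]]].
have s1 : s <= 1 by apply: ge_inf => //; exists 0 => t [/andP[]].
have v0 : 0 < `|y - x| + 1 by rewrite ltr_wpDl.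
have close t e : 0 < e -> `|t - s| < e / (`|y - x| + 1) -> `|p t - p s| < e.
  move=> e0 ts; rewrite pd normrZ.
  apply: (@le_lt_trans _ _ (`|t - s| * (`|y - x| + 1))).
    by rewrite ler_wpM2l// lerDl.
  by rewrite -ltr_pdivlMr.
have nDs : ~ D (p s).
  move=> Ds; have /nbhs_normV[e e0 eD] : nbhs (p s) D by exact: open_nbhs_nbhs.
  have [t Et ts] := inf_adherent (divr_gt0 e0 v0) infE.
  have st : s <= t by apply: ge_inf => //; exists 0 => u [/andP[]].
  case: (Et) => _; apply; apply: eD; apply: close => //.
  by rewrite ger0_norm ?subr_ge0// ltrBlDl.
have sp : 0 < s.
  rewrite lt_neqAle s0 andbT; apply/eqP => se; apply: nDs.
  by rewrite -se /p scale0r addr0.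
exists (p s).
  split; last by rewrite interior_openE.
  apply/norm_closureP => e e0.
  pose t := Order.max 0 (s - e / 2 / (`|y - x| + 1)).
  have d0 : 0 < e / 2 / (`|y - x| + 1) by rewrite !divr_gt0.
  have ts : t < s by rewrite gt_max sp ltrBlDr ltrDl.
  have t0 : 0 <= t by rewrite le_max lexx.
  exists (p t).
    apply: contrapT => nDt; move: (ts); rewrite ltNge => /negP; apply.
    apply: ge_inf; first by exists 0 => u [/andP[]].
    by split=> //; rewrite t0 (le_trans (ltW ts)).
  apply: close => //; rewrite distrC ger0_norm ?subr_ge0 ?(ltW ts)//.
  apply: (@le_lt_trans _ _ (e / 2 / (`|y - x| + 1))).
    by rewrite lerBlDr addrC -lerBlDr le_max lexx orbT.
  by rewrite ltr_pM2r ?invr_gt0// ltr_pdivrMr// ltr_pMr// ltr1n.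
have -> : x - p s = s *: (x - y).
  by rewrite /p opprD addrA subrr add0r -scalerN opprB.
by rewrite enormZ ger0_norm// ler_piMl// enorm_ge0.
Qed.

Lemma eball_dist_sub D x y : open D -> D x -> enorm (y - x) < dist_bdry D x -> D y.
Proof.
move=> oD Dx yx; apply: contrapT => nDy.
have [z Dz xz] := segment_bdry oD Dx nDy.
move: yx; rewrite ltNge => /negP; apply.
by rewrite (le_trans (dist_bdry_le x Dz))// (le_trans xz)// enormB.
Qed.

Lemma bdry_neq0 D x : (0 < N)%N -> open D -> bounded_set D -> D x -> bdry D !=set0.
Proof.
move=> N0 oD [M [_ DM]] Dx; pose i := Ordinal N0.
have nDy : ~ D (x + (`|M| + `|x| + 2) *: evec i).
  move=> /(DM (`|M| + 1)); rewrite (le_lt_trans (ler_norm M)) ?ltrDl// => /(_ isT).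
  move/(le_trans (coord_le_norm _ i)); rewrite !mxE !eqxx mulr1.
  have := coord_le_norm x i; set a := x ord0 i; set m := `|M|; set b := `|x|.
  have m0 : 0 <= m by rewrite normr_ge0.
  rewrite !ler_norml => /andP[? ?] /andP[? ?]; lra.
by have [z Dz _] := segment_bdry oD Dx nDy; exists z.
Qed.

Lemma dist_bdry_gt0 D x : (0 < N)%N -> open D -> bounded_set D -> D x ->
  0 < dist_bdry D x.
Proof.
move=> N0 oD bD Dx.
have /nbhs_normV[e e0 eD] : nbhs x D by exact: open_nbhs_nbhs.
apply: (lt_le_trans e0); apply: dist_bdry_ge; first exact: bdry_neq0 Dx.
move=> z Dz; rewrite leNgt; apply/negP => xz; apply: (bdry_notin oD Dz); apply: eD.
by rewrite distrC (le_lt_trans (norm_le_enorm _)).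
Qed.

Lemma dist_bdry0 D x : bdry D x -> dist_bdry D x = 0.
Proof.
move=> Dx; apply/eqP; rewrite eq_le dist_bdry_ge0 andbT.
by rewrite (le_trans (dist_bdry_le x Dx))// subrr enorm0.
Qed.

Lemma dist_bdry_eq0 D x : bdry D !=set0 -> dist_bdry D x = 0 -> bdry D x.
Proof.
move=> D0 d0; apply: contrapT => nDx.
have /nbhs_normV[e e0 eD] : nbhs x (~` bdry D).
  by apply: open_nbhs_nbhs; split => //; exact/closed_openC/closed_bdry.
suff : e <= dist_bdry D x by rewrite d0 leNgt e0.
apply: dist_bdry_ge => // z Dz; rewrite leNgt; apply/negP => xz.
by apply: (eD z) => //; rewrite distrC (le_lt_trans (norm_le_enorm _)).
Qed.

Lemma bounded_closure D : bounded_set D ->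
  exists2 r, 0 < r & forall x, closure D x -> `|x| <= r.
Proof.
move=> [M [_ DM]]; exists (`|M| + 2); first by rewrite ltr_wpDl.
move=> x /norm_closureP /(_ 1 ltr01)[y Dy yx].
have yM : `|y| <= `|M| + 1.
  by apply: (DM (`|M| + 1)) => //; rewrite (le_lt_trans (ler_norm M))// ltrDl.
rewrite -(subrK y x) (le_trans (ler_normD _ _))// distrC; lra.
Qed.

Lemma compact_bdry D : bounded_set D -> compact (bdry D).
Proof.
move=> /bounded_closure[r r0 hr]; apply: bounded_closed_compact; last exact: closed_bdry.
exists r; split; first exact: num_real.
by move=> M rM x [cx _] /=; rewrite (le_trans (hr x cx))// ltW.
Qed.

Lemma compact_closure D : bounded_set D -> compact (closure D).
Proof.
move=> /bounded_closure[r r0 hr]; apply: bounded_closed_compact; last exact: closed_closure.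
exists r; split; first exact: num_real.
by move=> M rM x cx /=; rewrite (le_trans (hr x cx))// ltW.
Qed.

End Geometry.

(** * Integrals of functions that agree off a null set *)

Section NullSets.
Local Open Scope ereal_scope.
Context d (T : measurableType d) (R : realType) (mu : {measure set T -> \bar R}).
Import HBNNSimple.

(** Neither function is assumed measurable, so the argument is made on the simple functions below f:
    set to 0 on E, each keeps its integral and lies below g. It is applied to F composed with
    [Xlim]. *)
Lemma nnintegral_le_off_null (f g : T -> \bar R) (E : set T) :
  measurable E -> mu E = 0 -> (forall t, 0 <= g t) ->
  (forall t, ~ E t -> f t = g t) ->
  ereal_sup [set sintegral mu h | h in [set h : {nnsfun T >-> R} | forall x, (h x)%:E <= f x]] <=
  ereal_sup [set sintegral mu h | h in [set h : {nnsfun T >-> R} | forall x, (h x)%:E <= g x]].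
Proof.
move=> mE E0 g0 fg; apply: ge_ereal_sup => _ [h hf <-].
have mCE : measurable (~` E) by exact: measurableC.
apply: ereal_sup_ubound; exists (proj_nnsfun h mCE).
  move=> t /=; rewrite mindicE; have [tE|tE] := pselect (E t).
    by rewrite memNset ?mulr0//; exact.
  by rewrite mem_set// mulr1 -fg.
have eqt : {ae mu, forall t, setT t -> (proj_nnsfun h mCE t)%:E = (h t)%:E}.
  exists E; split=> // t /= nt; apply: contrapT => tE; apply: nt => _.
  by rewrite mindicE mem_set// mulr1.
have : \int[mu]_t (proj_nnsfun h mCE t)%:E = \int[mu]_t (h t)%:E.
  apply: ge0_ae_eq_integral => //.
  - exact/measurable_EFinP.
  - exact/measurable_EFinP.
  - by move=> t _; rewrite lee_fin.
  - by move=> t _; rewrite lee_fin.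
by rewrite !integralT_nnsfun.
Qed.

Lemma integral_off_null (f g : T -> \bar R) (E : set T) :
  measurable E -> mu E = 0 -> (forall t, ~ E t -> f t = g t) ->
  \int[mu]_t f t = \int[mu]_t g t.
Proof.
move=> mE E0 fg; rewrite /integral !patch_setT.
congr (_ - _); apply/eqP; rewrite eq_le; apply/andP; split;
  apply: (@nnintegral_le_off_null _ _ E) => // t tE.
- by rewrite !funeposE fg.
- by rewrite !funeposE fg.
- by rewrite !funenegE fg.
- by rewrite !funenegE fg.
Qed.

End NullSets.

(** * The walk *)

Section WalkMeasurable.
Context {R : realType} {N : nat}.
Local Notation V := 'rV[R]_N.
Local Notation VM := (borelV R N).

Lemma measurable_dist_bdry D : measurable_fun setT (dist_bdry D : VM -> R).
Proof. by apply: measurable_continuousV; exact: dist_bdry_continuous. Qed.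

Lemma measurable_coord_comp d (T : measurableType d) (f : T -> VM) i :
  measurable_fun setT f -> measurable_fun setT (fun t => (f t : V) ord0 i).
Proof.
move=> mf; apply: (@measurableT_comp _ _ _ T VM R (fun x : VM => (x : V) ord0 i)) => //.
exact: measurable_coordV.
Qed.

(** Only the steps before n are assumed measurable, for an arbitrary structure on T, so that the
    lemma also gives measurability with respect to the past. *)
Lemma measurable_walk d (T : measurableType d) (w : nat -> T -> V) D eps x n :
  (forall k, (k < n)%N -> measurable_fun setT (w k : T -> VM)) ->
  measurable_fun setT (walk w D eps x n : T -> VM).
Proof.
elim: n => [|n IH] mw /=; first exact: measurable_cst.
have mX : measurable_fun setT (walk w D eps x n : T -> VM).
  by apply: IH => k kn; apply: mw; exact: ltnW.
apply: measurable_borelV => i.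
rewrite (_ : (fun t => _) = (fun t => walk w D eps x n t ord0 i +
  Num.min eps (dist_bdry D (walk w D eps x n t)) * w n t ord0 i)); last first.
  by apply/funext => t; rewrite !mxE.
apply: measurable_funD; first exact: measurable_coord_comp.
apply: measurable_funM; last by apply: measurable_coord_comp; exact: mw.
apply: measurable_minr; first exact: measurable_cst.
apply: (@measurableT_comp _ _ _ T VM R (dist_bdry D)) => //.
exact: measurable_dist_bdry.
Qed.

Lemma cvg_coordP (u : nat -> V) (l : V) :
  u n @[n --> \oo] --> l <-> forall i, u n ord0 i @[n --> \oo] --> l ord0 i.
Proof.
split=> [ul i|h].
  by apply: (@cvg_comp _ _ _ u (fun x : V => x ord0 i)); [exact: ul|exact: coord_continuous].
apply/cvgrPdist_lt => e e0.
have : forall i, \forall n \near \oo, `|l ord0 i - u n ord0 i| < e.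
  by move=> i; have /cvgrPdist_lt := h i; exact.
move=> /filter_forall; apply: filterS => n hn.
by apply: norm_lt_coord => // i; rewrite !mxE.
Qed.

(* Convergence is characterised by the Cauchy property, hence measurable. *)
Lemma measurable_limV d (T : measurableType d) (X : nat -> T -> V) :
  (forall n, measurable_fun setT (X n : T -> VM)) ->
  measurable_fun setT (fun t => lim (X n t @[n --> \oo]) : VM).
Proof.
move=> mX.
pose C := \bigcap_(j : nat) \bigcup_(m : nat) \bigcap_(k : nat)
   [set t | (m <= k)%N -> `|X m t - X k t| <= j.+1%:R^-1].
have mC : measurable C.
  apply: bigcapT_measurable => j; apply: bigcupT_measurable => m.
  apply: bigcapT_measurable => k; have [mk|mk] := leqP m k; last first.
    rewrite (_ : [set t | _] = setT)//; by apply/seteqP; split.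
  rewrite (_ : [set t | _] = \bigcap_(i in [set: 'I_N])
      [set t | `|X m t ord0 i - X k t ord0 i| <= j.+1%:R^-1]).
    apply: fin_bigcap_measurable => // i _.
    have mg : measurable_fun setT (fun t => `|X m t ord0 i - X k t ord0 i|).
      by apply: measurableT_comp => //; apply: measurable_funB; exact: measurable_coord_comp.
    have := mg measurableT _ (measurable_itv `]-oo, (j.+1%:R^-1 : R)]).
    by rewrite setTI set_itvE.
  apply/seteqP; split => t /= h.
    move=> i _; apply: le_trans (h isT); have := coord_le_norm (X m t - X k t) i.
    by rewrite !mxE.
  by move=> _; apply: norm_le_coord => // i; have := h i I; rewrite !mxE.
have CP t : C t <-> cvg (X n t @[n --> \oo]).
  split=> [Ct|ct].
    apply/cauchy_cvgP/cauchy_exP => e e0.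
    have [j _ je] := @near_infty_natSinv_lt R (PosNum e0).
    have {}je : j.+1%:R^-1 < e by apply: je => /=.
    have [m _ hm] := Ct j I; exists (X m t); exists m => // k mk.
    rewrite -ball_normE /=; apply: le_lt_trans je; exact: hm.
  move=> j _; have /cauchy_cvgP/cauchy_ballP := ct.
  have j0 : 0 < j.+1%:R^-1 :> R by rewrite invr_gt0.
  move=> /(_ _ j0) [[A1 A2] /= [[m1 _ h1] [m2 _ h2]] hA].
  exists (maxn m1 m2) => // k _ mk.
  have := hA (X (maxn m1 m2) t, X k t); rewrite -ball_normE /= => h; apply/ltW/h.
  by split; [apply: h1; rewrite /= leq_maxl|apply: h2; rewrite /= (leq_trans _ mk)// leq_maxr].
apply: measurable_borelV => i.
pose l t := lim (X n t @[n --> \oo]).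
pose h n t := if `[< C t >] then X n t ord0 i else (point : V) ord0 i.
apply: (@measurable_fun_cvg _ _ _ setT h) => //.
  move=> n; rewrite /h; apply: measurable_fun_ifT.
  - apply: (@measurable_fun_bool _ _ _ _ true).
    by rewrite setTI (_ : _ @^-1` _ = C)//; apply/seteqP; split => t /= /asboolP.
  - exact: measurable_coord_comp.
  - exact: measurable_cst.
move=> t _; rewrite /h; case: asboolP => [/CP ct|nct].
  by have /cvg_coordP := ct; exact.
(* A divergent sequence has the default limit [point], the value given to [h] off [C]. *)
rewrite (_ : lim _ = point); first exact: cvg_cst.
by apply: dvgP => /CP.
Qed.

Lemma measurable_Xlim d (T : measurableType d) (w : nat -> T -> V) D eps x :
  (forall k, measurable_fun setT (w k : T -> VM)) ->
  measurable_fun setT (Xlim w D eps x : T -> VM).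
Proof. by move=> mw; apply: measurable_limV => n; exact: measurable_walk. Qed.

End WalkMeasurable.

(** * Independence of a step from the past *)

Section Independence.
Context {R : realType} {N : nat}.
Local Notation V := 'rV[R]_N.
Local Notation VM := (borelV R N).
Local Notation B := (eball (0 : V) 1).
Context {d : measure_display} {T : measurableType d}.
Variables (P : probability T R) (w : nat -> T -> V).
Hypothesis iid : iid_uniform_ball P w.
Let mu := step_law iid.

(** These rectangles in the first n steps are stable under intersection, and on them independence
    from step n is the hypothesis itself. *)
Definition past_cylinders n : set (set T) :=
  [set C | exists A : nat -> set V, (forall k, borelN (A k)) /\
     C = \bigcap_(k in [set` iota 0 n]) (w k @^-1` A k)].

Definition past n := g_sigma_algebraType (past_cylinders n).
HB.instance Definition _ n := Measurable.on (past n).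

Lemma borelNT : borelN (setT : set V).
Proof. exact: (@measurableT _ VM). Qed.

Lemma measurable_past_step k n : (k < n)%N ->
  measurable_fun setT (w k : past n -> VM).
Proof.
move=> kn _ A mA; rewrite setTI; apply: sub_sigma_algebra.
exists (fun j => if j == k then A else setT); split.
  by move=> j; case: ifP => _ //; exact: borelNT.
apply/seteqP; split => t.
  by move=> wA j _ /=; case: eqP => // ->.
by move=> /(_ k); rewrite /= mem_iota eqxx; exact.
Qed.

Lemma past_cylinders_measurable n C : past_cylinders n C -> measurable C.
Proof.
move=> [A [mA ->]]; apply: fin_bigcap_measurable => // k _.
by have := @measurable_step _ _ _ _ P w iid k measurableT (A k) (mA k); rewrite setTI.
Qed.

Lemma past_sub n (S : set T) : measurable (S : set (past n)) -> measurable S.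
Proof.
apply: smallest_sub; first exact: sigma_algebra_measurable.
by move=> C; exact: past_cylinders_measurable.
Qed.

Lemma measurable_fun_past n d' (Y : measurableType d') (H : T -> Y) :
  measurable_fun (setT : set (past n)) H -> measurable_fun (setT : set T) H.
Proof. by move=> mH _ A mA; rewrite setTI; apply: (@past_sub n); have := mH measurableT A mA; rewrite setTI. Qed.

(** As functions of S, both sides are finite measures that agree on the rectangles of the past;
    uniqueness of measures extends this to the generated sigma-algebra. *)
Lemma past_independent n (S : set T) (A : set VM) :
  measurable (S : set (past n)) -> measurable A ->
  P (S `&` w n @^-1` A) = (P S * mu A)%E.
Proof.
move=> mS mA.
have mwA : measurable (w n @^-1` A).
  by have := @measurable_step _ _ _ _ P w iid n measurableT A mA; rewrite setTI.
have r0 : 0 <= fine (mu A) by apply: fine_ge0; exact: measure_ge0.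
have muA : (fine (mu A))%:E = mu A by rewrite fineK// fin_num_measure.
suff E : mrestr P mwA S = mscale (NngNum r0) P S.
  by move: E; rewrite /mrestr /mscale /= => ->; rewrite muA muleC.
apply: (@g_sigma_algebra_measure_unique _ _ T (past_cylinders n)
  (@past_cylinders_measurable n) (fun=> setT)) => //.
- move=> _; exists (fun=> setT); split; first by move=> k; exact: borelNT.
  by apply/seteqP; split.
- by apply/seteqP; split => // t _; exists 0%N.
- move=> _ _ [A1 [mA1 ->]] [A2 [mA2 ->]]; exists (fun k => A1 k `&` A2 k); split.
    by move=> k; exact: (@measurableI _ VM _ _ (mA1 k) (mA2 k)).
  apply/seteqP; split => t.
    by move=> [h1 h2] k kn; split; [exact: h1|exact: h2].
  by move=> h; split => k /h[].
- move=> C [A1 [mA1 CE]].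
  rewrite -[LHS]/(P (C `&` w n @^-1` A)) -[RHS]/((fine (mu A))%:E * P C)%E muA {}CE.
  pose A' k := if k == n then A : set V else A1 k.
  have mA' k : borelN (A' k) by rewrite /A'; case: ifP.
  have [_ _ h3] := iid.
  have := h3 (iota 0 n.+1) A' (iota_uniq _ _) mA'.
  have := h3 (iota 0 n) A1 (iota_uniq _ _) mA1.
  rewrite -(addn1 n) iotaD big_cat /= big_seq1 add0n => E1.
  have -> : (\big[*%E/1%E]_(k <- iota 0 n) P (w k @^-1` A' k))%E =
      (\big[*%E/1%E]_(k <- iota 0 n) P (w k @^-1` A1 k))%E.
    rewrite big_seq [RHS]big_seq; apply: eq_bigr => k.
    by rewrite mem_iota add0n /A' => /= kn; rewrite (ltn_eqF kn).
  rewrite -E1 {2}/A' eqxx (step_lawE iid)// muleC => <-.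
  congr (P _); apply/seteqP; split => t.
    move=> [h wA] k /=; rewrite mem_cat mem_seq1 /A'.
    by case: eqP => [->//|_]; rewrite orbF => /h.
  move=> h; split.
    move=> k /= kn; have := h k; rewrite /= mem_cat kn /A' => /(_ isT).
    by move: kn; rewrite mem_iota add0n /= => kn; rewrite (ltn_eqF kn).
  by have := h n; rewrite /= mem_cat mem_seq1 /A' !eqxx orbT => /(_ isT).
- move=> k; rewrite -[ltLHS]/(P (setT `&` w n @^-1` A)) setTI; apply: (le_lt_trans (probability_le1 P mwA)).
  by rewrite ltry.
Qed.

Hypothesis wB : forall k t, B (w k t).

Lemma bounded_measurable_integrable d' (Y : measurableType d') (Q : probability Y R)
    (f : Y -> R) K : measurable_fun setT f -> (forall y, `|f y| <= K) ->
  Q.-integrable setT (EFin \o f).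
Proof.
move=> mf fK; apply: measurable_bounded_integrable => //.
- by rewrite (le_lt_trans (probability_le1 Q measurableT))// ltry.
- exists K; split; first exact: num_real.
  by move=> M KM y _ /=; rewrite (le_trans (fK y))// ltW.
Qed.

Lemma measurable_avg d' (Y : measurableType d') (phi : Y -> V -> R) K :
  measurable_fun setT (fun yv : Y * VM => phi yv.1 yv.2) ->
  (forall y v, B v -> `|phi y v| <= K) ->
  measurable_fun setT (fun y => avg mu (phi y)).
Proof.
move=> mphi phiK.
have mB := @measurable_unit_ball R N.
(* The shift by K and the cut-off to the ball make the integrand nonnegative on the whole product,
   as Tonelli's theorem requires. *)
pose psi (yv : Y * VM) : R := (phi yv.1 yv.2 + K) * \1_(B : set VM) yv.2.
have mpsi : measurable_fun setT psi.
  apply: measurable_funM; first exact: measurable_funD.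
  apply: (@measurableT_comp _ _ _ _ VM R (\1_B : VM -> R) setT snd).
    exact: measurable_indic.
  exact: measurable_snd.
have psi0 yv : 0 <= psi yv.
  rewrite /psi indicE; case: (boolP (yv.2 \in _)) => [|_]; rewrite ?mulr0//.
  rewrite inE => /(phiK yv.1); rewrite mulr1 ler_norml => /andP[? _]; lra.
have mF : measurable_fun setT (fun y => fine (\int[mu]_v (psi (y, v))%:E)%E).
  apply: measurableT_comp => //.
  apply: (@measurable_fun_fubini_tonelli_F _ _ Y VM R mu (fun yv => (psi yv)%:E)).
    exact/measurable_EFinP.
  by move=> yv; rewrite lee_fin.
have -> : (fun y => avg mu (phi y)) =
    (fun y => fine (\int[mu]_v (psi (y, v))%:E)%E - K).
  apply/funext => y.
  have bphi : bounded_borel (phi y).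
    split; last by exists K => v; exact: phiK.
    exact: (@measurable_fun_pair2 _ _ _ _ _ _ (fun yv : Y * VM => phi yv.1 yv.2) y).
  have -> : fine (\int[mu]_v (psi (y, v))%:E)%E = avg mu (fun v => phi y v + K).
    rewrite /avg Rintegral_mkcond; congr fine; apply: eq_integral => v _.
    by rewrite /psi /= patchE indicE; case: (v \in _); rewrite ?mulr1 ?mulr0.
  have muB := step_law_ball iid.
  rewrite avgD//; last exact: bounded_borel_cst.
  by rewrite avg_cst// addrK.
by apply: measurable_funB => //.
Qed.

(** This replaces conditional expectation: H depends on the past only, so the joint law of (H, w n)
    is a product, and Fubini's theorem integrates the step out first. *)
Lemma expectation_step n d' (Y : measurableType d') (H : T -> Y) (phi : Y -> V -> R) K :
  measurable_fun (setT : set (past n)) H ->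
  measurable_fun setT (fun yv : Y * VM => phi yv.1 yv.2) ->
  (forall t v, B v -> `|phi (H t) v| <= K) ->
  \int[P]_t phi (H t) (w n t) = \int[P]_t avg mu (phi (H t)).
Proof.
move=> mpH mphi phiK.
have mB := @measurable_unit_ball R N.
have K0 : 0 <= K by have := phiK point _ (wB 0%N point); exact: le_trans.
(* [phi] is known to be bounded only at values of H and on the unit ball. Clamping to [-K, K] and
   cutting off give a function bounded everywhere with the same values at (H, w n). *)
pose psi (yv : Y * VM) : R :=
  Order.max (- K) (Order.min K (phi yv.1 yv.2)) * \1_(B : set VM) yv.2.
have mpsi : measurable_fun setT psi.
  apply: measurable_funM.
    apply: measurable_maxr; first exact: measurable_cst.
    by apply: measurable_minr => //; exact: measurable_cst.
  apply: (@measurableT_comp _ _ _ _ VM R (\1_B : VM -> R) setT snd).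
    exact: measurable_indic.
  exact: measurable_snd.
have psiK yv : `|psi yv| <= K.
  rewrite /psi indicE; case: (yv.2 \in _); rewrite ?mulr0 ?normr0// mulr1.
  by rewrite ler_norml le_max lexx /= ge_max ge_min lexx andbT lerNl (le_trans _ K0)// oppr_le0.
have psiE t v : B v -> psi (H t, v) = phi (H t) v.
  move=> Bv; rewrite /psi indicE mem_set// mulr1 /=.
  have := phiK t v Bv; rewrite ler_norml => /andP[h1 h2].
  by rewrite min_r// max_r.
have psi0 y v : ~ B v -> psi (y, v) = 0.
  by move=> Bv; rewrite /psi indicE memNset// mulr0.
have mH : measurable_fun setT H by exact: measurable_fun_past mpH.
have mw : measurable_fun setT (w n : T -> VM) by exact: (measurable_step iid).
have mHw : measurable_fun setT (fun t => (H t, w n t : VM)) by exact: measurable_fun_pair.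
pose HH : {mfun T >-> Y} := mfun_Sub (mem_set mH).
pose HW : {mfun T >-> (Y * VM)%type} := mfun_Sub (mem_set mHw).
pose mH' : probability Y R := distribution P HH.
pose mHW : probability (Y * VM)%type R := distribution P HW.
have unique X : measurable X -> (mH' \x mu)%E X = mHW X.
  apply: product_measure_unique => A1 A2 mA1 mA2.
  have := @past_independent n (H @^-1` A1) A2 _ mA2; rewrite -[P (H @^-1` A1)]/(mH' A1) => <-.
    by [].
  by have := mpH measurableT A1 mA1; rewrite setTI.
pose f (yv : Y * VM) : \bar R := (psi yv)%:E.
have mf : measurable_fun setT f by exact/measurable_EFinP.
have intf : (mH' \x mu)%E.-integrable setT f.
  apply: (@bounded_measurable_integrable _ _ (mH' \x mu)%E psi K) => //.
congr fine.
transitivity (\int[P]_t (f \o HW) t)%E.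
  by apply: eq_integral => t _; rewrite /f /= psiE.
have E1 : (\int[mHW]_yv f yv = \int[P]_(t in HW @^-1` setT) (f \o HW) t)%E.
  apply: (@integral_pushforward _ _ _ _ _ _ mHw P setT f mf) => //.
  apply: (@bounded_measurable_integrable _ _ P (psi \o HW) K) => //.
    exact: measurableT_comp.
  by move=> t; exact: psiK.
have E2 : (\int[mHW]_yv f yv = \int[mH' \x mu]_yv f yv)%E.
  by apply: eq_measure_integral => A mA _; exact/esym/unique.
have bphi t : bounded_borel (phi (H t)).
  split; last by exists K => v; exact: phiK.
  exact: (@measurable_fun_pair2 _ _ _ _ _ _ (fun yv : Y * VM => phi yv.1 yv.2) (H t)).
have FE t : fubini_F mu f (H t) = (avg mu (phi (H t)))%:E.
  rewrite /avg /Rintegral fineK; last first.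
    apply: integrable_fin_num => //.
    exact: (bounded_borel_integrable (step_law_ball iid)).
  rewrite /fubini_F [RHS]integral_mkcond; apply: eq_integral => v _.
  rewrite patchE /f; case: ifPn => [|]; rewrite ?inE ?notin_setE => Bv.
    by rewrite psiE.
  by rewrite psi0.
have mFH : measurable_fun setT (fun t => avg mu (phi (H t))).
  rewrite (_ : (fun t => _) = fine \o (fubini_F mu f \o H)).
    apply: measurableT_comp => //; apply: measurableT_comp => //.
    exact: (measurable_fubini_F intf).
  by apply/funext => t /=; rewrite FE.
have E3 : (\int[mH']_y fubini_F mu f y = \int[P]_(t in HH @^-1` setT) (fubini_F mu f \o HH) t)%E.
  apply: (@integral_pushforward _ _ _ _ _ _ mH P setT (fubini_F mu f)) => //.
    exact: (measurable_fubini_F intf).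
  apply: (@eq_integrable _ _ _ _ _ measurableT (EFin \o (fun t => avg mu (phi (H t))))).
    by move=> t _ /=; rewrite FE.
  apply: (@bounded_measurable_integrable _ _ P _ K) => //.
  by move=> t; apply: (norm_avg_le (step_law_ball iid) (bphi t)) => v; exact: phiK.
rewrite -[LHS]/(\int[P]_(t in HW @^-1` setT) (f \o HW) t)%E -E1 E2.
rewrite -integral12_prod_meas1// E3.
by apply: eq_integral => t _; exact: FE.
Qed.

End Independence.

Lemma bounded_markov {R : realType} {d} {T : measurableType d} (P : probability T R)
    (f : T -> R) K l : measurable_fun setT f -> (forall t, 0 <= f t <= K) -> 0 < l ->
  measurable [set t | l <= f t] /\ (P [set t | (l <= f t)%R] <= ((\int[P]_t f t) / l)%:E)%E.
Proof.
move=> mf fK l0.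
have mE : measurable [set t | l <= f t].
  have := mf measurableT _ (measurable_itv `[l, +oo[).
  by rewrite setTI set_itvE.
have nf t : `|f t| <= K by have /andP[h0 hK] := fK t; rewrite ger0_norm.
have K0 : 0 <= K by have /andP[h0 hK] := fK point; exact: le_trans hK.
split=> //; set E := [set t | _] in mE *.
rewrite -[leLHS](@fineK _ (P E)) ?fin_num_measure// lee_fin ler_pdivlMr// mulrC.
have -> : fine (P E) = \int[P]_t \1_E t.
  by rewrite /Rintegral integral_indic// setIT.
have i1 : P.-integrable setT (EFin \o (\1_E : T -> R)).
  apply: (@bounded_measurable_integrable _ _ _ P _ 1) => //.
  by move=> t; rewrite indicE; case: (_ \in _); rewrite ?normr1 ?normr0.
rewrite -RintegralZl//; apply: le_Rintegral => //.
- apply: (@bounded_measurable_integrable _ _ _ P _ l).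
    by apply: measurable_funM => //; exact: measurable_cst.
  move=> t; rewrite indicE; case: (_ \in _); rewrite ?mulr1 ?mulr0 ?normr0 ?(ltW l0)//.
  by rewrite gtr0_norm.
- exact: (@bounded_measurable_integrable _ _ _ P _ K).
- move=> t _; rewrite indicE; case: (boolP (t \in E)) => [|_].
    by rewrite inE /E /= mulr1.
  by rewrite mulr0; have /andP[] := fK t.
Qed.

Lemma Rintegral_probability_cst {R : realType} {d} {T : measurableType d} (P : probability T R) (k : R) :
  \int[P]_t k = k.
Proof.
rewrite Rintegral_cst//; have h : fine (P setT) = 1 by rewrite probability_setT.
by rewrite [X in _ * X]h mulr1.
Qed.

(** * Almost sure convergence of the walk to the boundary *)

Section WalkConverges.
Context {R : realType} {N : nat}.
Local Notation V := 'rV[R]_N.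
Local Notation VM := (borelV R N).
Local Notation B := (eball (0 : V) 1).
Context {d : measure_display} {T : measurableType d}.
Variables (P : probability T R) (w : nat -> T -> V).
Hypothesis iid : iid_uniform_ball P w.
Hypothesis wB : forall k t, B (w k t).
Hypothesis N0 : (0 < N)%N.
Let mu := step_law iid.
Variables (D : set V) (eps : R).
Hypotheses (oD : open D) (bD : bounded_set D) (eps0 : 0 < eps).

Definition step_radius (y : V) := Num.min eps (dist_bdry D y).

Lemma radius_ge0 y : 0 <= step_radius y.
Proof. by rewrite le_min (ltW eps0) dist_bdry_ge0. Qed.

Lemma radius_le y : step_radius y <= eps. Proof. by rewrite ge_min lexx. Qed.

Lemma step_in y v : D y -> B v -> D (y + step_radius y *: v).
Proof.
move=> Dy; rewrite /eball /= subr0 => v1; apply: (eball_dist_sub oD Dy).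
rewrite addrAC subrr add0r enormZ (ger0_norm (radius_ge0 y)).
have dy := dist_bdry_gt0 N0 oD bD Dy.
apply: (@le_lt_trans _ _ (dist_bdry D y * enorm v)).
  by rewrite ler_wpM2r ?enorm_ge0// ge_min lexx orbT.
by rewrite gtr_pMr.
Qed.

Lemma measurable_radius : measurable_fun setT (step_radius : VM -> R).
Proof.
by apply: measurable_minr; [exact: measurable_cst|exact: measurable_dist_bdry].
Qed.

Lemma measurable_sqn : measurable_fun setT (sqn : VM -> R).
Proof.
apply: measurable_sum => i; apply: measurable_funX; exact: measurable_coordV.
Qed.

Lemma measurable_shift d' (YM : measurableType d') (z : YM -> V) (s : YM -> R) :
  measurable_fun setT (z : YM -> VM) -> measurable_fun setT s ->
  measurable_fun setT (fun yv : YM * VM => z yv.1 + s yv.1 *: (yv.2 : V) : VM).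
Proof.
move=> mz ms; apply: measurable_borelV => i.
rewrite (_ : (fun yv => _) = (fun yv : YM * VM => z yv.1 ord0 i + s yv.1 * (yv.2 : V) ord0 i)); last first.
  by apply/funext => yv; rewrite !mxE.
apply: measurable_funD.
  apply: (@measurable_coord_comp _ _ _ _ (fun yv : YM * VM => z yv.1 : VM)).
  exact: (measurableT_comp mz measurable_fst).
apply: measurable_funM; first exact: (measurableT_comp ms measurable_fst).
apply: (@measurable_coord_comp _ _ _ _ (fun yv : YM * VM => yv.2)).
exact: measurable_snd.
Qed.

Variable x : V.
Hypothesis Dx : D x.
Let X n t := walk w D eps x n t.

Lemma walkS n t : X n.+1 t = X n t + step_radius (X n t) *: w n t.
Proof. by []. Qed.

Lemma walk_in n t : D (X n t).
Proof. by elim: n => // n IH; rewrite walkS; exact: step_in. Qed.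

Lemma walk_past n k : (k <= n)%N -> measurable_fun (setT : set (past w n)) (X k : _ -> VM).
Proof.
move=> kn; apply: measurable_walk => j jk; apply: measurable_past_step.
exact: leq_trans kn.
Qed.

Lemma walk_measurable k : measurable_fun setT (X k : T -> VM).
Proof. by apply: measurable_walk => j _; exact: (measurable_step iid). Qed.

(** Up to the factor N c, this is the variance of the n-th increment. *)
Let a n := \int[P]_t step_radius (X n t) ^+ 2.

Let radius_sqr_le t n : 0 <= step_radius (X n t) ^+ 2 <= eps ^+ 2.
Proof.
by rewrite sqr_ge0 lerXn2r ?nnegrE ?(ltW eps0) ?radius_ge0 ?radius_le.
Qed.

Let mradius n : measurable_fun setT (fun t => step_radius (X n t) ^+ 2).
Proof.
apply: measurable_funX; apply: (@measurableT_comp _ _ _ T VM R step_radius) => //.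
  exact: measurable_radius.
exact: walk_measurable.
Qed.

Let a_ge0 n : 0 <= a n.
Proof. by apply: Rintegral_ge0 => t _; exact: sqr_ge0. Qed.

Let integrable_radius_sqr n : P.-integrable setT (EFin \o (fun t => step_radius (X n t) ^+ 2)).
Proof.
apply: (@bounded_measurable_integrable _ _ _ P _ (eps ^+ 2)) => // t.
by have /andP[h1 h2] := radius_sqr_le t n; rewrite ger0_norm.
Qed.

Section StoppedIncrement.
Variables (c : R) (iso : isotropic mu c) (m : nat) (lam : R).

(* Kolmogorov's maximal inequality: the increments after time m are centred, so
   the second moment of the stopped increment is at most the sum of the variances
   of the steps, and Markov's inequality applies to it. *)
Fixpoint stopped j t : V :=
  if j is j'.+1 then
    stopped j' t + (if sqn (stopped j' t) < lam then step_radius (X (m + j')%N t) else 0) *: w (m + j')%N t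
  else 0.

Let gate (z y : V) : R := if sqn z < lam then step_radius y else 0.

Let gate_ge0 z y : 0 <= gate z y.
Proof. by rewrite /gate; case: ifP => // _; exact: radius_ge0. Qed.

Let gate_le z y : gate z y <= step_radius y.
Proof. by rewrite /gate; case: ifP => // _; exact: radius_ge0. Qed.

Let measurable_gate : measurable_fun setT (fun zy : VM * VM => gate zy.1 zy.2).
Proof.
apply: measurable_fun_ifT => //.
- apply: measurable_fun_ltr => //; apply: (@measurableT_comp _ _ _ _ VM R sqn setT fst).
    exact: measurable_sqn.
  exact: measurable_fst.
- apply: (@measurableT_comp _ _ _ _ VM R step_radius setT snd).
    exact: measurable_radius.
  exact: measurable_snd.
Qed.

Lemma enorm_stopped j t : enorm (stopped j t) <= j%:R * eps.
Proof.
elim: j => [|j IH] /=; first by rewrite mul0r enorm0.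
rewrite mulrSr mulrDl mul1r (le_trans (enormD _ _))// lerD// enormZ.
rewrite ger0_norm; last exact: gate_ge0.
rewrite -[leRHS]mulr1 ler_pM ?enorm_ge0//.
- exact: gate_ge0.
- exact: le_trans (gate_le _ _) (radius_le _).
- by have := wB (m + j)%N t; rewrite /eball /= subr0 => /ltW.
Qed.

Lemma stopped_past j : measurable_fun (setT : set (past w (m + j)%N)) (stopped j : _ -> VM).
Proof.
(* The sigma-algebra must stay that of the past of m + j while the induction runs over k. *)
suff h k : (k <= j)%N -> measurable_fun (setT : set (past w (m + j)%N)) (stopped k : _ -> VM).
  exact: h.
elim: k => [|k IH] kj /=; first exact: measurable_cst.
have mS := IH (ltnW kj).
have mX : measurable_fun (setT : set (past w (m + j)%N)) (X (m + k)%N : _ -> VM).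
  by apply: walk_past; rewrite leq_add2l ltnW.
have mw : measurable_fun (setT : set (past w (m + j)%N)) (w (m + k)%N : _ -> VM).
  by apply: measurable_past_step; rewrite ltn_add2l.
have := @measurable_shift _ (VM * VM)%type fst _ measurable_fst measurable_gate.
move=> /(@measurableT_comp _ _ _ (past w (m + j)%N) ((VM * VM) * VM)%type VM _ setT
   (fun t => ((stopped k t, X (m + k)%N t), w (m + k)%N t))).
apply; apply: measurable_fun_pair => //; exact: measurable_fun_pair.
Qed.

Let measurable_sqn_stopped j : measurable_fun setT (fun t => sqn (stopped j t)).
Proof.
apply: (@measurableT_comp _ _ _ T VM R sqn) => //; first exact: measurable_sqn.
exact: (measurable_fun_past iid (@stopped_past j)).
Qed.

Lemma sqn_stopped j t : 0 <= sqn (stopped j t) <= (j%:R * eps) ^+ 2.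
Proof.
rewrite sqn_ge0 -[sqn _]enorm_sqr lerXn2r ?nnegrE ?enorm_ge0 ?enorm_stopped//.
by rewrite mulr_ge0// ltW.
Qed.

Lemma stopped_second_moment j :
  \int[P]_t sqn (stopped j t) <= N%:R * c * \sum_(i < j) a (m + i)%N.
Proof.
elim: j => [|j IH].
  rewrite big_ord0 mulr0 /= (_ : sqn 0 = 0) ?Rintegral_cst ?mul0r//.
  by rewrite /sqn big1// => i _; rewrite mxE expr0n.
rewrite big_ord_recr mulrDr /=.
pose H t : VM * VM := (stopped j t, X (m + j)%N t).
pose phi (zy : VM * VM) (v : V) := sqn ((zy.1 : V) + gate zy.1 zy.2 *: v).
have Nc0 : 0 <= N%:R * c by rewrite mulr_ge0// ltW// (iso_gt0 iso).
(* A centred step is orthogonal in the mean to the current position, so square norms add. *)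
have avgphi zy : avg mu (phi zy) = sqn (zy.1 : V) + gate zy.1 zy.2 ^+ 2 * (N%:R * c).
  have [_ /(_ (zy.1 : V) (gate zy.1 zy.2)) [_]] := parabolic_sqn iso 0.
  by rewrite /phi; under eq_fun do rewrite subr0; rewrite subr0.
have -> : \int[P]_t sqn (stopped j.+1 t) = \int[P]_t avg mu (phi (H t)).
  rewrite -(@expectation_step _ _ _ _ P w iid wB (m + j)%N _ _ H phi (((j%:R + 1) * eps) ^+ 2)) //.
  - apply: measurable_fun_pair; first exact: stopped_past.
    exact: walk_past.
  - apply: (@measurableT_comp _ _ _ _ VM R sqn setT) => //; first exact: measurable_sqn.
    exact: (@measurable_shift _ (VM * VM)%type fst _ measurable_fst measurable_gate).
  - move=> t v Bv; rewrite ger0_norm ?sqn_ge0// /phi -[sqn _]enorm_sqr.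
    rewrite lerXn2r ?nnegrE ?enorm_ge0 ?mulr_ge0 ?(ltW eps0) ?addr_ge0//.
    rewrite mulrDl mul1r (le_trans (enormD _ _))// lerD ?enorm_stopped// enormZ ger0_norm//.
    rewrite -[leRHS]mulr1 ler_pM ?enorm_ge0//.
      exact: le_trans (gate_le _ _) (radius_le _).
    by move: Bv; rewrite /eball /= subr0 => /ltW.
have is0 : P.-integrable setT (EFin \o (fun t => sqn (stopped j t))).
  apply: (@bounded_measurable_integrable _ _ _ P _ ((j%:R * eps) ^+ 2)) => // t.
  by have /andP[h1 h2] := sqn_stopped j t; rewrite ger0_norm.
have mX : measurable_fun setT (X (m + j)%N : T -> VM) := walk_measurable (m + j)%N.
have mS : measurable_fun setT (stopped j : T -> VM).
  exact: (measurable_fun_past iid (@stopped_past j)).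
pose g t := gate (stopped j t) (X (m + j)%N t).
have mg : measurable_fun setT g.
  exact: (measurableT_comp measurable_gate (measurable_fun_pair mS mX)).
have g2 t : 0 <= g t ^+ 2 <= eps ^+ 2.
  rewrite sqr_ge0 lerXn2r ?nnegrE ?gate_ge0 ?(ltW eps0)//.
  exact: le_trans (gate_le _ _) (radius_le _).
have ig : P.-integrable setT (EFin \o (fun t => N%:R * c * g t ^+ 2)).
  apply: (@bounded_measurable_integrable _ _ _ P _ (N%:R * c * eps ^+ 2)).
    by apply: measurable_funM => //; exact: measurable_funX.
  by move=> t; have /andP[h1 h2] := g2 t; rewrite normrM (ger0_norm Nc0) ger0_norm// ler_wpM2l.
have ir : P.-integrable setT (EFin \o (fun t => N%:R * c * step_radius (X (m + j)%N t) ^+ 2)).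
  apply: (@bounded_measurable_integrable _ _ _ P _ (N%:R * c * eps ^+ 2)).
    exact: measurable_funM.
  move=> t; have /andP[h1 h2] := radius_sqr_le t (m + j)%N.
  by rewrite normrM (ger0_norm Nc0) ger0_norm// ler_wpM2l.
have -> : \int[P]_t avg mu (phi (H t)) = \int[P]_t (sqn (stopped j t) + N%:R * c * g t ^+ 2).
  by apply: eq_Rintegral => t _; rewrite avgphi /= mulrC.
rewrite RintegralD// lerD// /a -RintegralZl//.
apply: le_Rintegral => // t _; rewrite ler_wpM2l//.
rewrite lerXn2r ?nnegrE ?gate_ge0 ?radius_ge0//; exact: gate_le.
Qed.

End StoppedIncrement.

Lemma sqn_walk_le r n t : (forall y, D y -> `|y| <= r) -> 0 <= sqn (X n t) <= N%:R * r ^+ 2.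
Proof. by move=> Dr; rewrite sqn_ge0 sqn_le// Dr//; exact: walk_in. Qed.

(** Each step raises the mean of |X_n|^2 by N c times the mean square radius, while the walk stays
    in a bounded set; hence the square radii are summable in the mean. *)
Lemma walk_second_moment c r n : isotropic mu c -> (forall y, D y -> `|y| <= r) ->
  N%:R * c * \sum_(i < n) a i <= N%:R * r ^+ 2.
Proof.
move=> iso Dr.
have isq k : P.-integrable setT (EFin \o (fun t => sqn (X k t))).
  apply: (@bounded_measurable_integrable _ _ _ P _ (N%:R * r ^+ 2)).
    apply: (@measurableT_comp _ _ _ T VM R sqn) => //; first exact: measurable_sqn.
    exact: walk_measurable.
  by move=> t; have /andP[h1 h2] := sqn_walk_le k t Dr; rewrite ger0_norm.
suff h : \int[P]_t sqn (X n t) = sqn x + N%:R * c * \sum_(i < n) a i.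
  rewrite -[leLHS](addKr (sqn x)) -h addrC.
  apply: (@le_trans _ _ (\int[P]_t sqn (X n t))); first by rewrite gerBl sqn_ge0.
  apply: (@le_trans _ _ (\int[P]_t (cst (N%:R * r ^+ 2) t))).
    apply: le_Rintegral => //.
      apply: (@bounded_measurable_integrable _ _ _ P _ (`|N%:R * r ^+ 2|)) => //.
    by move=> t _; have /andP[] := sqn_walk_le n t Dr.
  by rewrite Rintegral_probability_cst.
elim: n => [|n IH].
  by rewrite big_ord0 mulr0 addr0; exact: (Rintegral_probability_cst P (sqn x)).
rewrite big_ord_recr mulrDr addrA -IH /=.
pose phi (y v : V) := sqn (y + step_radius y *: v).
have avgphi y : avg mu (phi y) = sqn y + N%:R * c * step_radius y ^+ 2.
  have [_ /(_ y (step_radius y)) [_]] := parabolic_sqn iso 0.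
  by rewrite /phi mulrC; under eq_fun do rewrite subr0; rewrite subr0.
have -> : \int[P]_t sqn (X n.+1 t) = \int[P]_t avg mu (phi (X n t)).
  rewrite -(@expectation_step _ _ _ _ P w iid wB n _ VM (X n) phi (N%:R * r ^+ 2)) //.
  - exact: walk_past.
  - apply: (@measurableT_comp _ _ _ _ VM R sqn setT) => //; first exact: measurable_sqn.
    exact: (@measurable_shift _ VM id _ (@measurable_id _ _ _) measurable_radius).
  - move=> t v Bv; rewrite ger0_norm ?sqn_ge0// sqn_le// Dr//.
    by apply: step_in => //; exact: walk_in.
have Nc0 : 0 <= N%:R * c by rewrite mulr_ge0// ltW// (iso_gt0 iso).
have ir : P.-integrable setT (EFin \o (fun t => N%:R * c * step_radius (X n t) ^+ 2)).
  apply: (@bounded_measurable_integrable _ _ _ P _ (N%:R * c * eps ^+ 2)).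
    exact: measurable_funM.
  move=> t; have /andP[h1 h2] := radius_sqr_le t n.
  by rewrite normrM (ger0_norm Nc0) ger0_norm// ler_wpM2l.
have -> : \int[P]_t avg mu (phi (X n t)) =
    \int[P]_t (sqn (X n t) + N%:R * c * step_radius (X n t) ^+ 2).
  by apply: eq_Rintegral => t _; rewrite avgphi.
by rewrite RintegralD// /a -RintegralZl.
Qed.

Lemma walk_tail e : 0 < e -> exists m, forall n, \sum_(i < n) a (m + i)%N <= e.
Proof.
move=> e0; have [c iso] := step_law_isotropic iid N0.
have [r r0 cr] := bounded_closure bD.
have Dr y : D y -> `|y| <= r by move=> Dy; apply: cr; exact: subset_closure.
have Nc0 : 0 < N%:R * c by rewrite mulr_gt0 ?ltr0n// (iso_gt0 iso).
pose S n := \sum_(i < n) a i.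
pose E := [set S n | n in [set: nat]].
have SM n : S n <= N%:R * r ^+ 2 / (N%:R * c).
  by rewrite ler_pdivlMr// mulrC; exact: walk_second_moment.
have supE : has_sup E.
  split; first by exists (S 0%N), 0%N.
  by exists (N%:R * r ^+ 2 / (N%:R * c)) => _ [n _ <-].
have [_ [m _ <-] Sm] := sup_adherent e0 supE.
exists m => n.
have -> : \sum_(i < n) a (m + i)%N = S (m + n)%N - S m.
  by rewrite /S big_split_ord /= [X in X - _]addrC addrK.
have : S (m + n)%N <= sup E by apply: ub_le_sup; [exact: (proj2 supE)|exists (m + n)%N].
lra.
Qed.

Let lam j : R := j.+1%:R^-1.
Let lam_gt0 j : 0 < lam j. Proof. by rewrite invr_gt0. Qed.

(** Outside this event, by [stopped_cases], all positions after time m stay within squared distance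
    [lam j] of X m. *)
Let Osc j m := \bigcup_J [set t | lam j <= sqn (stopped m (lam j) J t)].

Lemma stopped_cases m l J t :
  stopped m l J t = X (m + J)%N t - X m t \/ l <= sqn (stopped m l J t).
Proof.
elim: J => [|J [IH|IH]]; first by left; rewrite addn0 subrr.
  rewrite /=; case: ifPn => [_|]; last by rewrite -leNgt => h; right; rewrite scale0r addr0.
  by left; rewrite IH addnS walkS addrAC.
by right; rewrite /= ltNge IH /= scale0r addr0.
Qed.

Lemma stopped_nondecreasing m l J K t : (J <= K)%N ->
  l <= sqn (stopped m l J t) -> l <= sqn (stopped m l K t).
Proof.
move=> /subnK <-; elim: (K - J)%N => // k IH /IH h.
by rewrite addSn /= ltNge h /= scale0r addr0.
Qed.

Let measurable_event j m J : measurable [set t | lam j <= sqn (stopped m (lam j) J t)].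
Proof.
have mS : measurable_fun setT (fun t => sqn (stopped m (lam j) J t)).
  apply: (@measurableT_comp _ _ _ T VM R sqn) => //; first exact: measurable_sqn.
  exact: (measurable_fun_past iid (@stopped_past m (lam j) J)).
have := mS measurableT _ (measurable_itv `[lam j, +oo[).
by rewrite setTI set_itvE.
Qed.

Let measurable_Osc j m : measurable (Osc j m).
Proof. by apply: bigcupT_measurable => J; exact: measurable_event. Qed.

(** The events increase with J, since a stopped increment remains stopped, and Markov's inequality
    bounds each of them by the same tail of variances. *)
Let Osc_small j e : 0 < e -> exists m, (P (Osc j m) <= e%:E)%E.
Proof.
move=> e0; have [c iso] := step_law_isotropic iid N0.
have Nc0 : 0 < N%:R * c by rewrite mulr_gt0 ?ltr0n// (iso_gt0 iso).
have [m hm] := walk_tail (divr_gt0 (mulr_gt0 e0 (lam_gt0 j)) Nc0).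
exists m.
have nd : nondecreasing_seq (fun J => [set t | lam j <= sqn (stopped m (lam j) J t)]).
  by move=> J K JK; apply/subsetPset => t /=; exact: stopped_nondecreasing.
have cvP := nondecreasing_cvg_mu (mu := P) (measurable_event j m) (measurable_Osc j m) nd.
rewrite -(cvg_lim _ cvP)//; apply: lime_le; first by apply/cvg_ex; exists (P (Osc j m)).
apply: nearW => J /=.
have mS : measurable_fun setT (fun t => sqn (stopped m (lam j) J t)).
  apply: (@measurableT_comp _ _ _ T VM R sqn) => //; first exact: measurable_sqn.
  exact: (measurable_fun_past iid (@stopped_past m (lam j) J)).
have [|_] := @bounded_markov _ _ _ P _ ((J%:R * eps) ^+ 2) _ mS _ (lam_gt0 j).
  by move=> t; exact: sqn_stopped.
move=> /le_trans; apply; rewrite lee_fin ler_pdivrMr//.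
apply: (le_trans (stopped_second_moment iso m (lam j) J)).
by rewrite mulrC -ler_pdivlMr.
Qed.

Let Rad j m := \bigcap_n [set t | lam j <= step_radius (X (m + n)%N t) ^+ 2].

Let measurable_Rad_event j n :
  measurable [set t | lam j <= step_radius (X n t) ^+ 2].
Proof.
have := mradius n measurableT (measurable_itv `[lam j, +oo[).
by rewrite setTI set_itvE.
Qed.

Let measurable_Rad j m : measurable (Rad j m).
Proof. by apply: bigcapT_measurable => n; exact: measurable_Rad_event. Qed.

(** The event forces the radius to be large at arbitrarily late times, where Markov's inequality and
    the summability of [a] make this as unlikely as desired. *)
Let Rad0 j m : P (Rad j m) = 0%E.
Proof.
apply/eqP; rewrite eq_le measure_ge0 andbT; apply/lee_addgt0Pr => e e0.
rewrite add0e; have [n hn] := walk_tail (mulr_gt0 e0 (lam_gt0 j)).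
apply: (@le_trans _ _ (P [set t | lam j <= step_radius (X (m + n)%N t) ^+ 2])).
  by apply: le_measure; rewrite ?inE// => t /(_ n I).
have [|_] := @bounded_markov _ _ _ P _ (eps ^+ 2) _ (mradius (m + n)) _ (lam_gt0 j).
  by move=> t; exact: radius_sqr_le.
move=> /le_trans; apply; rewrite lee_fin ler_pdivrMr// -/(a (m + n)).
apply: le_trans (hn m.+1); rewrite big_ord_recr /= [(n + m)%N]addnC lerDr.
by apply: sumr_ge0 => i _; exact: a_ge0.
Qed.

(** Off [N1] the walk is a Cauchy sequence. If its limit were at positive distance from the
    boundary, the radii would eventually stay above a positive constant, which places the path in
    [N2]. *)
Lemma walk_converges : exists E : set T, [/\ measurable E, P E = 0%E &
  forall t, ~ E t -> X n t @[n --> \oo] --> Xlim w D eps x t /\ bdry D (Xlim w D eps x t)].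
Proof.
pose N1 := \bigcup_j \bigcap_m Osc j m.
pose N2 := \bigcup_j \bigcup_m Rad j m.
have mN1 : measurable N1.
  by apply: bigcupT_measurable => j; apply: bigcapT_measurable => m; exact: measurable_Osc.
have mN2 : measurable N2.
  by apply: bigcupT_measurable => j; apply: bigcupT_measurable => m; exact: measurable_Rad.
have null (G : nat -> set T) : (forall k, measurable (G k)) -> (forall k, P (G k) = 0%E) ->
    P (\bigcup_k G k) = 0%E.
  move=> mG G0; apply: measure_negligible; first exact: bigcupT_measurable.
  by apply: negligible_bigcup => k; apply/(negligibleP _ (mG k)); exact: G0.
have null1 : P N1 = 0%E.
  apply: (null) => j; first by apply: bigcapT_measurable => m; exact: measurable_Osc.
  apply/eqP; rewrite eq_le measure_ge0 andbT; apply/lee_addgt0Pr => e e0.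
  rewrite add0e; have [m hm] := Osc_small j e0; apply: le_trans hm.
  apply: le_measure; last by move=> t /(_ m I).
    by rewrite inE; apply: bigcapT_measurable => m'; exact: measurable_Osc.
  by rewrite inE; exact: measurable_Osc.
have null2 : P N2 = 0%E.
  apply: (null) => j; first by apply: bigcupT_measurable => m; exact: measurable_Rad.
  by apply: (null) => m; [exact: measurable_Rad|exact: Rad0].
exists (N1 `|` N2); split.
- exact: measurableU.
- apply/eqP; rewrite -measure_le0; apply: (le_trans (measureU2 _ mN1 mN2)).
  have h : (P N1 + P N2 <= 0)%E by rewrite null1 null2 adde0.
  exact: h.
move=> t nt; have [n1 n2] : ~ N1 t /\ ~ N2 t by split=> h; apply: nt; [left|right].
have ct : cvg (X n t @[n --> \oo]).
  apply/cauchy_cvgP/cauchy_exP => e e0.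
  have [j _ je] := @near_infty_natSinv_lt R (PosNum (exprn_gt0 2 e0)).
  have {}je : lam j < e ^+ 2 by apply: je => /=.
  have [m nm] : exists m, ~ Osc j m t.
    apply: contrapT => h; apply: n1; exists j => // m _.
    by apply: contrapT => om; apply: h; exists m.
  exists (X m t); exists m => // k /= mk; rewrite -ball_normE /= distrC.
  have := stopped_cases m (lam j) (k - m) t; rewrite subnKC// => -[h|h]; last first.
    by exfalso; apply: nm; exists (k - m)%N.
  rewrite -(@ltr_pXn2r _ 2) ?nnegrE ?(ltW e0)//.
  apply: (le_lt_trans _ je); apply: (@le_trans _ _ (sqn (X k t - X m t))).
    by rewrite -[leRHS]enorm_sqr lerXn2r ?nnegrE ?enorm_ge0//; exact: norm_le_enorm.
  rewrite leNgt; apply/negP => /ltW l1; apply: nm; exists (k - m)%N => //=.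
  by rewrite h.
split; first exact: ct.
set l := Xlim w D eps x t.
apply: (dist_bdry_eq0 (bdry_neq0 N0 oD bD Dx)).
apply/eqP; rewrite eq_le dist_bdry_ge0 andbT leNgt; apply/negP => l0.
have l2 : 0 < dist_bdry D l / 2 by rewrite divr_gt0.
have dX : dist_bdry D (X n t) @[n --> \oo] --> dist_bdry D l.
  by apply: (@cvg_comp _ _ _ (fun n => X n t) (dist_bdry D)); [exact: ct|exact: dist_bdry_continuous].
have /cvgrPdist_lt /(_ _ l2) [m _ hm] := dX.
pose s := Num.min eps (dist_bdry D l / 2).
have s0 : 0 < s by rewrite lt_min eps0.
have [j _ js] := @near_infty_natSinv_lt R (PosNum (exprn_gt0 2 s0)).
have {}js : lam j < s ^+ 2 by apply: js => /=.
apply: n2; exists j => //; exists m => // n _ /=; apply: (le_trans (ltW js)).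
rewrite lerXn2r ?nnegrE ?(ltW s0) ?radius_ge0// /step_radius le_min ge_min lexx /=.
rewrite (@le_trans _ _ (dist_bdry D l / 2))//; first by rewrite ge_min lexx orbT.
have := hm (m + n)%N (leq_addr _ _); rewrite /= ltr_norml => /andP[_]; lra.
Qed.

End WalkConverges.

Lemma Rintegral_cvg {R : realType} {d} {Y : measurableType d} (Q : probability Y R)
    (S E : set Y) (f_ : nat -> Y -> R) (f : Y -> R) K :
  measurable S -> (forall n, measurable_fun setT (f_ n)) -> measurable_fun setT f ->
  measurable E -> Q E = 0%E ->
  (forall y, S y -> ~ E y -> f_ n y @[n --> \oo] --> f y) ->
  (forall n y, `|f_ n y| <= K) ->
  \int[Q]_(y in S) f_ n y @[n --> \oo] --> \int[Q]_(y in S) f y.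
Proof.
move=> mS mf_ mf mE E0 ff fK.
have iK : Q.-integrable S (EFin \o (fun _ : Y => K)).
  apply: (@integrableS _ _ _ Q setT) => //.
  exact: (@bounded_measurable_integrable _ _ _ Q (fun=> K) (`|K|)).
have ae1 : {ae Q, forall y, S y -> (f_ n y)%:E @[n --> \oo] --> (f y)%:E}.
  exists E; split => // y /= ny; apply: contrapT => nE; apply: ny => Sy.
  by apply: cvg_EFin; [exact: nearW|exact: ff].
have ae2 : {ae Q, forall y n, S y -> (`| (f_ n y)%:E | <= K%:E)%E}.
  by apply: aeW => y n _; rewrite lee_fin.
have [||intf _ cv] := dominated_convergence mS _ _ ae1 iK ae2.
- by move=> n; apply/measurable_EFinP; exact: measurable_funTS.
- by apply/measurable_EFinP; exact: measurable_funTS.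
move: cv; rewrite -[X in _ --> X -> _]fineK; last exact: integrable_fin_num.
exact: fine_cvg.
Qed.

(** * The mean value property of the expected boundary value *)

Section MeanValue.
Context {R : realType} {N : nat}.
Local Notation V := 'rV[R]_N.
Local Notation VM := (borelV R N).
Local Notation B := (eball (0 : V) 1).
Context {d : measure_display} {T : measurableType d}.
Variables (P : probability T R) (w : nat -> T -> V).
Hypothesis iid : iid_uniform_ball P w.
Hypothesis wB : forall k t, B (w k t).
Hypothesis N0 : (0 < N)%N.
Let mu := step_law iid.
Variables (D : set V) (eps : R).
Hypotheses (oD : open D) (bD : bounded_set D) (eps0 : 0 < eps).
Variables (F : V -> R) (G : V -> R) (K : R).
Hypotheses (cG : continuous G) (GK : forall y, `|G y| <= K)
  (GF : forall y, bdry D y -> G y = F y).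
Local Notation radius := (step_radius D eps).

Definition ball_mean (g : V -> R) (x : V) : R := avg mu (fun v => g (x + radius x *: v)).

Let good (g : V -> R) := measurable_fun (setT : set VM) g /\ forall y, `|g y| <= K.

Let measurable_moved g : measurable_fun (setT : set VM) g ->
  measurable_fun setT (fun yv : VM * VM => g ((yv.1 : V) + radius yv.1 *: (yv.2 : V)) : R).
Proof.
move=> mg; apply: (@measurableT_comp _ _ _ _ VM R g setT) => //.
apply: (@measurable_shift _ _ _ VM id); first exact: measurable_id.
exact: measurable_radius.
Qed.

Let good_ball_mean g : good g -> good (ball_mean g).
Proof.
move=> [mg gK]; split.
  apply: (@measurable_avg _ _ _ _ P w iid _ VM (fun y v => g (y + radius y *: v)) K) => //.
  exact: measurable_moved.
move=> y; apply: (norm_avg_le (step_law_ball iid)) => //.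
by split; [exact: measurable_affine|exists K].
Qed.

Let good_iter n g : good g -> good (iter n ball_mean g).
Proof. by move=> gg; elim: n => //= n; exact: good_ball_mean. Qed.

Let good_G : good G.
Proof. by split => //; exact: measurable_continuousV. Qed.

(** Expressing the expectation by iterates of one operator yields at once Borel dependence on the
    starting point and, on letting n grow in the (n+1)-st iterate, the mean value property. The last
    step is peeled off, hence the induction over all g. *)
Lemma expectation_walk x n g : D x -> good g ->
  \int[P]_t g (walk w D eps x n t) = iter n ball_mean g x.
Proof.
move=> Dx; elim: n g => [|n IH] g gg.
  exact: (Rintegral_probability_cst P (g x)).
rewrite iterSr -(IH (ball_mean g)); last exact: good_ball_mean.
have [mg gK] := gg.
apply: (@expectation_step _ _ _ _ P w iid wB n _ VM (walk w D eps x n)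
  (fun y v => g (y + radius y *: v)) K) => //.
- exact: walk_past.
- exact: measurable_moved.
Qed.

Definition limit_value (x : V) : R := \int[P]_t G (Xlim w D eps x t).

Lemma measurable_GXlim x : measurable_fun setT (fun t => G (Xlim w D eps x t)).
Proof.
apply: (@measurableT_comp _ _ _ T VM R G) => //; first exact: (proj1 good_G).
by apply: measurable_Xlim => k; exact: (measurable_step iid).
Qed.

Lemma iter_cvg_limit_value x : D x ->
  iter n ball_mean G x @[n --> \oo] --> limit_value x.
Proof.
move=> Dx; have [E [mE E0 hE]] := walk_converges iid wB N0 oD bD eps0 Dx.
rewrite (_ : (fun n => _) = (fun n => \int[P]_t G (walk w D eps x n t))); last first.
  by apply/funext => n; rewrite expectation_walk.
apply: (@Rintegral_cvg _ _ _ P setT E _ _ K) => //.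
- move=> n; apply: (@measurableT_comp _ _ _ T VM R G) => //; first exact: (proj1 good_G).
  exact: (walk_measurable iid).
- exact: measurable_GXlim.
- move=> t _ /hE[ct _].
  by apply: (@cvg_comp _ _ _ (fun n => walk w D eps x n t) G); [exact: ct|exact: cG].
Qed.

Lemma u_eps_limit_value x : D x -> u_eps P w D F eps x = limit_value x.
Proof.
move=> Dx; have [E [mE E0 hE]] := walk_converges iid wB N0 oD bD eps0 Dx.
congr fine; apply: (@integral_off_null _ _ _ P _ _ E) => // t /hE[_ bt].
by rewrite GF.
Qed.

(** The step radius is 0 on the boundary, so the walk stands still; thus estimates on the closure of
    D make sense up to the boundary. *)
Lemma u_eps_bdry x : bdry D x -> u_eps P w D F eps x = F x.
Proof.
move=> bx; have wx n t : walk w D eps x n t = x.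
  by elim: n => //= n ->; rewrite dist_bdry0// min_r ?ltW// scale0r addr0.
have Xx t : Xlim w D eps x t = x.
  rewrite /Xlim (_ : (fun n => _) = (fun=> x)); last by apply/funext => n; rewrite wx.
  by apply: cvg_lim => //; exact: cvg_cst.
rewrite /u_eps (_ : (fun t => _) = (fun=> (F x)%:E)).
  exact: (Rintegral_probability_cst P (F x)).
by apply/funext => t; rewrite Xx.
Qed.

Lemma norm_limit_value x : `|limit_value x| <= K.
Proof.
have K0 : 0 <= K := le_trans (normr_ge0 _) (GK 0).
have iG : P.-integrable setT (EFin \o (fun t => G (Xlim w D eps x t))).
  by apply: (@bounded_measurable_integrable _ _ _ P _ K) => //; exact: measurable_GXlim.
rewrite (le_trans (le_normr_Rintegral _ iG))//.
rewrite -[leRHS](Rintegral_probability_cst P K); apply: le_Rintegral => //.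
- apply: (@bounded_measurable_integrable _ _ _ P _ K) => //.
    by apply: measurableT_comp => //; exact: measurable_GXlim.
  by move=> t; rewrite normr_id.
- exact: (@bounded_measurable_integrable _ _ _ P (fun=> K) (`|K|)).
Qed.

(* F o Xlim need not be measurable, since F is arbitrary off the boundary; with G
   in place of F, u_eps becomes a Borel function of the starting point. *)
Definition mean_function (x : V) : R := if `[< D x >] then limit_value x else 0.

Let iterD n (x : V) : R := if `[< D x >] then iter n ball_mean G x else 0.

Let measurable_D : measurable (D : set VM).
Proof. exact: sub_sigma_algebra. Qed.

Let measurable_iterD n : measurable_fun (setT : set VM) (iterD n).
Proof.
apply: measurable_fun_ifT.
- apply: (@measurable_fun_bool _ _ _ _ true).
  by rewrite setTI (_ : _ @^-1` _ = D)//; apply/seteqP; split => t /= /asboolP.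
- by have [] := good_iter n good_G.
- exact: measurable_cst.
Qed.

Let iterD_cvg x : iterD n x @[n --> \oo] --> mean_function x.
Proof.
rewrite /iterD /mean_function; case: asboolP => [|_]; first exact: iter_cvg_limit_value.
exact: cvg_cst.
Qed.

Lemma measurable_mean_function : measurable_fun (setT : set VM) mean_function.
Proof. by apply: (@measurable_fun_cvg _ VM _ setT iterD) => // x _; exact: iterD_cvg. Qed.

Lemma mean_functionE x : D x -> mean_function x = u_eps P w D F eps x.
Proof. by move=> Dx; rewrite /mean_function; case: asboolP => // _; rewrite u_eps_limit_value. Qed.

Lemma norm_mean_function x : `|mean_function x| <= K.
Proof.
rewrite /mean_function; case: asboolP => _; first exact: norm_limit_value.
by rewrite normr0 (le_trans _ (GK 0)).
Qed.

Lemma mean_function_mean x : D x ->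
  mean_function x = avg mu (fun v => mean_function (x + radius x *: v)).
Proof.
move=> Dx.
have h1 : iterD n.+1 x @[n --> \oo] --> mean_function x.
  by have := @iterD_cvg x; rewrite -(cvg_shiftS (fun n => iterD n x)).
have h2 : avg mu (fun v => iterD n (x + radius x *: v)) @[n --> \oo] -->
    avg mu (fun v => mean_function (x + radius x *: v)).
  apply: (@Rintegral_cvg _ _ VM mu B set0 (fun n v => iterD n (x + radius x *: v))
    (fun v => mean_function (x + radius x *: v)) K) => //.
  - exact: measurable_unit_ball.
  - by move=> n; exact: measurable_affine.
  - by apply: measurable_affine; exact: measurable_mean_function.
  - move=> n v; rewrite /=; rewrite /iterD; case: asboolP => _; first by have [_ h] := good_iter n good_G; exact: h.
    by rewrite normr0 (le_trans _ (GK 0)).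
apply: (cvg_unique _ h1) => //.
rewrite (_ : (fun n => iterD n.+1 x) = (fun n => avg mu (fun v => iterD n (x + radius x *: v)))) //.
apply/funext => n; rewrite {1}/iterD; case: asboolP => // _ /=.
apply: eq_avg => v Bv; rewrite /iterD; case: asboolP => // -[].
exact: (step_in N0 oD bD eps0).
Qed.

End MeanValue.

(** * Reduction to steps in the open unit ball *)

Section Truncation.
Context {R : realType} {N : nat}.
Local Notation V := 'rV[R]_N.
Local Notation VM := (borelV R N).
Local Notation B := (eball (0 : V) 1).
Context {d : measure_display} {T : measurableType d}.
Variables (P : probability T R) (w : nat -> T -> V).
Hypothesis iid : iid_uniform_ball P w.

(* The steps lie in the open unit ball only almost surely, and outside it a step
   could leave D. *)
Definition truncated (k : nat) (t : T) : V := if `[< B (w k t) >] then w k t else 0.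

Lemma truncated_in k t : B (truncated k t).
Proof.
by rewrite /truncated; case: asboolP => // _; rewrite /eball /= subrr enorm0.
Qed.

Let bad := \bigcup_k [set t | ~ B (w k t)].

Let mbad k : measurable [set t | ~ B (w k t)].
Proof.
rewrite (_ : [set t | _] = ~` (w k @^-1` B))//; apply: measurableC.
by have [h _ _] := iid; apply: h; exact: measurable_unit_ball.
Qed.

Let measurable_bad : measurable bad. Proof. exact: bigcupT_measurable. Qed.

Let bad0 : P bad = 0%E.
Proof.
apply: measure_negligible => //; apply: negligible_bigcup => k.
apply/(negligibleP _ (mbad k)).
have mB : measurable (w k @^-1` B).
  by have [h _ _] := iid; apply: h; exact: measurable_unit_ball.
apply: (etrans (probability_setC P mB)).
have -> : P (w k @^-1` B) = 1%E.
  rewrite (step_lawE iid); first exact: step_law_ball.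
  exact: measurable_unit_ball.
by rewrite subee.
Qed.

Lemma truncatedE k t : ~ bad t -> truncated k t = w k t.
Proof.
move=> nt; rewrite /truncated; case: asboolP => // nB; exfalso.
by apply: nt; exists k.
Qed.

Lemma probability_off_null (A1 A2 E : set T) : measurable A1 -> measurable A2 ->
  measurable E -> P E = 0%E -> (forall t, ~ E t -> A1 t <-> A2 t) -> P A1 = P A2.
Proof.
move=> m1 m2 mE E0 h.
rewrite -(setIT A1) -(setIT A2) -!integral_indic//.
apply: (@integral_off_null _ _ _ P _ _ E) => // t /h A12.
by rewrite !indicE; congr ((_ : bool)%:R%:E); apply/idP/idP; rewrite !inE => /A12.
Qed.

Lemma measurable_truncated k : measurable_fun setT (truncated k : T -> VM).
Proof.
apply: measurable_fun_ifT; last exact: measurable_cst.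
- apply: (@measurable_fun_bool _ _ _ _ true).
  rewrite setTI (_ : _ @^-1` _ = w k @^-1` B); last first.
    by apply/seteqP; split => t /= /asboolP.
  by have [h _ _] := iid; apply: h; exact: measurable_unit_ball.
- exact: (measurable_step iid).
Qed.

Lemma iid_truncated : iid_uniform_ball P truncated.
Proof.
have [h1 h2 h3] := iid.
have mt k (A : set V) : borelN A -> measurable (truncated k @^-1` A).
  move=> mA; have := @measurable_truncated k measurableT _ mA.
  by rewrite setTI.
have PE k (A : set V) : borelN A -> P (truncated k @^-1` A) = P (w k @^-1` A).
  move=> mA; apply: (@probability_off_null _ _ bad) => //; [exact: mt|exact: h1|].
  by move=> t /(truncatedE k) E; rewrite /preimage /= E.
split=> //.
- by move=> k A mA; rewrite PE// h2.
- move=> s A us mA.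
  rewrite (eq_bigr (fun k => P (w k @^-1` A k))); last by move=> k _; exact: PE.
  rewrite -h3//; apply: (@probability_off_null _ _ bad) => //.
  + by apply: fin_bigcap_measurable => // k _; apply: mt; exact: mA.
  + by apply: fin_bigcap_measurable => // k _; apply: h1; exact: mA.
  + move=> t nt; split => h k ks; have := h k ks; by rewrite /preimage /= truncatedE.
Qed.

Variable D : set V.

Lemma walk_truncated eps x n t : ~ bad t -> walk truncated D eps x n t = walk w D eps x n t.
Proof. by move=> nt; elim: n => //= n ->; rewrite truncatedE. Qed.

Lemma Xlim_truncated eps x t : ~ bad t -> Xlim truncated D eps x t = Xlim w D eps x t.
Proof.
move=> nt; rewrite /Xlim.
suff -> : (fun n => walk truncated D eps x n t) = (fun n => walk w D eps x n t) by [].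
by apply/funext => n; exact: walk_truncated.
Qed.

Lemma u_eps_truncated F eps x : u_eps P truncated D F eps x = u_eps P w D F eps x.
Proof.
congr fine; apply: (@integral_off_null _ _ _ P _ _ bad) => // t nt.
by rewrite Xlim_truncated.
Qed.

Lemma walk_regular_truncated : walk_regular P w D -> walk_regular P truncated D.
Proof.
move=> hw y0 by0 eta delta eta0 delta0; have [dh [eh [? ? ? ? h]]] := hw y0 by0 eta delta eta0 delta0.
exists dh, eh; split=> // eps x0 e0 e1 x0y Dx0; rewrite -(_ : P [set t | eball y0 delta (Xlim w D eps x0 t)] = P _); first exact: h.
have mb : measurable (eball y0 delta : set VM).
  by apply: sub_sigma_algebra; exact: open_eball.
have m1 := @measurable_Xlim _ _ _ T w D eps x0 (measurable_step iid) measurableT _ mb.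
have m2 := @measurable_Xlim _ _ _ T truncated D eps x0 measurable_truncated measurableT _ mb.
rewrite !setTI in m1 m2.
apply: (@probability_off_null _ _ bad) => // t nt.
by rewrite /= Xlim_truncated.
Qed.

End Truncation.

(** * The Dirichlet problem *)

(** At a maximum of v - u + k |x|^2 the second difference is at most 0. The square contributes 2 k
    t^2 and the two Taylor errors take away at most k t^2 / 2, so more than k t^2 remains. *)
Lemma second_difference_comparison {R : realFieldType}
    (up um u0 vp vm v0 sp sm s0 Lu Lv k t : R) : 0 < t ->
  `|up + um - 2 * u0 - t ^+ 2 * Lu| <= k / 4 * t ^+ 2 ->
  `|vp + vm - 2 * v0 - t ^+ 2 * Lv| <= k / 4 * t ^+ 2 ->
  vp - up + k * sp <= v0 - u0 + k * s0 -> vm - um + k * sm <= v0 - u0 + k * s0 ->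
  sp + sm = 2 * s0 + 2 * t ^+ 2 -> 0 < k -> Lv - Lu + k <= 0.
Proof.
move=> t0 hu hv hp hm hs k0; have t20 : 0 < t ^+ 2 by rewrite exprn_gt0.
rewrite -(pmulr_rle0 _ t20).
have ks : k * (sp + sm) = k * (2 * s0 + 2 * t ^+ 2) by rewrite hs.
have kt : 0 < k * t ^+ 2 by rewrite mulr_gt0.
move: hu hv; rewrite !ler_norml => /andP[_ hu] /andP[hv _].
by move: (t ^+ 2) ks kt hu hv => q ks kt hu hv; lra.
Qed.

(** * Uniqueness of the solution *)

Section Uniqueness.
Context {R : realType} {N : nat}.
Local Notation V := 'rV[R]_N.
Implicit Types (D : set V) (u v : V -> R).

Lemma taylor2_second_difference D u x i : open D -> C2_on D u -> D x ->
  forall k, 0 < k -> exists2 d, 0 < d & forall t, `|t| < d ->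
   `|u (x + t *: evec i) + u (x - t *: evec i) - 2 * u x
      - t ^+ 2 * 'D_(evec i) ('D_(evec i) u) x| <= k * t ^+ 2.
Proof.
move=> oD C2 Dx k k0; have k2 : 0 < k / 2 by rewrite divr_gt0.
have [d d0 hd] := taylor2 oD C2 Dx k2; exists d => // t td.
have ev (s : R) : \sum_j (s *: (evec i : V)) ord0 j * 'D_(evec j) u x = s * 'D_(evec i) u x.
  rewrite (bigD1 i)//= big1 ?addr0 => [|j /negbTE ji].
    by rewrite !mxE !eqxx mulr1.
  by rewrite !mxE ji andbF mulr0 mul0r.
have evv (s : R) : \sum_j \sum_l (s *: (evec i : V)) ord0 j * (s *: (evec i : V)) ord0 l
    * 'D_(evec l) ('D_(evec j) u) x = s ^+ 2 * 'D_(evec i) ('D_(evec i) u) x.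
  rewrite (bigD1 i)//= [X in _ + X]big1 ?addr0 => [|j /negbTE ji].
    rewrite (bigD1 i)//= big1 ?addr0 => [|j /negbTE ji].
      by rewrite !mxE !eqxx mulr1.
    by rewrite !mxE ji andbF mulr0 mulr0 mul0r.
  by rewrite big1// => l _; rewrite !mxE ji andbF mulr0 !mul0r.
have nt (s : R) : `|s *: (evec i : V)| <= `|s|.
  rewrite normrZ ler_piMr//; apply: norm_le_coord => // j; rewrite !mxE eqxx.
  by case: (j == i); rewrite ?normr1 ?normr0.
have hs (s : R) : `|s| < d ->
    `|u (x + s *: evec i) - u x - s * 'D_(evec i) u x
       - 2^-1 * (s ^+ 2 * 'D_(evec i) ('D_(evec i) u) x)| <= k / 2 * s ^+ 2.
  move=> sd; have := hd _ (le_lt_trans (nt s) sd); rewrite ev evv => /le_trans; apply.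
  rewrite ler_wpM2l ?(ltW k2)// -[s ^+ 2]real_normK ?num_real//.
  by rewrite lerXn2r ?nnegrE.
have := hs t td; have := hs (- t); rewrite normrN => /(_ td); rewrite sqrrN scaleNr.
set a := u _; set b := u _; set Q := 'D_(evec i) ('D_(evec i) u) x; set L := 'D_(evec i) u x.
rewrite !ler_norml => /andP[? ?] /andP[? ?]; apply/andP; split; lra.
Qed.

(** A competing solution is known only through its derivatives, so this maximum principle works with
    second differences instead of averages: an interior maximum of h would give N k <= 0. *)
Lemma C2_comparison D u v : (0 < N)%N -> open D -> bounded_set D ->
  C2_on D u -> C2_on D v ->
  (forall x, D x -> laplacian u x = 0) -> (forall x, D x -> laplacian v x = 0) ->
  {within closure D, continuous u} -> {within closure D, continuous v} ->
  (forall y, bdry D y -> v y = u y) -> forall x, closure D x -> v x <= u x.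
Proof.
move=> N0 oD bD Cu Cv Lu Lv cu cv vu x0 cx0; rewrite leNgt; apply/negP => ux.
have [r r0 hr] := bounded_closure bD.
have n0 : 0 < N%:R :> R by rewrite ltr0n.
have G0 : 0 < N%:R * r ^+ 2 by rewrite mulr_gt0// exprn_gt0.
(* The added square is at most half of the gap v x0 - u x0, so the maximum of h cannot lie on the
   boundary. *)
pose k := (v x0 - u x0) / (2 * (N%:R * r ^+ 2)).
have k0 : 0 < k by rewrite divr_gt0 ?subr_gt0// mulr_gt0.
pose h x := v x - u x + k * sqn x.
have csq : continuous (@sqn R N).
  have -> : @sqn R N = (fun x => enorm x * enorm x).
    by apply/funext => x; rewrite -expr2 enorm_sqr.
  by move=> x; apply: continuousM; exact: enorm_continuous.
have ch : {within closure D, continuous h}.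
  apply/subspace_continuousP => x Dx; move/subspace_continuousP in cu.
  move/subspace_continuousP in cv; apply: cvgD; first by apply: cvgB; [exact: cv|exact: cu].
  by apply: cvgMr; apply: cvg_within_filter; exact: csq.
have [p /set_mem cp pmax] := EVT_max_rV (ex_intro _ x0 cx0) (compact_closure bD) ch.
have hx0 := pmax x0 (mem_set cx0).
have sq0 (z : V) : 0 <= k * sqn z by rewrite mulr_ge0 ?sqn_ge0// ltW.
have [Dp|bp] := closure_bdry oD cp; last first.
  have : h p <= k * (N%:R * r ^+ 2).
    by rewrite /h vu// subrr add0r ler_wpM2l ?(ltW k0)// sqn_le// hr.
  have -> : k * (N%:R * r ^+ 2) = (v x0 - u x0) / 2.
    by rewrite /k; field; rewrite !gt_eqF.
  by have := sq0 x0; move: hx0; rewrite /h; lra.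
have key i : 'D_(evec i) ('D_(evec i) v) p - 'D_(evec i) ('D_(evec i) u) p + k <= 0.
  have k4 : 0 < k / 4 by rewrite divr_gt0.
  have [d1 d10 h1] := taylor2_second_difference i oD Cu Dp k4.
  have [d2 d20 h2] := taylor2_second_difference i oD Cv Dp k4.
  have /nbhs_normV[d3 d30 h3] : nbhs p D by exact: open_nbhs_nbhs.
  pose d := Order.min d1 (Order.min d2 d3).
  have d0 : 0 < d by rewrite !lt_min d10 d20.
  pose t := d / 2; have t0 : 0 < t by rewrite divr_gt0.
  have td : `|t| < d by rewrite gtr0_norm// ltr_pdivrMr// ltr_pMr// ltr1n.
  have := td; rewrite !lt_min => /and3P[t1 t2 t3].
  have e1 (s : R) : `|s| < d3 -> D (p + s *: evec i).
    move=> sd; apply: h3; rewrite addrAC subrr add0r (le_lt_trans _ sd)//.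
    rewrite normrZ ler_piMr//; apply: norm_le_coord => // j; rewrite !mxE eqxx.
    by case: (j == i); rewrite ?normr1 ?normr0.
  have m1 := pmax _ (mem_set (subset_closure (e1 t t3))).
  have m2 : h (p - t *: evec i) <= h p.
    by apply: pmax; apply/mem_set/subset_closure; rewrite -scaleNr; apply: e1; rewrite normrN.
  have sE : sqn (p + t *: evec i) + sqn (p - t *: evec i) = 2 * sqn p + 2 * t ^+ 2.
    rewrite /sqn mulr_sumr -big_split /= (bigD1 i)//= [in RHS](bigD1 i)//=.
    have -> : \sum_(j < N | j != i) ((p + t *: evec i) ord0 j ^+ 2 + (p - t *: evec i) ord0 j ^+ 2)
        = \sum_(j < N | j != i) 2 * p ord0 j ^+ 2.
      by apply: eq_bigr => j /negbTE ji; rewrite !mxE ji andbF /=; ring.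
    by rewrite !mxE !eqxx /=; ring.
  exact: (second_difference_comparison t0 (h1 t t1) (h2 t t2) m1 m2 sE k0).
have : \sum_(i < N) ('D_(evec i) ('D_(evec i) v) p - 'D_(evec i) ('D_(evec i) u) p + k) <= 0.
  by apply: sumr_le0 => i _; exact: key.
have -> : \sum_(i < N) ('D_(evec i) ('D_(evec i) v) p - 'D_(evec i) ('D_(evec i) u) p + k)
    = laplacian v p - laplacian u p + k *+ N.
  by rewrite big_split sumrB sumr_const card_ord.
by rewrite Lu// Lv// subrr add0r leNgt pmulrn_lgt0 ?k0.
Qed.

Lemma dirichlet_unique D F u v : (0 < N)%N -> open D -> bounded_set D ->
  dirichlet_solution D F u -> dirichlet_solution D F v ->
  forall x, closure D x -> v x = u x.
Proof.
move=> N0 oD bD [Cu Lu cu Fu] [Cv Lv cv Fv] x cx.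
have E y : bdry D y -> v y = u y by move=> by_; rewrite Fu// Fv.
apply/eqP; rewrite eq_le; apply/andP; split.
  exact: (C2_comparison N0 oD bD Cu Cv).
by apply: (C2_comparison N0 oD bD Cv Cu) => // y /E.
Qed.

End Uniqueness.

(** |f| lies below a + b (1 - 1_E) everywhere, and the complement of E has probability at most
    eta. *)
Lemma Rintegral_concentrated {R : realType} {d} {T : measurableType d}
    (P : probability T R) (f : T -> R) (E : set T) (a b eta : R) :
  measurable_fun setT f -> measurable E -> 0 <= a -> 0 <= b ->
  (forall t, E t -> `|f t| <= a) -> (forall t, `|f t| <= a + b) ->
  ((1 - eta)%:E <= P E)%E -> `|\int[P]_t f t| <= a + b * eta.
Proof.
move=> mf mE a0 b0 fa fb PE.
have int1 (g : T -> R) K : measurable_fun setT g -> (forall t, `|g t| <= K) ->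
    P.-integrable setT (EFin \o g).
  by move=> mg gK; exact: (@bounded_measurable_integrable _ _ _ P g K).
have iE b1 : b1 <= 1 -> 0 <= b1 -> `|b * b1| <= b.
  by move=> b11 b10; rewrite normrM !ger0_norm// ler_piMr.
have mb : measurable_fun setT (fun t => b * \1_E t : R).
  by apply: measurable_funM => //; exact: measurable_cst.
have i1 : P.-integrable setT (EFin \o (\1_E : T -> R)).
  apply: (int1 _ 1) => // t.
  by rewrite indicE; case: (_ \in _); rewrite ?normr1 ?normr0.
have i2 : P.-integrable setT (EFin \o (fun t => b * \1_E t : R)).
  apply: (int1 _ b) => // t; apply: iE; rewrite indicE;
  by case: (_ \in _); rewrite ?ler01 ?lexx.
have i3 : P.-integrable setT (EFin \o (fun _ : T => a + b)).
  by apply: (int1 _ (a + b)) => // _; rewrite ger0_norm ?addr_ge0.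
apply: (le_trans (le_normr_Rintegral measurableT (int1 _ _ mf fb))).
apply: (@le_trans _ _ (\int[P]_t (a + b - b * \1_E t))).
  apply: le_Rintegral => //.
  - apply: (int1 _ (a + b)); first by apply: measurableT_comp.
    by move=> t; rewrite normr_id.
  - apply: (int1 _ (a + b + b)); first by apply: measurable_funB.
    move=> t; rewrite (le_trans (ler_normB _ _))// ger0_norm ?addr_ge0// lerD2l iE//;
    by rewrite indicE; case: (_ \in _); rewrite ?ler01 ?lexx.
  move=> t _; rewrite indicE; case: (boolP (t \in E)) => [|_].
    by rewrite inE mulr1 addrK; exact: fa.
  by rewrite mulr0 subr0.
rewrite RintegralB// (@Rintegral_probability_cst _ _ _ P (a + b)) RintegralZl//.
rewrite -addrA lerD2l -[X in X - _]mulr1 -mulrBr ler_wpM2l// lerBlDr -lerBlDl.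
rewrite /Rintegral integral_indic// setIT.
by rewrite -lee_fin fineK// fin_num_measure.
Qed.

(** * Uniform control near the boundary *)

Section BoundaryValues.
Context {R : realType} {N : nat}.
Local Notation V := 'rV[R]_N.
Local Notation VM := (borelV R N).
Local Notation B := (eball (0 : V) 1).
Context {d : measure_display} {T : measurableType d}.
Variables (P : probability T R) (w : nat -> T -> V).
Hypothesis iid : iid_uniform_ball P w.
Hypothesis wB : forall k t, B (w k t).
Hypothesis N0 : (0 < N)%N.
Variables (D : set V).
Hypotheses (oD : open D) (bD : bounded_set D).
Hypothesis regD : walk_regular P w D.
Variables (F : V -> R) (G : V -> R) (K : R).
Hypotheses (cG : continuous G) (GK : forall y, `|G y| <= K)
  (GF : forall y, bdry D y -> G y = F y).

Lemma u_eps_near_bdry y0 e : bdry D y0 -> 0 < e ->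
  exists2 r, 0 < r & exists2 s, 0 < s & forall eps x, 0 < eps -> eps < s ->
    closure D x -> `|x - y0| < r -> `|u_eps P w D F eps x - G y0| <= e.
Proof.
move=> by0 e0; have e2 : 0 < e / 2 by rewrite divr_gt0.
have n0 : 0 < N%:R :> R by rewrite ltr0n.
have K0 : 0 <= K by exact: le_trans (GK 0).
have [del del0 hG] := (continuousV_P G y0).1 (@cG y0) _ e2.
(* Walks ending far from y0 contribute at most 2 K eta, which is below e / 2; the [+ 1] covers K =
   0. *)
pose eta := e / (4 * (K + 1)).
have eta0 : 0 < eta by rewrite divr_gt0// mulr_gt0// ltr_wpDl.
have [dh [eh [dh0 _ eh0 _ hP]]] := regD by0 eta0 del0.
(* dh / N puts a cube inside the Euclidean ball of walk-regularity; [del] settles points x on the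
   boundary itself. *)
exists (Num.min (dh / N%:R) del); first by rewrite lt_min del0 divr_gt0.
exists eh => // eps x eps0 epsh cx; rewrite lt_min => /andP[xdh xdel].
have [Dx|bx] := closure_bdry oD cx; last first.
  rewrite (u_eps_bdry _ _ eps0)// -GF//; apply: ltW.
  by apply: (lt_le_trans (hG _ xdel)); rewrite ler_pdivrMr// ler_peMr ?ler1n// ltW.
have xe : eball y0 dh x.
  rewrite /eball /= (le_lt_trans (enorm_le_norm _))//.
  by rewrite mulrC -ltr_pdivlMr.
rewrite (u_eps_limit_value iid wB N0 oD bD eps0 GF Dx).
have mG := @measurable_GXlim _ _ _ _ _ _ iid D eps _ _ cG GK x.
have iG : P.-integrable setT (EFin \o (fun t => G (Xlim w D eps x t))).
  by apply: (@bounded_measurable_integrable _ _ _ P _ K) => //; exact: mG.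
have ic : P.-integrable setT (EFin \o (fun _ : T => G y0)).
  exact: (@bounded_measurable_integrable _ _ _ P (fun=> G y0) K).
have -> : limit_value P w D eps G x - G y0 = \int[P]_t (G (Xlim w D eps x t) - G y0).
  by rewrite RintegralB// (@Rintegral_probability_cst _ _ _ P (G y0)).
have mE : measurable [set t | eball y0 del (Xlim w D eps x t)].
  rewrite -[X in measurable X]setTI; apply: (@measurable_Xlim R N) => //.
    by move=> k; exact: (measurable_step iid).
  by apply: sub_sigma_algebra; exact: open_eball.
have K2 : 0 <= 2 * K by rewrite mulr_ge0.
have := @Rintegral_concentrated _ _ _ P (fun t => G (Xlim w D eps x t) - G y0) _ (e / 2) (2 * K) eta.
move=> /(_ _ _ mE (ltW e2) K2) h.
apply: (le_trans (h _ _ _ (hP _ _ eps0 epsh xe Dx))).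
- by apply: measurable_funB => //; exact: mG.
- move=> t Et; apply: ltW; apply: hG.
  exact: (le_lt_trans (norm_le_enorm _) Et).
- move=> t; rewrite (le_trans (ler_normB _ _))//.
  by have := GK (Xlim w D eps x t); have := GK y0; move: e2; lra.
- rewrite {2}[e]splitr lerD2l.
  have -> : e / 2 = 2 * (K + 1) * eta by rewrite /eta; field; rewrite gt_eqF// ltr_wpDl.
  by rewrite ler_wpM2r ?(ltW eta0)// ler_wpM2l// lerDl.
Qed.

Lemma u_eps_uniformly_near_bdry e : 0 < e ->
  exists2 r, 0 < r & exists2 s, 0 < s & forall eps x y, 0 < eps -> eps < s ->
    closure D x -> bdry D y -> `|x - y| < r -> `|u_eps P w D F eps x - F y| <= e.
Proof.
move=> e0; have e2 : 0 < e / 2 by rewrite divr_gt0.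
have nc := @compact_near_coveringP V (bdry D).
have [+ _] := nc; move=> /(_ (compact_bdry bD)) cov.
(* One parameter r bounds both eps and the distance, so that compactness applies along the single
   filter r -> 0+. *)
pose Q (r : R) (y : V) := forall eps x, 0 < eps -> eps < r ->
    closure D x -> bdry D y -> `|x - y| < r -> `|u_eps P w D F eps x - F y| <= e.
have : \forall r \near 0^'+, bdry D `<=` Q r.
  apply: (cov _ _ Q) => y0 by0.
  have [r r0 [s s0 h]] := u_eps_near_bdry by0 e2.
  have [del del0 hG] := (continuousV_P G y0).1 (@cG y0) _ e2.
  have m0 : 0 < Num.min (r / 2) (Num.min s del) by rewrite !lt_min divr_gt0//= s0.
  exists ([set y | `|y - y0| < Num.min (r / 2) (Num.min s del)],
          [set r' | 0 < r' < Num.min (r / 2) (Num.min s del)]) => /=.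
    split; first by apply/nbhs_normV; exists (Num.min (r / 2) (Num.min s del)).
    near=> r'; apply/andP; split; first by near: r'; exact: nbhs_right_gt.
    by near: r'; exact: nbhs_right_lt.
  move=> [y r'] /= [ym /andP[r'0 r'm]] eps x eps0 epsr cx by_ xy.
  move: ym r'm; rewrite !lt_min => /and3P[y1 y2 y3] /and3P[r1 r2 r3].
  rewrite -GF//; have := h eps x eps0 (lt_trans epsr r2) cx.
  have -> : `|x - y0| < r.
    have -> : x - y0 = (x - y) + (y - y0) by rewrite addrA subrK.
    rewrite (le_lt_trans (ler_normD _ _))// [r]splitr ltrD// (lt_trans xy)//.
  move=> /(_ isT); have := hG _ y3; rewrite (distrC (G y)).
  set a := u_eps _ _ _ _ _ _ => g1 g2.
  have -> : a - G y = (a - G y0) + (G y0 - G y) by rewrite addrA subrK.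
  rewrite (le_trans (ler_normD _ _))// [e]splitr lerD// ltW//.
move=> H; have : \forall r \near (0 : R)^'+, 0 < r /\ bdry D `<=` Q r.
  by near=> r; split; near: r => //; exact: nbhs_right_gt.
move=> /filter_ex[r [r0 hr]]; exists r => //; exists r => // eps x y eps0 er cx by_ xy.
exact: (hr y by_).
Unshelve. all: by end_near. Qed.

End BoundaryValues.

(** * Equicontinuity up to o(1) *)

Section Equicontinuity.
Context {R : realType} {N : nat}.
Local Notation V := 'rV[R]_N.
Local Notation VM := (borelV R N).
Local Notation B := (eball (0 : V) 1).
Context {d : measure_display} {T : measurableType d}.
Variables (P : probability T R) (w : nat -> T -> V).
Hypothesis iid : iid_uniform_ball P w.
Hypothesis wB : forall k t, B (w k t).
Hypothesis N0 : (0 < N)%N.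
Variables (D : set V).
Hypotheses (oD : open D) (bD : bounded_set D).
Hypothesis regD : walk_regular P w D.
Variables (F : V -> R) (G : V -> R) (K : R).
Hypotheses (cG : continuous G) (GK : forall y, `|G y| <= K)
  (GF : forall y, bdry D y -> G y = F y).
Local Notation uE := (u_eps P w D F).

Lemma dist_bdry_ltP x r : bdry D !=set0 -> dist_bdry D x < r ->
  exists2 y, bdry D y & enorm (x - y) < r.
Proof.
move=> [z Dz]; apply: contraPP => h; apply/negP; rewrite -leNgt.
apply: dist_bdry_ge => [|y Dy]; first by exists z.
by rewrite leNgt; apply/negP => yr; apply: h; exists y.
Qed.

Lemma u_eps_equicontinuous_interior e : 0 < e ->
  exists2 r, 0 < r & exists2 s, 0 < s & forall eps x y, 0 < eps -> eps < s ->
    D x -> D y -> `|x - y| < r -> uE eps y - uE eps x <= e.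
Proof.
move=> e0; have e2 : 0 < e / 2 by rewrite divr_gt0.
have n0 : 0 < N%:R :> R by rewrite ltr0n.
have [r1 r10 [s1 s10 hb]] :=
  u_eps_uniformly_near_bdry iid wB N0 oD bD regD cG GK GF e2.
have [q q0 hq] := bounded_closure bD.
have [c iso] := step_law_isotropic iid N0.
(* If z is within r1 / 2 of a boundary point, then z + h is within r1 of the same point, so both
   values are close to the same [F y0]. *)
pose del := r1 / 2; have del0 : 0 < del by rewrite divr_gt0.
(* The second bound gives h Euclidean norm at most del / 2: if z is at distance del from the
   boundary, z + h keeps distance del / 2 > eps. Both balls then have radius exactly eps, and the
   difference has the mean value property. *)
pose rr := Num.min del (del / 2 / N%:R).
have rr0 : 0 < rr by rewrite lt_min del0 !divr_gt0.
exists rr => //; exists (Num.min s1 (del / 2)).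
  by rewrite lt_min s10 divr_gt0.
move=> eps x y eps0; rewrite lt_min => /andP[es1 edel] Dx Dy xy.
pose h := y - x.
have [h1 h2] : `|h| < del /\ enorm h <= del / 2.
  move: xy; rewrite distrC -/h lt_min => /andP[hd hn]; split=> //.
  rewrite (le_trans (enorm_le_norm _))// mulrC -ler_pdivlMr//; exact: ltW.
pose m := mean_function P w D eps G.
have mE z : D z -> m z = uE eps z by move=> Dz; exact: (mean_functionE iid wB N0 oD bD eps0 GF Dz).
have mm : measurable_fun (setT : set VM) m.
  exact: (measurable_mean_function iid wB N0 oD bD eps0 cG GK).
have mK z : `|m z| <= K by exact: (norm_mean_function iid D eps cG GK).
pose Z := [set z : V | D z /\ D (z + h)].
pose U := [set z : V | del <= dist_bdry D z].
have mshift : measurable_fun (setT : set VM) (fun z : V => m (z + h)).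
  rewrite (_ : (fun z => m (z + h)) = (fun z => m (h + 1 *: z))).
    exact: measurable_affine.
  by apply/funext => z; rewrite scale1r addrC.
rewrite -(mE y Dy) -(mE x Dx).
have -> : y = x + h by rewrite /h addrC subrK.
have step z : del / 2 <= dist_bdry D z -> step_radius D eps z = eps.
  by move=> zd; rewrite /step_radius min_l// (le_trans (ltW edel)).
apply: (@discrete_max_principle _ _ _ _ iso N0 Z U (fun z => m (z + h) - m z)
  eps e q (K + K) eps0) => //.
- by move=> z [Dz _]; apply/hq/subset_closure.
- exact: measurable_funB.
- by move=> z _; rewrite (le_trans (ler_normB _ _))// lerD.
- move=> z [Dz Dzh] Uz.
  have s1z : step_radius D eps z = eps.
    by apply: step; rewrite (le_trans _ Uz)// ler_pdivrMr// ler_peMr ?ler1n// ltW.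
  have s2z : step_radius D eps (z + h) = eps.
    have zh : z - (z + h) = - h by rewrite opprD addrA subrr add0r.
    apply: step; have := dist_bdry_lip D z (z + h).
    by rewrite zh enormN; move: Uz h2; rewrite /U /=; lra.
  split=> [v Bv|].
    split; first by rewrite -[in X in D X]s1z; exact: (step_in N0 oD bD eps0 Dz Bv).
    rewrite addrAC -[in X in D X]s2z; exact: (step_in N0 oD bD eps0 Dzh Bv).
  have := mean_function_mean iid wB N0 oD bD eps0 cG GK Dz.
  have := mean_function_mean iid wB N0 oD bD eps0 cG GK Dzh.
  rewrite (_ : (fun v => m (z + eps *: v + h) - m (z + eps *: v)) =
      (fun v => m (z + h + eps *: v) - m (z + eps *: v))); last first.
    by apply/funext => v; rewrite addrAC.
  rewrite s1z s2z -/m => -> ->; rewrite -avgB.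
  + exact: lexx.
  + exact: (iso_ball iso).
  + by apply: (@bounded_borel_affine _ _ _ _ _ setT K) => // ? _; exact: mK.
  + by apply: (@bounded_borel_affine _ _ _ _ _ setT K) => // ? _; exact: mK.
- move=> z [Dz Dzh] /negP; rewrite -ltNge => zd.
  have [y0 by0 zy] := dist_bdry_ltP (bdry_neq0 N0 oD bD Dz) zd.
  have zn := le_lt_trans (norm_le_enorm _) zy.
  have a1 : `|m z - F y0| <= e / 2.
    rewrite mE//; apply: hb => //; first exact: subset_closure.
    by rewrite (lt_trans zn)// ltr_pdivrMr// ltr_pMr// ltr1n.
  have a2 : `|m (z + h) - F y0| <= e / 2.
    rewrite mE//; apply: hb => //; first exact: subset_closure.
    by rewrite addrAC (le_lt_trans (ler_normD _ _))// [r1]splitr ltrD.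
  by move: a1 a2; rewrite !ler_norml => /andP[? ?] /andP[? ?]; lra.
by split => //; rewrite /h addrC subrK.
Qed.

Lemma u_eps_equicontinuous e : 0 < e ->
  exists2 r, 0 < r & exists2 s, 0 < s & forall eps x y, 0 < eps -> eps < s ->
    closure D x -> closure D y -> `|x - y| < r -> `|uE eps x - uE eps y| <= e.
Proof.
move=> e0; have e2 : 0 < e / 2 by rewrite divr_gt0.
have [r1 r10 [s1 s10 hb]] :=
  u_eps_uniformly_near_bdry iid wB N0 oD bD regD cG GK GF e2.
have [r2 r20 [s2 s20 hi]] := u_eps_equicontinuous_interior e0.
exists (Num.min r1 r2); first by rewrite lt_min r10.
exists (Num.min s1 s2); first by rewrite lt_min s10.
move=> eps x y eps0; rewrite !lt_min => /andP[es1 es2] cx cy /andP[xy1 xy2].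
have ee : e / 2 <= e by rewrite ler_pdivrMr// ler_peMr ?ler1n// ltW.
have [Dx|bx] := closure_bdry oD cx; last first.
  rewrite (u_eps_bdry _ _ eps0 _ bx) distrC (le_trans _ ee)//.
  by apply: hb => //; rewrite distrC.
have [Dy|by_] := closure_bdry oD cy; last first.
  by rewrite (u_eps_bdry _ _ eps0 _ by_) (le_trans _ ee)//; apply: hb.
rewrite ler_norml; apply/andP; split.
  by have := hi eps x y eps0 es2 Dx Dy xy2; lra.
have := hi eps y x eps0 es2 Dy Dx; rewrite distrC => /(_ xy2); lra.
Qed.

Lemma u_eps_bounded eps x : 0 < eps -> closure D x -> `|uE eps x| <= K.
Proof.
move=> eps0 cx; have [Dx|bx] := closure_bdry oD cx.
  rewrite -(mean_functionE iid wB N0 oD bD eps0 GF Dx).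
  exact: (norm_mean_function iid D eps cG GK).
by rewrite (u_eps_bdry _ _ eps0 _ bx) -GF.
Qed.

(** As the cube of double radius lies in D, points of the smaller cube are at distance at least r >
    eps from the boundary, and the radius is constantly eps there. *)
Lemma u_eps_local_mean x0 r eps : 0 < r -> 0 < eps -> eps < r ->
  (forall z, `|z - x0| < 2 * r -> D z) ->
  exists g, [/\ measurable_fun (setT : set VM) g,
    (forall x, `|x - x0| < r -> g x = uE eps x) &
    (forall x, `|x - x0| < r - eps ->
       g x = avg (step_law iid) (fun v => g (x + eps *: v)))].
Proof.
move=> r0 eps0 epsr hD; exists (mean_function P w D eps G).
have Dr x : `|x - x0| < r -> D x.
  by move=> xr; apply: hD; rewrite (lt_trans xr)// ltr_pMl// ltr1n.
split.
- exact: (measurable_mean_function iid wB N0 oD bD eps0 cG GK).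
- by move=> x /Dr Dx; rewrite (mean_functionE iid wB N0 oD bD eps0 GF Dx).
- move=> x xr; have {}xr : `|x - x0| < r by rewrite (lt_trans xr)// ltrBlDr ltrDl.
  rewrite {1}(mean_function_mean iid wB N0 oD bD eps0 cG GK (Dr _ xr)).
  suff -> : step_radius D eps x = eps by [].
  rewrite /step_radius min_l//; apply: (le_trans (ltW epsr)).
  apply: dist_bdry_ge => [|z bz]; first exact: (bdry_neq0 N0 oD bD (Dr _ xr)).
  rewrite leNgt; apply/negP => xz; case: (bz) => _; apply.
  rewrite (interior_openE oD); apply: hD.
  have -> : z - x0 = - (x - z) + (x - x0) by rewrite opprB addrA subrK.
  rewrite (le_lt_trans (ler_normD _ _))// normrN mulr_natl mulr2n ltrD//.
  exact: le_lt_trans (norm_le_enorm _) xz.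
Qed.

End Equicontinuity.

(** Compactness of [-K, K] gives a cluster point, and an ultrafilter converges to its cluster
    points. *)
Lemma ultrafilter_limit {R : realType} (UF : set_system R) (f : R -> R) K :
  UltraFilter UF -> UF [set e | `|f e| <= K] ->
  exists l, forall t, 0 < t -> UF [set e | `|f e - l| <= t].
Proof.
move=> uf fK; have pf : ProperFilter (f @ UF) by apply: fmap_proper_filter.
have [|l [_ cl]] := @segment_compact R (- K) K (f @ UF) pf.
  by apply: (@filterS _ UF _ _ [set e | f e \in `[- K, K]] _ fK) => e /= fe; rewrite in_itv /= -ler_norml.
exists l => t t0; have [//|nt] := @in_ultra_setVsetC _ UF [set e | `|f e - l| <= t] uf.
have /(_ (ball l t)) := cl (~` [set y | `|y - l| <= t]) _ nt.
move=> /(_ (nbhsx_ballx l t t0))[y [/= ny]].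
by rewrite -ball_normE /= distrC => /ltW.
Qed.

(** * Limits along ultrafilters solve the Dirichlet problem *)

Section UltraLimit.
Context {R : realType} {N : nat}.
Local Notation V := 'rV[R]_N.
Local Notation VM := (borelV R N).
Local Notation B := (eball (0 : V) 1).
Context {d : measure_display} {T : measurableType d}.
Variables (P : probability T R) (w : nat -> T -> V).
Hypothesis iid : iid_uniform_ball P w.
Hypothesis wB : forall k t, B (w k t).
Hypothesis N0 : (0 < N)%N.
Variables (D : set V).
Hypotheses (oD : open D) (bD : bounded_set D).
Hypothesis regD : walk_regular P w D.
Variables (F : V -> R) (G : V -> R) (K : R).
Hypotheses (cG : continuous G) (GK : forall y, `|G y| <= K)
  (GF : forall y, bdry D y -> G y = F y).
Local Notation uE := (u_eps P w D F).
Variable UF : set_system R.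
Context {uUF : UltraFilter UF}.
Hypothesis UF0 : forall s, 0 < s -> UF [set e | 0 < e < s].

Let equi := u_eps_equicontinuous iid wB N0 oD bD regD cG GK GF.

(** Pointwise limits inherit the modulus of continuity, the o(1) term vanishing along [UF];
    compactness of the closure then upgrades pointwise to uniform convergence, with e / 3 for each
    of the three comparisons. *)
Lemma u_eps_ultralimit : exists u, forall e, 0 < e ->
  UF [set eps | forall x, closure D x -> `|uE eps x - u x| <= e].
Proof.
have ptw x : exists l, closure D x -> forall t, 0 < t -> UF [set e | `|uE e x - l| <= t].
  have [cx|ncx] := pselect (closure D x); last by exists 0.
  have [|l hl] := @ultrafilter_limit _ UF (fun eps => uE eps x) K uUF.
    apply: filterS (UF0 ltr01) => eps /= /andP[eps0 _].
    exact: (u_eps_bounded iid wB N0 oD bD cG GK GF eps0 cx).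
  by exists l.
have [u hu] := choice ptw; exists u => e e0.
have e3 : 0 < e / 3 by rewrite divr_gt0.
have [r r0 [s s0 hr]] := equi e3.
have du x y : closure D x -> closure D y -> `|x - y| < r -> `|u x - u y| <= e / 3.
  move=> cx cy xy; apply/ler_addgt0Pr => t t0; have t2 : 0 < t / 2 by rewrite divr_gt0.
  have /filter_ex[eps /= [[h1 h2] /andP[h3 h4]]] :
    UF ([set eps | `|uE eps x - u x| <= t / 2] `&` [set eps | `|uE eps y - u y| <= t / 2]
        `&` [set eps | 0 < eps < s]).
    by apply: filterI => //; [apply: filterI; exact: hu|exact: UF0].
  have := hr eps x y h3 h4 cx cy xy; move: h1 h2.
  by rewrite !ler_norml => /andP[? ?] /andP[? ?] /andP[? ?]; apply/andP; split; lra.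
have [+ _] := @compact_near_coveringP V (closure D).
move=> /(_ (compact_closure bD)) cov.
pose Q (eps : R) (x : V) := closure D x -> `|uE eps x - u x| <= e.
have H : \forall eps \near UF, closure D `<=` Q eps.
  apply: (cov _ UF Q) => x cx.
  exists ([set y | `|y - x| < r],
     [set eps | `|uE eps x - u x| <= e / 3] `&` [set eps | 0 < eps < s]) => /=.
    split; first by apply/nbhs_normV; exists r.
    by apply: filterI; [exact: hu|exact: UF0].
  move=> [y eps] /= [yx [h1 /andP[h2 h3]]] cy.
  have := du y x cy cx yx; have := hr eps y x h2 h3 cy cx yx; move: h1.
  by rewrite !ler_norml => /andP[? ?] /andP[? ?] /andP[? ?]; apply/andP; split; lra.
by apply: filterS H => eps h x cx; exact: h.
Qed.

Lemma ultralimit_dirichlet u :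
  (forall e, 0 < e -> UF [set eps | forall x, closure D x -> `|uE eps x - u x| <= e]) ->
  dirichlet_solution D F u.
Proof.
move=> hu; have [c iso] := step_law_isotropic iid N0.
have cont e : 0 < e -> exists2 r, 0 < r & forall x y, closure D x -> closure D y ->
    `|x - y| < r -> `|u x - u y| < e.
  move=> e0; have e4 : 0 < e / 4 by rewrite divr_gt0.
  have [r r0 [s s0 hr]] := equi e4; exists r => // x y cx cy xy.
  have /filter_ex[eps /= [h1 /andP[h3 h4]]] :
    UF ([set eps | forall x, closure D x -> `|uE eps x - u x| <= e / 4]
        `&` [set eps | 0 < eps < s]).
    by apply: filterI; [exact: hu|exact: UF0].
  have := hr eps x y h3 h4 cx cy xy; have := h1 x cx; have := h1 y cy.
  rewrite !ler_norml ltr_norml => /andP[? ?] /andP[? ?] /andP[? ?].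
  by apply/andP; split; lra.
have bnd x : closure D x -> `|u x| <= K + 1.
  move=> cx; have /filter_ex[eps /= [h1 /andP[h3 h4]]] :
    UF ([set eps | forall x, closure D x -> `|uE eps x - u x| <= 1]
        `&` [set eps | 0 < eps < 1]).
    by apply: filterI; [exact: hu|exact: UF0].
  have := h1 x cx; have := u_eps_bounded iid wB N0 oD bD cG GK GF h3 cx.
  rewrite !ler_norml => /andP[? ?] /andP[? ?]; apply/andP; split; lra.
have lh : loc_harm (step_law iid) UF D u.
  move=> x0 Dx0.
  have /nbhs_normV[r2 r20 h2] : nbhs x0 D by exact: open_nbhs_nbhs.
  pose r := r2 / 2; have r0 : 0 < r by rewrite divr_gt0.
  have hD z : `|z - x0| < 2 * r -> D z.
    by move=> zx; apply: h2; rewrite (lt_le_trans zx)// /r mulrC divfK.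
  have Dr x : `|x - x0| < r -> D x.
    by move=> xr; apply: hD; rewrite (lt_trans xr)// ltr_pMl// ltr1n.
  exists r => //; split.
  - move=> x /Dr Dx; apply/continuousV_P => e e0; have [r3 r30 h3] := cont e e0.
    have /nbhs_normV[r4 r40 h4] : nbhs x D by exact: open_nbhs_nbhs.
    exists (Num.min r3 r4); first by rewrite lt_min r30.
    move=> y; rewrite lt_min => /andP[y3 y4].
    by apply: h3 => //; apply: subset_closure => //; exact: h4.
  - by exists (K + 1) => x /Dr Dx; apply/bnd/subset_closure.
  - move=> t t0; apply: (@filterS _ UF _ _ _ _ (filterI (hu t t0) (UF0 r0))) => eps /= [h3 /andP[h4 h5]].
    have [g [mg gE gm]] := u_eps_local_mean iid wB N0 oD bD cG GK GF r0 h4 h5 hD.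
    exists g; split=> // x xr; rewrite gE//.
    by apply/h3/subset_closure/Dr.
split.
- exact: (loc_harm_C2 iso N0 UF0 lh).
- by move=> x; exact: (loc_harm_laplacian iso N0 UF0 oD lh).
- apply/subspace_continuousP => x cx.
  apply/(@cvgrPdist_lt _ _ _ (within (closure D) (nbhs x)) _ u (u x)) => e e0.
  have [r r0 h] := cont e e0; rewrite near_withinE; apply/nbhs_normV; exists r => // y yx cy.
  by apply: h => //; rewrite distrC.
- move=> y by_; apply/eqP; rewrite -subr_eq0 -normr_le0; apply/ler_addgt0Pr => t t0.
  have /filter_ex[eps /= [h1 /andP[h3 h4]]] :
    UF ([set eps | forall x, closure D x -> `|uE eps x - u x| <= t]
        `&` [set eps | 0 < eps < 1]).
    by apply: filterI; [exact: hu|exact: UF0].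
  by have := h1 y (proj1 by_); rewrite (u_eps_bdry _ _ h3 _ by_) distrC add0r.
Qed.

End UltraLimit.

(** A filter is the intersection of the ultrafilters above it: if A is missing, F has a proper trace
    on the complement of A, and an ultrafilter above that trace omits A. *)
Lemma ultrafilter_sup {X : Type} (F : set_system X) (A : set X) : Filter F ->
  (forall UF, UltraFilter UF -> F `<=` UF -> UF A) -> F A.
Proof.
move=> FF hU; apply: contrapT => nFA.
have pF : ProperFilter (within (~` A) F).
  apply: Build_ProperFilter_ex => Y FY; apply: contrapT => nY; apply: nFA.
  by apply: (@filterS _ F _ _ _ _ FY) => x Yx; apply: contrapT => nAx; apply: nY; exists x; exact: Yx.
have [UF [uUF sUF]] := ultraFilterLemma pF.
have UA : UF A by apply: hU => // Y FY; apply: sUF; apply: (@filterS _ F _ _ _ _ FY) => x Yx _.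
have UnA : UF (~` A) by apply: sUF; rewrite /within /=; exact: filterE.
by have /filter_ex[x []] : UF (A `&` ~` A) by exact: filterI.
Qed.

(** Tietze's theorem applied on the compact boundary, where F is bounded. The extension can be
    evaluated along the walk before it reaches the boundary. *)
Lemma bounded_extension {R : realType} {N : nat} (D : set 'rV[R]_N) (F : 'rV[R]_N -> R) :
  bounded_set D -> {within bdry D, continuous F} -> exists K (G : 'rV[R]_N -> R),
    [/\ continuous G, (forall y, `|G y| <= K) & (forall y, bdry D y -> G y = F y)].
Proof.
move=> bD cF.
have [K K0 FK] : exists2 K, 0 < K & forall y, bdry D y -> `|F y| <= K.
  have [D0|nD0] := pselect (bdry D !=set0); last first.
    by exists 1 => // y Dy; exfalso; apply: nD0; exists y.
  have cn : {within bdry D, continuous (fun y => `|F y|)}.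
    by move=> y; apply: cvg_norm; exact: cF.
  have [p _ hp] := EVT_max_rV D0 (compact_bdry bD) cn.
  exists (`|F p| + 1) => [|y Dy]; first by rewrite ltr_wpDl.
  by rewrite (le_trans (hp y (mem_set Dy)))// lerDl.
have [G [FG cG GK]] := continuous_bounded_extension
  (@pseudometric_normal R 'rV[R]_N) (@closed_bdry R N D) K0 cF FK.
by exists K, G; split=> // y Dy; rewrite -FG// mem_set.
Qed.

Theorem theorem2p14 (R : realType) (N : nat) (D : set 'rV[R]_N)
    (d : measure_display) (T : measurableType d) (P : probability T R)
    (w : nat -> T -> 'rV[R]_N) :
  (0 < N)%N -> open D -> bounded_set D -> connected D ->
  iid_uniform_ball P w -> walk_regular P w D ->
  forall F : 'rV[R]_N -> R, {within bdry D, continuous F} ->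
  exists u : 'rV[R]_N -> R,
    [/\ dirichlet_solution D F u,
        (forall v, dirichlet_solution D F v -> forall x, closure D x -> v x = u x) &
        (forall e : R, 0 < e -> exists e0 : R, 0 < e0 /\
           forall eps : R, 0 < eps -> eps < 1 -> eps < e0 ->
           forall x, closure D x -> `|u_eps P w D F eps x - u x| < e)].
Proof.
move=> N0 oD bD _ iid regD F cF.
have [K [G [cG GK GF]]] := bounded_extension bD cF.
have iid' := iid_truncated iid; have wB := truncated_in w.
have regD' := walk_regular_truncated iid regD.
have sol UF : UltraFilter UF -> (0 : R)^'+ `<=` UF -> exists2 u, dirichlet_solution D F u &
    forall e, 0 < e ->
      UF [set eps | forall x, closure D x -> `|u_eps P w D F eps x - u x| <= e].
  move=> uUF sUF.
  have UF0 s : 0 < s -> UF [set e | 0 < e < s].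
    move=> s0; apply: sUF; near=> t; apply/andP; split; near: t.
    - exact: nbhs_right_gt.
    - exact: nbhs_right_lt.
  have [u hu] := u_eps_ultralimit iid' wB N0 oD bD regD' cG GK GF UF0.
  exists u; first exact: (ultralimit_dirichlet iid' wB N0 oD bD regD' cG GK GF UF0 hu).
  move=> e e0; apply: (@filterS _ UF _ _ _ _ (hu e e0)) => eps /= h x cx.
  by rewrite -(u_eps_truncated iid); exact: h.
have [UF [uUF sUF]] := ultraFilterLemma (at_right_proper_filter (0 : R)).
have [u du _] := sol UF uUF sUF; exists u; split=> // [v dv|e e0].
  exact: (dirichlet_unique N0 oD bD du dv).
have e2 : 0 < e / 2 by rewrite divr_gt0.
have : (0 : R)^'+ [set eps | forall x, closure D x -> `|u_eps P w D F eps x - u x| <= e / 2].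
  apply: ultrafilter_sup => UF' uUF' sUF'; have [u' du' hu'] := sol UF' uUF' sUF'.
  apply: (@filterS _ UF' _ _ _ _ (hu' _ e2)) => eps /= h x cx.
  by rewrite -(dirichlet_unique N0 oD bD du du' cx); exact: h.
rewrite /at_right /= => /nbhs_ballP[e1 /= e10 h]; exists e1; split=> // eps eps0 _ epse1 x cx.
apply: (@le_lt_trans _ _ (e / 2)); last by rewrite ltr_pdivrMr// ltr_pMr// ltr1n.
by apply: h => //; rewrite /= /ball /= sub0r normrN gtr0_norm.
Unshelve. all: by end_near. Qed.
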